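(* Let $\star\in\{\text{non unital},\ \text{cohomologically unital},\ \text{unital}\}$. Given a $\star$ $A_\infty$-category (resp. $\star$ DG category) $\mathscr A$, there exist a $\star$ $A_\infty$-category (resp. $\star$ DG category) $\mathscr A^{\mathrm{cm}}$ with cofibrant morphisms, having the same objects as $\mathscr A$, and a strict $A_\infty$-functor $\Psi_{\mathscr A}:\mathscr A^{\mathrm{cm}}\to\mathscr A$ which is surjective on the morphisms and is a quasi-equivalence. Moreover the construction $\mathscr A\mapsto\mathscr A^{\mathrm{cm}}$ can be made functorial in $A_\infty\mathrm{Cat}^{\star}_{\mathrm{strict}}$, $F\mapsto F^{\mathrm{cm}}$, in such a way that for every $F:\mathscr A\to\mathscr B$ in $A_\infty\mathrm{Cat}^{\star}_{\mathrm{strict}}$ one has $\Psi_{\mathscr B}\cdot F^{\mathrm{cm}}=F\cdot\Psi_{\mathscr A}$.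
   Context: $R$ is a commutative ring; categories are small. A non unital $A_\infty$-category $\mathscr A$ is a graded $R$-linear quiver (a set of objects and graded $R$-modules $\mathrm{Hom}(x,y)$) with $R$-linear maps $m^n_{\mathscr A}:\mathrm{Hom}(x_{n-1},x_n)\otimes\cdots\otimes\mathrm{Hom}(x_0,x_1)\to\mathrm{Hom}(x_0,x_n)[2-n]$ ($n\ge1$) such that $\sum_{m=1}^n\sum_{d=0}^{n-m}(-1)^{\dagger_d}m^{n-m+1}(f_n,\dots,f_{d+m+1},m^m(f_{d+m},\dots,f_{d+1}),f_d,\dots,f_1)=0$, with $\dagger_d=\sum_{i\le d}\deg f_i-d$. A non unital DG category is a non unital $A_\infty$-category with $m^n=0$ for $n\ge3$; a $\star$ DG category is a $\star$ $A_\infty$-category with $m^n=0$ for $n\ge3$. $H(\mathscr A)$ is the graded non unital category with the objects of $\mathscr A$, morphisms the cohomology of $(\mathrm{Hom}_{\mathscr A}(x,y),m^1)$, composition $[g][f]=(-1)^{\deg f}[m^2(g,f)]$. $\mathscr A$ is cohomologically unital if $H(\mathscr A)$ is unital. $\mathscr A$ is unital if it is cohomologically unital and for every object $x$ there is a representative $1_x$ of the cohomology unit such that, for every $y$, the chain maps $f\mapsto m^2(f,1_x)$ on $\mathrm{Hom}(x,y)$ and $f\mapsto(-1)^{\deg f}m^2(1_x,f)$ on $\mathrm{Hom}(y,x)$ are chain homotopic to the identity. A strict $A_\infty$-functor $F:\mathscr A\to\mathscr B$ is a map $F^0$ on objects and degree $0$ $R$-linear maps $F^1:\mathrm{Hom}_{\mathscr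 A}(x,y)\to\mathrm{Hom}_{\mathscr B}(F^0x,F^0y)$ commuting with all $m^n$. It is a quasi-equivalence if it induces an equivalence $H(\mathscr A)\to H(\mathscr B)$ of (non unital) graded categories. It is cohomologically unital if it induces a unital functor on cohomology categories. $A_\infty\mathrm{Cat}^{\star}_{\mathrm{strict}}$ is the category of $\star$ $A_\infty$-categories with strict functors, required to be cohomologically unital when $\star$ is ''cohomologically unital'' or ''unital''. ''Surjective on the morphisms'' means $F^1$ is surjective on every Hom module; $\Psi_{\mathscr A}$ is the identity on objects. $\mathscr A$ has cofibrant morphisms if every DG $R$-module $(\mathrm{Hom}_{\mathscr A}(x,y),m^1)$ is cofibrant in the projective model structure on unbounded DG $R$-modules (weak equivalences the quasi-isomorphisms, fibrations the degreewise surjections), i.e. it is h-projective and degreewise projective. *)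

(* Defs.v *)
From HB Require Import structures.
From mathcomp Require Import all_boot all_order all_algebra.
From mathcomp Require Import boolp.
From mathcomp Require Import zify.

Set Implicit Arguments.
Unset Strict Implicit.
Unset Printing Implicit Defensive.

Import GRing.Theory.
Local Open Scope ring_scope.
Local Open Scope quotient_scope.

(* The sign (-1)^k for an integer k; the parity of k is that of |k|. *)
Definition ksign (R : comPzRingType) (k : int) : R := (-1) ^+ `|k|%N.

Lemma ksign0 (R : comPzRingType) : ksign R 0 = 1.
Proof. by []. Qed.

Lemma ksignE (R : comPzRingType) (k : int) : ksign R k = (-1) ^+ odd `|k|%N.
Proof. by rewrite /ksign signr_odd. Qed.

Lemma ksignD (R : comPzRingType) (k l : int) :
  ksign R (k + l) = ksign R k * ksign R l.
Proof.
rewrite !ksignE -signr_addb; congr (_ ^+ nat_of_bool _).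
by rewrite -oddD; lia.
Qed.

Lemma ksignN (R : comPzRingType) (k : int) : ksign R (- k) = ksign R k.
Proof. by rewrite /ksign abszN. Qed.

Lemma ksign1 (R : comPzRingType) : ksign R 1 = -1.
Proof. by rewrite /ksign expr1. Qed.

Lemma ksignK (R : comPzRingType) (k : int) : ksign R k * ksign R k = 1.
Proof. by rewrite !ksignE -expr2 sqrr_sign. Qed.

(* An unbounded cochain complex.  The differential out of degree n is given by
   its components in every degree e; only the one with e = n + 1 is nonzero.
   This keeps all degrees free variables and avoids transports along equalities
   of integers.  The same device is used for every graded operation below. *)
Record dgmod (R : comPzRingType) := DGMod {
  dg_mod :> int -> lmodType R;
  dg_d : forall n e : int, {linear dg_mod n -> dg_mod e};
  dg_deg : forall (n e : int) (x : dg_mod n), e != n + 1 -> dg_d n e x = 0;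
  dg_dd : forall (n e : int) (x : dg_mod n), dg_d (n + 1) e (dg_d n (n + 1) x) = 0
}.
Arguments dg_d {R} M n e : rename.

Lemma dg_dd' (R : comPzRingType) (M : dgmod R) (n k e : int) (x : M n) :
  dg_d M k e (dg_d M n k x) = 0.
Proof.
have [->|nk] := eqVneq k (n + 1); first exact: dg_dd.
by rewrite (dg_deg x nk) linear0.
Qed.

Record dgmap (R : comPzRingType) (M N : dgmod R) := DGMap {
  dg_map :> forall n : int, {linear M n -> N n};
  dg_mapP : forall (n e : int) (x : M n),
    dg_map e (dg_d M n e x) = dg_d N n e (dg_map n x)
}.

Definition is_cocycle (R : comPzRingType) (M : dgmod R) (n : int) : {pred M n} :=
  [pred z | dg_d M n (n + 1) z == 0].

Lemma is_cocycle_submod (R : comPzRingType) (M : dgmod R) (n : int) :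
  submod_closed (@is_cocycle R M n).
Proof.
split=> [|a x y]; first by rewrite inE linear0.
by rewrite !inE linearP => /eqP-> /eqP->; rewrite scaler0 addr0.
Qed.
HB.instance Definition _ (R : comPzRingType) (M : dgmod R) (n : int) :=
  GRing.isSubmodClosed.Build R (M n) (@is_cocycle R M n)
    (is_cocycle_submod M n).

Record cocycle (R : comPzRingType) (M : dgmod R) (n : int) := Cocycle {
  cocycle_val : M n;
  cocycleP : cocycle_val \in @is_cocycle R M n
}.
HB.instance Definition _ (R : comPzRingType) (M : dgmod R) (n : int) :=
  [isSub for @cocycle_val R M n].
HB.instance Definition _ (R : comPzRingType) (M : dgmod R) (n : int) :=
  [Choice of cocycle M n by <:].
HB.instance Definition _ (R : comPzRingType) (M : dgmod R) (n : int) :=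
  [SubChoice_isSubLmodule of cocycle M n by <:].

Definition is_coboundary (R : comPzRingType) (M : dgmod R) (n : int) :
    {pred cocycle M n} :=
  fun z => `[< exists b : M (n - 1), dg_d M (n - 1) n b = cocycle_val z >].

Lemma is_coboundary_submod (R : comPzRingType) (M : dgmod R) (n : int) :
  submod_closed (@is_coboundary R M n).
Proof.
split=> [|a x y].
  by apply/asboolP; exists 0; rewrite linear0.
move=> /asboolP[b eb] /asboolP[c ec]; apply/asboolP; exists (a *: b + c).
by rewrite linearP eb ec.
Qed.
HB.instance Definition _ (R : comPzRingType) (M : dgmod R) (n : int) :=
  GRing.isSubmodClosed.Build R (cocycle M n) (@is_coboundary R M n)
    (is_coboundary_submod M n).

(* Cocycles modulo coboundaries; [ideal_quot] only requires an additive
   subgroup. *)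
Definition cohomology (R : comPzRingType) (M : dgmod R) (n : int) : Type :=
  {ideal_quot (@is_coboundary R M n)}.
HB.instance Definition _ (R : comPzRingType) (M : dgmod R) (n : int) :=
  GRing.Zmodule.on (cohomology M n).

Definition hclass (R : comPzRingType) (M : dgmod R) (n : int)
  (z : cocycle M n) : cohomology M n :=
  \pi_{ideal_quot (@is_coboundary R M n)} z.

Definition hrepr (R : comPzRingType) (M : dgmod R) (n : int)
  (h : cohomology M n) : cocycle M n :=
  repr (h : {ideal_quot (@is_coboundary R M n)}).

Lemma hreprK (R : comPzRingType) (M : dgmod R) (n : int) :
  cancel (@hrepr R M n) (@hclass R M n).
Proof. exact: reprK. Qed.

Lemma hclassP (R : comPzRingType) (M : dgmod R) (n : int) (z w : cocycle M n) :
  hclass z = hclass w <->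
  exists b : M (n - 1),
    dg_d M (n - 1) n b = cocycle_val z - cocycle_val w.
Proof.
rewrite /hclass; split=> [/eqP|[b eb]]; last apply/eqP.
  by rewrite -Quotient.idealrBE => /asboolP[b eb]; exists b; rewrite eb.
by rewrite -Quotient.idealrBE; apply/asboolP; exists b; rewrite eb.
Qed.

Lemma hclassD (R : comPzRingType) (M : dgmod R) (n : int) :
  {morph @hclass R M n : z w / z + w}.
Proof. by move=> z w; rewrite /hclass [RHS]piE. Qed.

Definition hscale (R : comPzRingType) (M : dgmod R) (n : int) (a : R)
  (h : cohomology M n) : cohomology M n := hclass (a *: hrepr h).

Lemma hclass_repr (R : comPzRingType) (M : dgmod R) (n : int)
    (z : cocycle M n) : exists b : M (n - 1),
  dg_d M (n - 1) n b = cocycle_val (hrepr (hclass z)) - cocycle_val z.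
Proof. by apply/hclassP; rewrite hreprK. Qed.

Lemma hscaleE (R : comPzRingType) (M : dgmod R) (n : int) (a : R) :
  {morph @hclass R M n : z / a *: z >-> hscale a z}.
Proof.
move=> z; apply/esym/hclassP; have [b eb] := hclass_repr z.
by exists (a *: b); rewrite linearZ /= eb scalerBr.
Qed.

Section CohomologyLmodule.
Variables (R : comPzRingType) (M : dgmod R) (n : int).
Implicit Types (a b : R) (u v : cohomology M n).

Lemma hscaleA a b v : hscale a (hscale b v) = hscale (a * b) v.
Proof. by rewrite -[v]hreprK -!hscaleE scalerA. Qed.

Lemma hscale1 : left_id 1 (@hscale R M n).
Proof. by move=> v; rewrite -[v]hreprK -hscaleE scale1r. Qed.

Lemma hscaleDr : right_distributive (@hscale R M n) +%R.
Proof.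
by move=> a u v; rewrite -[u]hreprK -[v]hreprK -hclassD -!hscaleE -hclassD scalerDr.
Qed.

Lemma hscaleDl v : {morph (@hscale R M n)^~ v : a b / a + b}.
Proof. by move=> a b; rewrite -[v]hreprK -!hscaleE -hclassD scalerDl. Qed.

HB.instance Definition _ := GRing.Zmodule_isLmodule.Build R (cohomology M n)
  hscaleA hscale1 hscaleDr hscaleDl.

Lemma hclass_is_linear : linear (@hclass R M n).
Proof. by move=> a u v; rewrite hclassD hscaleE. Qed.

HB.instance Definition _ :=
  GRing.isLinear.Build R (cocycle M n) (cohomology M n) _ (@hclass R M n)
    hclass_is_linear.
End CohomologyLmodule.

Lemma dgmap_cocycle (R : comPzRingType) (M N : dgmod R) (f : dgmap M N)
    (n : int) (z : cocycle M n) : f n (cocycle_val z) \in @is_cocycle R N n.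
Proof.
by rewrite inE -dg_mapP; have /eqP-> := cocycleP z; rewrite linear0.
Qed.

Definition map_cocycle (R : comPzRingType) (M N : dgmod R) (f : dgmap M N)
  (n : int) (z : cocycle M n) : cocycle N n := Cocycle (dgmap_cocycle f z).

Section MapCohomology.
Variables (R : comPzRingType) (M N : dgmod R) (f : dgmap M N) (n : int).

Definition hmap (h : cohomology M n) : cohomology N n :=
  hclass (map_cocycle f (hrepr h)).

Lemma hmapE (z : cocycle M n) : hmap (hclass z) = hclass (map_cocycle f z).
Proof.
apply/hclassP; have [b eb] := hclass_repr z.
by exists (f (n - 1) b); rewrite -dg_mapP eb linearB.
Qed.

Lemma hmap_is_linear : linear hmap.
Proof.
move=> a u v; rewrite -[u]hreprK -[v]hreprK -linearP !hmapE -linearP.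
by congr hclass; apply: val_inj; rewrite /= !linearP.
Qed.

HB.instance Definition _ :=
  GRing.isLinear.Build R (cohomology M n) (cohomology N n) _ hmap hmap_is_linear.
End MapCohomology.

Definition quasi_iso (R : comPzRingType) (M N : dgmod R) (f : dgmap M N) : Prop :=
  forall n : int, bijective (@hmap R M N f n).

Definition degreewise_surjective (R : comPzRingType) (M N : dgmod R)
    (f : dgmap M N) : Prop :=
  forall (n : int) (y : N n), exists x : M n, f n x = y.

(* Cofibrant object of the projective model structure on DG R-modules: the map
   from 0 has the left lifting property against the trivial fibrations, that
   is, the degreewise surjective quasi-isomorphisms. *)
Definition cofibrant (R : comPzRingType) (M : dgmod R) : Prop :=
  forall (E B : dgmod R) (p : dgmap E B),
    degreewise_surjective p -> quasi_iso p ->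
  forall f : dgmap M B, exists g : dgmap M E,
    forall (n : int) (x : M n), p n (g n x) = f n x.

(* [h] consists of maps of degree -1; only the components [h n e] with
   n = e + 1 are used. *)
Definition homotopic (R : comPzRingType) (M N : dgmod R)
    (phi psi : forall n : int, M n -> N n) : Prop :=
  exists h : forall n e : int, {linear M n -> N e},
  forall (n : int) (x : M n),
    phi n x - psi n x =
      dg_d N (n - 1) n (h n (n - 1) x) + h (n + 1) n (dg_d M n (n + 1) x).

(* [gcomp g f e] is the component of degree e of the composite g f, which is
   zero unless e is the sum of the degrees. *)
Record gcat (R : comPzRingType) := GCat {
  gobj :> Type;
  ghom : gobj -> gobj -> int -> lmodType R;
  gcomp : forall (x y z : gobj) (p q : int),
    ghom y z q -> ghom x y p -> forall e : int, ghom x z e;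
  gcomp_deg : forall (x y z : gobj) (p q : int) (g : ghom y z q)
      (f : ghom x y p) (e : int), e != p + q -> gcomp g f e = 0;
  gcomp_linl : forall (x y z : gobj) (p q e : int) (f : ghom x y p) (a : R)
      (g g' : ghom y z q),
    gcomp (a *: g + g') f e = a *: gcomp g f e + gcomp g' f e;
  gcomp_linr : forall (x y z : gobj) (p q e : int) (g : ghom y z q) (a : R)
      (f f' : ghom x y p),
    gcomp g (a *: f + f') e = a *: gcomp g f e + gcomp g f' e;
  gcompA : forall (x y z w : gobj) (p q r e : int) (h : ghom z w r)
      (g : ghom y z q) (f : ghom x y p),
    gcomp h (gcomp g f (p + q)) e = gcomp (gcomp h g (q + r)) f e
}.
Arguments gcomp {R C x y z p q} g f e : rename.

Record gfun (R : comPzRingType) (C D : gcat R) := GFun {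
  gf_obj :> C -> D;
  gf_hom : forall (x y : C) (n : int),
    {linear ghom x y n -> ghom (gf_obj x) (gf_obj y) n};
  gf_comp : forall (x y z : C) (p q e : int) (g : ghom y z q) (f : ghom x y p),
    gf_hom x z e (gcomp g f e) = gcomp (gf_hom y z q g) (gf_hom x y p f) e
}.
Arguments gf_hom {R C D} F {x y} n : rename.

Section GFunctors.
Variable R : comPzRingType.

Definition gid (C : gcat R) : gfun C C :=
  @GFun R C C id (fun x y n => idfun) (fun _ _ _ _ _ _ _ _ => erefl).

Lemma gcompose_comp (C D E : gcat R) (G : gfun D E) (F : gfun C D)
    (x y z : C) (p q e : int) (g : ghom y z q) (f : ghom x y p) :
  (gf_hom G e \o gf_hom F e) (gcomp g f e) =
  gcomp ((gf_hom G q \o gf_hom F q) g) ((gf_hom G p \o gf_hom F p) f) e.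
Proof. by rewrite /= !gf_comp. Qed.

Definition gcompose (C D E : gcat R) (G : gfun D E) (F : gfun C D) : gfun C E :=
  @GFun R C E (G \o F) (fun x y n => gf_hom G n \o gf_hom F n)
    (gcompose_comp G F).

Definition is_unit (C : gcat R) (x : C) (u : ghom x x 0) : Prop :=
  (forall (y : C) (p : int) (f : ghom x y p), gcomp f u p = f) /\
  (forall (y : C) (p : int) (f : ghom y x p), gcomp u f p = f).

Definition gunital (C : gcat R) : Prop :=
  forall x : C, exists u : ghom x x 0, is_unit u.

Definition gfun_unital (C D : gcat R) (F : gfun C D) : Prop :=
  forall (x : C) (u : ghom x x 0), is_unit u -> is_unit (gf_hom F 0 u).

(* A multiplier from x to y is a formal arrow of degree 0, given by the
   composites with it on either side.  Every object of a non unital category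
   has an identity multiplier, and in a unital category multipliers are the
   same as morphisms of degree 0. *)
Record multiplier (C : gcat R) (x y : C) := Multiplier {
  mul_post : forall (z : C) (n : int), {linear ghom z x n -> ghom z y n};
  mul_pre : forall (z : C) (n : int), {linear ghom y z n -> ghom x z n};
  mul_postP : forall (w z : C) (p q e : int) (g : ghom z x q) (f : ghom w z p),
    mul_post w e (gcomp g f e) = gcomp (mul_post z q g) f e;
  mul_preP : forall (z w : C) (p q e : int) (g : ghom z w q) (f : ghom y z p),
    mul_pre w e (gcomp g f e) = gcomp g (mul_pre z p f) e;
  mul_balanced : forall (z w : C) (p q e : int) (g : ghom y w q) (f : ghom z x p),
    gcomp g (mul_post z p f) e = gcomp (mul_pre w q g) f e
}.

Definition mul_inverse (C : gcat R) (x y : C) (u : multiplier x y)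
    (v : multiplier y x) : Prop :=
  forall (z : C) (n : int),
    [/\ cancel (mul_post u z n) (mul_post v z n),
        cancel (mul_post v z n) (mul_post u z n),
        cancel (mul_pre u z n) (mul_pre v z n) &
        cancel (mul_pre v z n) (mul_pre u z n)].

(* Natural isomorphism of functors between non unital graded categories; with
   multipliers as components the identity of a functor is always one.  When the
   target is unital this is the usual notion, see [gnatiso_unital]. *)
Definition gnatiso (C D : gcat R) (F G : gfun C D) : Prop :=
  exists (eta : forall x : C, multiplier (F x) (G x))
         (theta : forall x : C, multiplier (G x) (F x)),
    (forall x : C, mul_inverse (eta x) (theta x)) /\
    (forall (x y : C) (n : int) (a : ghom x y n),
       mul_post (eta y) (F x) n (gf_hom F n a) =
       mul_pre (eta x) (G y) n (gf_hom G n a)).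

Definition gequivalence (C D : gcat R) (F : gfun C D) : Prop :=
  exists G : gfun D C,
    gnatiso (gcompose G F) (gid C) /\ gnatiso (gcompose F G) (gid D).

Section MultiplierOfMorphism.
Variables (C : gcat R) (x y : C) (f : ghom x y 0).

Lemma gcompA' (s t v w : C) (p q r k l e : int) (h : ghom v w r)
    (g : ghom t v q) (a : ghom s t p) : k = p + q -> l = q + r ->
  gcomp h (gcomp g a k) e = gcomp (gcomp h g l) a e.
Proof. by move=> -> ->; exact: gcompA. Qed.

Definition post_of z n (g : ghom z x n) : ghom z y n := gcomp f g n.
Definition pre_of z n (g : ghom y z n) : ghom x z n := gcomp g f n.

Lemma post_of_linear z n : linear (@post_of z n).
Proof. by move=> a u v; exact: gcomp_linr. Qed.
Lemma pre_of_linear z n : linear (@pre_of z n).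
Proof. by move=> a u v; exact: gcomp_linl. Qed.
HB.instance Definition _ z n :=
  GRing.isLinear.Build R _ _ _ (@post_of z n) (@post_of_linear z n).
HB.instance Definition _ z n :=
  GRing.isLinear.Build R _ _ _ (@pre_of z n) (@pre_of_linear z n).

Lemma post_ofP (w z : C) (p q e : int) (g : ghom z x q) (a : ghom w z p) :
  post_of (gcomp g a e) = gcomp (post_of g) a e.
Proof.
rewrite /post_of; have [->|ne] := eqVneq e (p + q).
  by apply: gcompA'; rewrite ?addr0.
by rewrite (gcomp_deg g a ne) (gcomp_deg _ a ne) [LHS](linear0 (@post_of w e)).
Qed.

Lemma pre_ofP (z w : C) (p q e : int) (g : ghom z w q) (a : ghom y z p) :
  pre_of (gcomp g a e) = gcomp g (pre_of a) e.
Proof.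
rewrite /pre_of; have [->|ne] := eqVneq e (p + q).
  by apply/esym; apply: gcompA'; rewrite ?add0r.
by rewrite (gcomp_deg g a ne) (gcomp_deg g _ ne) [LHS](linear0 (@pre_of w e)).
Qed.

Lemma of_balanced (z w : C) (p q e : int) (g : ghom y w q) (a : ghom z x p) :
  gcomp g (post_of a) e = gcomp (pre_of g) a e.
Proof. by apply: gcompA'; rewrite ?addr0 ?add0r. Qed.

Definition multiplier_of : multiplier x y :=
  @Multiplier C x y (fun z n => @post_of z n) (fun z n => @pre_of z n)
    post_ofP pre_ofP of_balanced.
End MultiplierOfMorphism.

Lemma gnatiso_unital (C D : gcat R) (F G : gfun C D) : gunital D ->
  gnatiso F G <->
  exists (eta : forall x : C, ghom (F x) (G x) 0)
         (theta : forall x : C, ghom (G x) (F x) 0),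
    (forall x : C,
       is_unit (gcomp (theta x) (eta x) 0) /\
       is_unit (gcomp (eta x) (theta x) 0)) /\
    (forall (x y : C) (n : int) (a : ghom x y n),
       gcomp (eta y) (gf_hom F n a) n = gcomp (gf_hom G n a) (eta x) n).
Proof.
move=> unitD; pose u x := projT1 (cid (unitD x)); have uP x : is_unit (u x) := projT2 (cid (unitD x)).
move: u uP => u uP; split=> -[eta [theta [inv nat]]]; last first.
  exists (fun x => multiplier_of (eta x)), (fun x => multiplier_of (theta x)).
  split=> [x z n|x y n a]; last exact: nat.
  have [[ute teu] [uet etu]] := inv x.
  split=> g.
  - change (gcomp (theta x) (gcomp (eta x) g n) n = g).
    by rewrite (gcompA' (l := 0) n (theta x) (eta x) g) ?teu ?addr0.
  - change (gcomp (eta x) (gcomp (theta x) g n) n = g).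
    by rewrite (gcompA' (l := 0) n (eta x) (theta x) g) ?etu ?addr0.
  - change (gcomp (gcomp g (eta x) n) (theta x) n = g).
    by rewrite -(gcompA' (k := 0) n g (eta x) (theta x)) ?uet ?add0r.
  - change (gcomp (gcomp g (theta x) n) (eta x) n = g).
    by rewrite -(gcompA' (k := 0) n g (theta x) (eta x)) ?ute ?add0r.
exists (fun x => mul_post (eta x) _ 0 (u (F x))).
exists (fun x => mul_post (theta x) _ 0 (u (G x))).
have postE x z n (g : ghom z (F x) n) :
    gcomp (mul_post (eta x) _ 0 (u (F x))) g n = mul_post (eta x) _ n g.
  by rewrite -mul_postP (uP _).2.
have postE' x z n (g : ghom z (G x) n) :
    gcomp (mul_post (theta x) _ 0 (u (G x))) g n = mul_post (theta x) _ n g.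
  by rewrite -mul_postP (uP _).2.
split=> [x|x y n a].
  by have [k1 k2 _ _] := inv x (F x) 0; have [k3 k4 _ _] := inv x (G x) 0;
     rewrite postE' k1 postE k4.
by rewrite postE nat mul_balanced (uP _).1.
Qed.

End GFunctors.

(* Composable strings (f_1, ..., f_n), n >= 0, of homogeneous morphisms of a
   graded quiver, f_1 first. *)
Inductive word (R : comPzRingType) (O : Type) (V : O -> O -> int -> lmodType R)
    (x : O) : O -> Type :=
| Nil : word V x x
| Snoc (y z : O) (p : int) : word V x y -> V y z p -> word V x z.
Arguments Nil {R O V x}.
Arguments Snoc {R O V x y z p} s f.

Section Words.
Variables (R : comPzRingType) (O : Type) (V : O -> O -> int -> lmodType R).

Fixpoint wlen (x y : O) (s : word V x y) : nat :=
  if s is Snoc _ _ _ s' _ then (wlen s').+1 else 0.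

Fixpoint wdeg (x y : O) (s : word V x y) : int :=
  if s is Snoc _ _ p s' _ then wdeg s' + p else 0.

Fixpoint wcat (x y z : O) (s : word V x y) (t : word V y z) : word V x z :=
  match t in word _ _ z' return word V x z' with
  | Nil => s
  | Snoc _ _ _ t' f => Snoc (wcat s t') f
  end.

Record splitting (x z : O) := Splitting {
  sp_mid : O;
  sp_left : word V x sp_mid;
  sp_right : word V sp_mid z
}.

Fixpoint splittings (x z : O) (s : word V x z) : seq (splitting x z) :=
  match s in word _ _ z' return seq (splitting x z') with
  | Nil => [:: Splitting Nil Nil]
  | Snoc _ _ _ s' f =>
      Splitting (Snoc s' f) Nil ::
      [seq Splitting (sp_left p) (Snoc (sp_right p) f) | p <- splittings s']
  end.

End Words.

Fixpoint wmap (R : comPzRingType) (O P : Type) (V : O -> O -> int -> lmodType R)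
    (W : P -> P -> int -> lmodType R) (F0 : O -> P)
    (F1 : forall (x y : O) (n : int), V x y n -> W (F0 x) (F0 y) n)
    (x y : O) (s : word V x y) : word W (F0 x) (F0 y) :=
  if s is Snoc _ _ _ s' f then Snoc (wmap F1 s') (F1 _ _ _ f) else Nil.

(* [ainf_m s e], for s = (f_1, ..., f_n), is the component of degree e of
   m^n (f_n, ..., f_1); it is zero unless e = deg f_1 + ... + deg f_n + 2 - n,
   and there is no m^0.  In [ainf_rel] the word s is split in all possible ways
   as (s1, s2, s3) with s2 nonempty, and the summand is
   (-1)^(deg s1 - length s1) m (s3, m (s2), s1). *)
Record ainf_on (R : comPzRingType) (O : Type) := AInfOn {
  ainf_hom : O -> O -> int -> lmodType R;
  ainf_m : forall x y : O, word ainf_hom x y -> forall e : int, ainf_hom x y e;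
  ainf_m0 : forall (x : O) (e : int), ainf_m (Nil : word ainf_hom x x) e = 0;
  ainf_deg : forall (x y : O) (s : word ainf_hom x y) (e : int),
    e != wdeg s + 2 - (wlen s)%:Z -> ainf_m s e = 0;
  ainf_linear : forall (x y z w : O) (p e : int) (s : word ainf_hom x y)
      (t : word ainf_hom z w) (a : R) (f g : ainf_hom y z p),
    ainf_m (wcat (Snoc s (a *: f + g)) t) e =
    a *: ainf_m (wcat (Snoc s f) t) e + ainf_m (wcat (Snoc s g) t) e;
  ainf_rel : forall (x y : O) (s : word ainf_hom x y) (e : int),
    \sum_(p <- splittings s)
      \sum_(q <- splittings (sp_right p) | (0 < wlen (sp_left q))%N)
        ksign R (wdeg (sp_left p) - (wlen (sp_left p))%:Z) *:
        ainf_m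
          (wcat
            (Snoc (sp_left p)
               (ainf_m (sp_left q)
                  (wdeg (sp_left q) + 2 - (wlen (sp_left q))%:Z)))
            (sp_right q)) e = 0
}.
Arguments ainf_m {R O} A {x y} s e : rename.

Record ainf (R : comPzRingType) := AInf {
  ainf_obj :> Type;
  ainf_str :> ainf_on R ainf_obj
}.
Arguments AInf {R ainf_obj} ainf_str.

Definition is_dg (R : comPzRingType) (A : ainf R) : Prop :=
  forall (x y : A) (s : word (ainf_hom A) x y) (e : int),
    (3 <= wlen s)%N -> ainf_m A s e = 0.

Section Operations.
Variables (R : comPzRingType) (A : ainf R).
Implicit Types x y z w : A.

Definition m1 x y p (f : ainf_hom A x y p) (e : int) : ainf_hom A x y e :=
  ainf_m A (Snoc Nil f) e.

Definition m2 x y z p q (g : ainf_hom A y z q) (f : ainf_hom A x y p) (e : int) :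
    ainf_hom A x z e :=
  ainf_m A (Snoc (Snoc Nil f) g) e.

Definition m3 x y z w p q r (h : ainf_hom A z w r) (g : ainf_hom A y z q)
    (f : ainf_hom A x y p) (e : int) : ainf_hom A x w e :=
  ainf_m A (Snoc (Snoc (Snoc Nil f) g) h) e.

Lemma m1_linear x y p e : linear (fun f : ainf_hom A x y p => m1 f e).
Proof. by move=> a f g; exact: (ainf_linear _ Nil Nil). Qed.

Lemma m2_linearl x y z p q e (f : ainf_hom A x y p) :
  linear (fun g : ainf_hom A y z q => m2 g f e).
Proof. by move=> a g h; exact: (ainf_linear _ (Snoc Nil f) Nil). Qed.

Lemma m2_linearr x y z p q e (g : ainf_hom A y z q) :
  linear (fun f : ainf_hom A x y p => m2 g f e).
Proof. by move=> a f h; exact: (ainf_linear _ Nil (Snoc Nil g)). Qed.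

Lemma m3_linear1 x y z w p q r e (h : ainf_hom A z w r) (g : ainf_hom A y z q) :
  linear (fun f : ainf_hom A x y p => m3 h g f e).
Proof. by move=> a f f'; exact: (ainf_linear _ Nil (Snoc (Snoc Nil g) h)). Qed.

Lemma m3_linear2 x y z w p q r e (h : ainf_hom A z w r) (f : ainf_hom A x y p) :
  linear (fun g : ainf_hom A y z q => m3 h g f e).
Proof. by move=> a g g'; exact: (ainf_linear _ (Snoc Nil f) (Snoc Nil h)). Qed.

Lemma m3_linear3 x y z w p q r e (g : ainf_hom A y z q) (f : ainf_hom A x y p) :
  linear (fun h : ainf_hom A z w r => m3 h g f e).
Proof. by move=> a h h'; exact: (ainf_linear _ (Snoc (Snoc Nil f) g) Nil). Qed.

Lemma lin0 (U W : lmodType R) (f : U -> W) : linear f -> f 0 = 0.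
Proof.
by move=> fl; have := fl (-1) 0 0; rewrite scaler0 addr0 scaleN1r addNr.
Qed.

Lemma m1_deg x y p e (f : ainf_hom A x y p) : e != p + 1 -> m1 f e = 0.
Proof. by move=> ne; apply: ainf_deg => /=; lia. Qed.

Lemma m2_deg x y z p q e (g : ainf_hom A y z q) (f : ainf_hom A x y p) :
  e != p + q -> m2 g f e = 0.
Proof. by move=> ne; apply: ainf_deg => /=; lia. Qed.

Lemma m1_rel x y p (f : ainf_hom A x y p) (k e : int) : k = p + 1 ->
  m1 (m1 f k) e = 0.
Proof.
move=> ek; have {ek} -> : k = p + 2 - 1%:Z by lia.
have := ainf_rel (Snoc Nil f : word (ainf_hom A) x y) e.
by rewrite /= !(big_cons, big_nil) /= ?(addr0, add0r) ksign0 scale1r.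
Qed.

Lemma m2_rel x y z p q (g : ainf_hom A y z q) (f : ainf_hom A x y p)
    (k l n e : int) : k = p + 1 -> l = q + 1 -> n = p + q ->
  m1 (m2 g f n) e + m2 g (m1 f k) e - ksign R p *: m2 (m1 g l) f e = 0.
Proof.
move=> ek el en.
have {ek} -> : k = p + 2 - 1%:Z by lia.
have {el} -> : l = q + 2 - 1%:Z by lia.
have {en} -> : n = p + q + 2 - 2%:Z by lia.
have := ainf_rel (Snoc (Snoc Nil f) g : word (ainf_hom A) x z) e.
rewrite /= !(big_cons, big_nil) /= ?(addr0, add0r).
by rewrite ksignD ksignN ksign1 ksign0 mulrN1 scaleNr !scale1r addrC.
Qed.

Lemma m3_rel x y z w p q r (h : ainf_hom A z w r) (g : ainf_hom A y z q)
    (f : ainf_hom A x y p) (k l n s t u e : int) :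
    k = p + 1 -> l = q + 1 -> n = r + 1 -> s = p + q -> t = q + r ->
    u = p + q + r - 1 ->
  m1 (m3 h g f u) e + m3 h g (m1 f k) e - ksign R p *: m3 h (m1 g l) f e
    + ksign R (p + q) *: m3 (m1 h n) g f e
    + m2 h (m2 g f s) e - ksign R p *: m2 (m2 h g t) f e = 0.
Proof.
move=> ek el en es et eu.
have {ek} -> : k = p + 2 - 1%:Z by lia.
have {el} -> : l = q + 2 - 1%:Z by lia.
have {en} -> : n = r + 2 - 1%:Z by lia.
have {es} -> : s = p + q + 2 - 2%:Z by lia.
have {et} -> : t = q + r + 2 - 2%:Z by lia.
have {eu} -> : u = p + q + r + 2 - 3%:Z by lia.
have := ainf_rel (Snoc (Snoc (Snoc Nil f) g) h : word (ainf_hom A) x w) e.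
rewrite /= !(big_cons, big_nil) /= ?(addr0, add0r).
have -> : ksign R (p + q - 2%:Z) = ksign R (p + q).
  by rewrite [LHS]ksignD ksignN /ksign sqrrN expr1n mulr1.
have -> : ksign R (p - 1%:Z) = - ksign R p.
  by rewrite ksignD ksignN ksign1 mulrN1.
rewrite ksign0 !scale1r !scaleNr => eq0; rewrite -[RHS]eq0 /m1 /m2 /m3.
by rewrite [LHS](ACl (4*6*3*1*5*2)%AC) /= !addrA.
Qed.

End Operations.

Definition hom_d (R : comPzRingType) (A : ainf R) (x y : A) (n e : int)
  (f : ainf_hom A x y n) : ainf_hom A x y e := m1 f e.
HB.instance Definition _ (R : comPzRingType) (A : ainf R) (x y : A) (n e : int) :=
  GRing.isLinear.Build R (ainf_hom A x y n) (ainf_hom A x y e) _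
    (@hom_d R A x y n e) (@m1_linear R A x y n e).

(* The DG module (Hom(x, y), m^1). *)
Definition hom_dg (R : comPzRingType) (A : ainf R) (x y : A) : dgmod R :=
  @DGMod R (ainf_hom A x y) (fun n e => @hom_d R A x y n e)
    (fun n e f => @m1_deg R A x y n e f)
    (fun n e f => @m1_rel R A x y n f (n + 1) e erefl).

Section CohomologyCategory.
Variables (R : comPzRingType) (A : ainf R).
Implicit Types x y z w : A.

Lemma cocycle_m1 x y p (f : cocycle (hom_dg x y) p) (e : int) :
  m1 (cocycle_val f) e = 0.
Proof.
have [->|ne] := eqVneq e (p + 1); last exact: m1_deg.
exact/eqP/(cocycleP f).
Qed.

Lemma m2_0r x y z p q e (g : ainf_hom A y z q) :
  m2 g (0 : ainf_hom A x y p) e = 0.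
Proof. exact: (lin0 (m2_linearr e g)). Qed.

Lemma m2_0l x y z p q e (f : ainf_hom A x y p) :
  m2 (0 : ainf_hom A y z q) f e = 0.
Proof. exact: (lin0 (m2_linearl e f)). Qed.

Lemma m2_cocycle x y z p q (g : cocycle (hom_dg y z) q)
    (f : cocycle (hom_dg x y) p) (e : int) :
  (m2 (cocycle_val g) (cocycle_val f) e : hom_dg x z e)
    \in @is_cocycle R (hom_dg x z) e.
Proof.
rewrite inE /= /hom_d; apply/eqP; have [ee|ne] := eqVneq e (p + q); last first.
  by rewrite m2_deg // (lin0 (m1_linear _)).
have := m2_rel (cocycle_val g) (cocycle_val f) (e + 1) erefl erefl ee.
by rewrite !cocycle_m1 m2_0l m2_0r scaler0 subr0 addr0.
Qed.

Definition cocycle_m2 x y z p q (g : cocycle (hom_dg y z) q)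
    (f : cocycle (hom_dg x y) p) (e : int) : cocycle (hom_dg x z) e :=
  Cocycle (m2_cocycle g f e).

Definition hcomp x y z p q (g : cohomology (hom_dg y z) q)
    (f : cohomology (hom_dg x y) p) (e : int) : cohomology (hom_dg x z) e :=
  ksign R p *: hclass (cocycle_m2 (hrepr g) (hrepr f) e).

Lemma hcompE x y z p q (g : cocycle (hom_dg y z) q)
    (f : cocycle (hom_dg x y) p) (e : int) :
  hcomp (hclass g) (hclass f) e = ksign R p *: hclass (cocycle_m2 g f e).
Proof.
congr (_ *: _); have [ee|ne] := eqVneq e (p + q); last first.
  by congr hclass; apply: val_inj; rewrite /= !m2_deg.
apply/hclassP => /=.
have [b /= eb] := hclass_repr g; have [c /= ec] := hclass_repr f.
set g' := hrepr _ in eb *; set f' := hrepr _ in ec *.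
have E1 : m1 (m2 (cocycle_val g') c (e - 1)) e =
    - m2 (cocycle_val g') (cocycle_val f' - cocycle_val f) e.
  have := @m2_rel _ _ _ _ _ _ _ (cocycle_val g') c p (q + 1) (e - 1) e.
  rewrite cocycle_m1 m2_0l scaler0 subr0 -/(hom_d _) => /(_ _ _ _)/eqP.
  rewrite addr_eq0 => E; rewrite (eqP (E _ _ _)); [|lia|lia|lia].
  by rewrite -ec.
have E2 : m1 (m2 b (cocycle_val f) (e - 1)) e =
    ksign R p *: m2 (cocycle_val g' - cocycle_val g) (cocycle_val f) e.
  have := @m2_rel _ _ _ _ _ _ _ b (cocycle_val f) (p + 1) q (e - 1) e.
  rewrite cocycle_m1 m2_0r addr0 => /(_ _ _ _)/eqP.
  rewrite subr_eq0 => E; rewrite (eqP (E _ _ _)); [|lia|lia|lia].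
  by rewrite -eb.
exists (ksign R p *: m2 b (cocycle_val f) (e - 1) - m2 (cocycle_val g') c (e - 1)).
rewrite linearB linearZ /= /hom_d E1 E2 scalerA ksignK scale1r opprK.
have m2Bl := zmod_morphism_linear (m2_linearl e (cocycle_val f)).
have m2Br := zmod_morphism_linear (m2_linearr e (cocycle_val g')).
by rewrite m2Bl m2Br addrC addrA subrK.
Qed.

Lemma hcomp_deg x y z p q (g : cohomology (hom_dg y z) q)
    (f : cohomology (hom_dg x y) p) (e : int) : e != p + q -> hcomp g f e = 0.
Proof.
move=> ne; rewrite /hcomp -[RHS](scaler0 _ (ksign R p)) -[in RHS](linear0 (@hclass R (hom_dg x z) e)).
by congr (_ *: hclass _); apply: val_inj; rewrite /= m2_deg.
Qed.

Lemma hcomp_linl x y z p q e (f : cohomology (hom_dg x y) p) (a : R)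
    (g g' : cohomology (hom_dg y z) q) :
  hcomp (a *: g + g') f e = a *: hcomp g f e + hcomp g' f e.
Proof.
rewrite -[f]hreprK -[g]hreprK -[g']hreprK -linearP !hcompE.
rewrite scalerA mulrC -scalerA -scalerDr -linearP.
by congr (_ *: hclass _); apply: val_inj => /=; rewrite m2_linearl.
Qed.

Lemma hcomp_linr x y z p q e (g : cohomology (hom_dg y z) q) (a : R)
    (f f' : cohomology (hom_dg x y) p) :
  hcomp g (a *: f + f') e = a *: hcomp g f e + hcomp g f' e.
Proof.
rewrite -[g]hreprK -[f]hreprK -[f']hreprK -linearP !hcompE.
rewrite scalerA mulrC -scalerA -scalerDr -linearP.
by congr (_ *: hclass _); apply: val_inj => /=; rewrite m2_linearr.
Qed.

Lemma hcompZl x y z p q e (a : R) (g : cohomology (hom_dg y z) q)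
    (f : cohomology (hom_dg x y) p) : hcomp (a *: g) f e = a *: hcomp g f e.
Proof.
have lin : linear (fun g : cohomology (hom_dg y z) q => hcomp g f e).
  by move=> b g1 g2; exact: hcomp_linl.
by have := lin a g 0; rewrite (lin0 lin) !addr0.
Qed.

Lemma hcompZr x y z p q e (a : R) (g : cohomology (hom_dg y z) q)
    (f : cohomology (hom_dg x y) p) : hcomp g (a *: f) e = a *: hcomp g f e.
Proof.
have lin : linear (fun f : cohomology (hom_dg x y) p => hcomp g f e).
  by move=> b f1 f2; exact: hcomp_linr.
by have := lin a f 0; rewrite (lin0 lin) !addr0.
Qed.

Lemma hcompA x y z w p q r e (h : cohomology (hom_dg z w) r)
    (g : cohomology (hom_dg y z) q) (f : cohomology (hom_dg x y) p) :
  hcomp h (hcomp g f (p + q)) e = hcomp (hcomp h g (q + r)) f e.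
Proof.
have [ee|ne] := eqVneq e (p + (q + r)); last first.
  by rewrite !hcomp_deg // -addrA.
rewrite -[h]hreprK -[g]hreprK -[f]hreprK.
move: (hrepr h) (hrepr g) (hrepr f) => {}h {}g {}f.
rewrite [hcomp (hclass g) _ _]hcompE hcompZr hcompE.
rewrite [hcomp (hclass h) _ _]hcompE hcompZl hcompE.
rewrite ksignD !scalerA mulrA ksignK mul1r -!linearZ; apply/hclassP => /=.
exists (- (ksign R q *:
  m3 (cocycle_val h) (cocycle_val g) (cocycle_val f) (e - 1))).
rewrite linearN linearZ /= /hom_d.
have := @m3_rel _ _ _ _ _ _ _ _ _ (cocycle_val h) (cocycle_val g) (cocycle_val f)
  (p + 1) (q + 1) (r + 1) (p + q) (q + r) (e - 1) e.
rewrite !cocycle_m1 (lin0 (m3_linear1 _ _ _)) (lin0 (m3_linear2 _ _ _)).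
rewrite (lin0 (m3_linear3 _ _ _)) !scaler0 subr0 !addr0 => rel.
have eu : e - 1 = p + q + r - 1 by rewrite ee addrA.
have {rel} /eqP := rel erefl erefl erefl erefl erefl eu.
rewrite -addrA addr_eq0 => /eqP ->.
by rewrite scalerN opprK scalerBr scalerA [_ * ksign R p]mulrC.
Qed.

End CohomologyCategory.

Definition cohomology_cat (R : comPzRingType) (A : ainf R) : gcat R :=
  @GCat R A (fun x y n => cohomology (hom_dg x y) n) (@hcomp R A) (@hcomp_deg R A)
    (@hcomp_linl R A) (@hcomp_linr R A) (@hcompA R A).

Definition coh_unital (R : comPzRingType) (A : ainf R) : Prop :=
  gunital (cohomology_cat A).

Definition unital (R : comPzRingType) (A : ainf R) : Prop :=
  coh_unital A /\
  forall x : A, exists one : cocycle (hom_dg x x) 0,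
    @is_unit R (cohomology_cat A) x (hclass one) /\
    forall y : A,
      @homotopic R (hom_dg x y) (hom_dg x y)
        (fun n f => m2 f (cocycle_val one) n) (fun n f => f) /\
      @homotopic R (hom_dg y x) (hom_dg y x)
        (fun n f => ksign R n *: m2 (cocycle_val one) f n) (fun n f => f).

Definition cofibrant_morphisms (R : comPzRingType) (A : ainf R) : Prop :=
  forall x y : A, cofibrant (hom_dg x y).

Record sfun (R : comPzRingType) (A B : ainf R) := SFun {
  sf_obj :> A -> B;
  sf_hom : forall (x y : A) (n : int),
    {linear ainf_hom A x y n -> ainf_hom B (sf_obj x) (sf_obj y) n};
  sf_m : forall (x y : A) (s : word (ainf_hom A) x y) (e : int),
    sf_hom x y e (ainf_m A s e) =
    ainf_m B (wmap (W := ainf_hom B) (fun x y n f => sf_hom x y n f) s) e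
}.
Arguments sf_hom {R A B} F {x y} n : rename.

Lemma linear_map_eq (R : comPzRingType) (U W : lmodType R) (f g : {linear U -> W}) :
  f =1 g -> f = g.
Proof.
case: f g => [f [[fD] [fZ]]] [g [[gD] [gZ]]] /= /funext efg; subst g.
by rewrite (Prop_irrelevance fD gD) (Prop_irrelevance fZ gZ).
Qed.

Lemma sfun_eq (R : comPzRingType) (A B : ainf R) (F0 : A -> B)
    (F1 G1 : forall (x y : A) (n : int),
      {linear ainf_hom A x y n -> ainf_hom B (F0 x) (F0 y) n}) Fm Gm :
  (forall x y n f, F1 x y n f = G1 x y n f) ->
  @SFun R A B F0 F1 Fm = @SFun R A B F0 G1 Gm.
Proof.
move=> eFG; have eFG1 : F1 = G1.
  apply: functional_extensionality_dep => x.
  apply: functional_extensionality_dep => y.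
  apply: functional_extensionality_dep => n.
  exact/linear_map_eq/eFG.
by subst G1; congr SFun; exact: Prop_irrelevance.
Qed.

Section StrictFunctors.
Variable R : comPzRingType.

Lemma wmap_id (O : Type) (V : O -> O -> int -> lmodType R) (x y : O)
    (s : word V x y) : wmap (W := V) (F0 := id) (fun x y n f => f) s = s.
Proof. by elim: s => //= {}y z p s -> f. Qed.

Lemma wmap_comp (O P Q : Type) (V : O -> O -> int -> lmodType R)
    (W : P -> P -> int -> lmodType R) (U : Q -> Q -> int -> lmodType R)
    (F0 : O -> P) (G0 : P -> Q)
    (F1 : forall (x y : O) (n : int), V x y n -> W (F0 x) (F0 y) n)
    (G1 : forall (x y : P) (n : int), W x y n -> U (G0 x) (G0 y) n)
    (x y : O) (s : word V x y) :
  wmap G1 (wmap F1 s) =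
  wmap (W := U) (F0 := G0 \o F0) (fun x y n f => G1 _ _ _ (F1 _ _ _ f)) s.
Proof. by elim: s => //= {}y z p s -> f. Qed.

Lemma sid_m (A : ainf R) (x y : A) (s : word (ainf_hom A) x y) (e : int) :
  ainf_m A s e = ainf_m A (wmap (W := ainf_hom A) (F0 := id) (fun x y n f => f) s) e.
Proof. by rewrite wmap_id. Qed.

Definition sid (A : ainf R) : sfun A A :=
  @SFun R A A id (fun x y n => idfun) (@sid_m A).

Lemma scomp_m (A B C : ainf R) (G : sfun B C) (F : sfun A B) (x y : A)
    (s : word (ainf_hom A) x y) (e : int) :
  (sf_hom G e \o sf_hom F e) (ainf_m A s e) =
  ainf_m C (wmap (W := ainf_hom C) (F0 := G \o F)
    (fun x y n f => (sf_hom G n \o sf_hom F n) f) s) e.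
Proof. by rewrite /= !sf_m (wmap_comp (U := ainf_hom C)). Qed.

Definition scomp (A B C : ainf R) (G : sfun B C) (F : sfun A B) : sfun A C :=
  @SFun R A C (G \o F) (fun x y n => sf_hom G n \o sf_hom F n) (scomp_m G F).

Section OnCohomology.
Variables (A B : ainf R) (F : sfun A B).

Definition sfun_dgmap (x y : A) : dgmap (hom_dg x y) (hom_dg (F x) (F y)) :=
  @DGMap R (hom_dg x y) (hom_dg (F x) (F y)) (fun n => sf_hom F n)
    (fun n e f => sf_m F (Snoc Nil f) e).

Lemma hmap_comp (x y z : A) (p q e : int) (g : cohomology (hom_dg y z) q)
    (f : cohomology (hom_dg x y) p) :
  hmap (sfun_dgmap x z) (hcomp g f e) =
  hcomp (hmap (sfun_dgmap y z) g) (hmap (sfun_dgmap x y) f) e.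
Proof.
rewrite -[g]hreprK -[f]hreprK hcompE linearZ /= !hmapE hcompE.
congr (_ *: hclass _); apply: val_inj => /=.
exact: (sf_m F (Snoc (Snoc Nil _) _)).
Qed.

Definition cohomology_fun : gfun (cohomology_cat A) (cohomology_cat B) :=
  @GFun R (cohomology_cat A) (cohomology_cat B) F
    (fun x y n => @hmap R _ _ (sfun_dgmap x y) n) hmap_comp.

Definition quasi_equivalence : Prop := gequivalence cohomology_fun.

Definition coh_unital_fun : Prop := gfun_unital cohomology_fun.

Definition surjective_on_morphisms : Prop :=
  forall (x y : A) (n : int) (g : ainf_hom B (F x) (F y) n),
    exists f : ainf_hom A x y n, sf_hom F n f = g.
End OnCohomology.

Lemma sid_coh_unital (A : ainf R) : coh_unital_fun (sid A).
Proof.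
move=> x u uP; suff -> : gf_hom (cohomology_fun (sid A)) 0 u = u by [].
rewrite /= -[u]hreprK hmapE; congr hclass; exact: val_inj.
Qed.

Lemma scomp_coh_unital (A B C : ainf R) (G : sfun B C) (F : sfun A B) :
  coh_unital_fun G -> coh_unital_fun F -> coh_unital_fun (scomp G F).
Proof.
move=> Gu Fu x u /Fu/Gu; congr is_unit.
rewrite /= -[u]hreprK !hmapE; congr hclass; exact: val_inj.
Qed.

End StrictFunctors.

Inductive unitality := NonUnital | CohUnital | Unital.

(* Whether one considers all A-infinity categories or only DG categories. *)
Inductive flavour := AInfinity | DG.

Definition has_unitality (R : comPzRingType) (u : unitality) (A : ainf R) : Prop :=
  match u with
  | NonUnital => True
  | CohUnital => coh_unital A
  | Unital => unital A
  end.

Definition has_flavour (R : comPzRingType) (k : flavour) (A : ainf R) : Prop :=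
  match k with AInfinity => True | DG => is_dg A end.

(* The category of A-infinity (resp. DG) categories of the given unitality and
   strict functors; morphisms are required to be cohomologically unital except
   in the non unital case. *)
Record star_cat (R : comPzRingType) (u : unitality) (k : flavour) := StarCat {
  star_ainf :> ainf R;
  star_unitality : has_unitality u star_ainf;
  star_flavour : has_flavour k star_ainf
}.

Definition star_mor (R : comPzRingType) (u : unitality) (A B : ainf R)
    (F : sfun A B) : Prop :=
  match u with NonUnital => True | _ => coh_unital_fun F end.

Record star_fun (R : comPzRingType) (u : unitality) (k : flavour)
    (A B : star_cat R u k) := StarFun {
  star_sfun :> sfun A B;
  star_funP : star_mor u star_sfun
}.

Lemma star_fun_eq (R : comPzRingType) (u : unitality) (k : flavour)
    (A B : star_cat R u k) (F G : star_fun A B) :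
  star_sfun F = star_sfun G -> F = G.
Proof.
by case: F G => [F Fu] [G Gu] /= eFG; subst G; congr StarFun; exact: Prop_irrelevance.
Qed.

Section StarCategory.
Variables (R : comPzRingType) (u : unitality) (k : flavour).

Lemma star_idP (A : star_cat R u k) : star_mor u (sid A).
Proof. by case: u A => A //=; exact: sid_coh_unital. Qed.

Definition star_id (A : star_cat R u k) : star_fun A A := StarFun (star_idP A).

Lemma star_compP (A B C : star_cat R u k) (G : star_fun B C) (F : star_fun A B) :
  star_mor u (scomp G F).
Proof.
by case: u A B C G F => A B C [G Gu] [F Fu] //=; exact: scomp_coh_unital.
Qed.

Definition star_comp (A B C : star_cat R u k) (G : star_fun B C)
    (F : star_fun A B) : star_fun A C := StarFun (star_compP G F).

End StarCategory.

(* Main.v *)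
(* The category A^cm is built from a single inductive type of trees, freely closed
   under formal operations (all m^k with k >= 2, or m^2 only for DG categories)
   and under cells (z, f), where z is a cocycle of A^cm and f a morphism of A with
   Psi z = m^1 f; the cell has differential z and image f.  The cells (0, f) with
   f a cocycle and (z, f) with z the cell (0, m^1 f) make Psi surjective, also on
   cocycles, and the cells (z, f) kill the kernel of Psi in cohomology, so that Psi
   is a trivial fibration on morphisms.  The differential of a formal operation is
   forced by the A-infinity relations, and strictly decreases an integer weight;
   hence the modules of morphisms are cofibrant.  Since trees are syntactic, strict
   functors act on them functorially on the nose.  As H(Psi) is an isomorphism,
   cohomological units lift; the homotopies required of a unital category lift
   because maps out of a cofibrant complex lift up to homotopy along Psi. *)

From HB Require Import structures.
From mathcomp Require Import all_boot all_order all_algebra.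
From mathcomp Require Import boolp zify.
Require Import Defs.

Set Implicit Arguments.
Unset Strict Implicit.
Unset Printing Implicit Defensive.

Import GRing.Theory.
Local Open Scope ring_scope.

(** * Free modules *)

(** A cell is attached along a cocycle, and being a cocycle refers to the differential of trees
    already built. Differential, projection and weight are therefore defined on all raw trees;
    [tree_wf] then selects the trees whose cells sit on genuine cocycles, and the modules of
    morphisms are free on these. A cell lists its boundary as a finite family of coefficients and
    trees: an element of the free module would make the type of trees occur negatively in its own
    constructor.

    With d of an operation read off from the relations, the relations on two or more letters are
    immediate in the A-infinity case. The relation on one letter, d^2 = 0, is a theorem: it comes
    from an identity for the square of a coderivation, by an induction on the weight that carries
    the compatibility with [psi] along. The number k - 2 in the weight is the dimension of the
    associahedron of arity k.

    A free DG category must be strictly associative, which forces a normal form of trees, the left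
    combs. The product is then a recursive function instead of a constructor, and both associativity
    and the Leibniz rule have to be proved. *)

Section FreeModule.
Variables (R : comPzRingType) (T : Type).
Implicit Types (s : seq {classic T}).

(** Finite support is only asserted to exist, so that equality is equality of coefficients;
    [{classic T}] supplies decidable equality on trees. *)
Record fmod := FMod {
  fcoef :> {classic T} -> R;
  fcoefP : exists s, forall t, fcoef t != 0 -> t \in s
}.

Lemma fmod_eq (u v : fmod) : (forall t, u t = v t) -> u = v.
Proof.
case: u v => [u up] [v vp] /= /funext e; subst v.
by congr FMod; exact: Prop_irrelevance.
Qed.

HB.instance Definition _ := gen_eqMixin fmod.
HB.instance Definition _ := gen_choiceMixin fmod.

Definition fsupp (v : fmod) : seq {classic T} := undup (projT1 (cid (fcoefP v))).

Lemma fsuppP (v : fmod) t : v t != 0 -> t \in fsupp v.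
Proof. by rewrite mem_undup; exact: (projT2 (cid (fcoefP v))). Qed.

Lemma fzero_subproof : exists s, forall t : {classic T}, (0 : R) != 0 -> t \in s.
Proof. by exists [::] => t /eqP. Qed.
Definition fzero : fmod := FMod fzero_subproof.

Lemma fadd_subproof (u v : fmod) : exists s, forall t, u t + v t != 0 -> t \in s.
Proof.
exists (fsupp u ++ fsupp v) => t; rewrite mem_cat.
have [u0|/fsuppP->//] := eqVneq (u t) 0.
by rewrite u0 add0r => /fsuppP->; rewrite orbT.
Qed.
Definition fadd u v : fmod := FMod (fadd_subproof u v).

Lemma fscale_subproof a (v : fmod) : exists s, forall t, a * v t != 0 -> t \in s.
Proof.
exists (fsupp v) => t; have [v0|/fsuppP->//] := eqVneq (v t) 0.
by rewrite v0 mulr0 eqxx.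
Qed.
Definition fscale a v : fmod := FMod (fscale_subproof a v).

Lemma faddA : associative fadd.
Proof. by move=> u v w; apply: fmod_eq => t /=; rewrite addrA. Qed.
Lemma faddC : commutative fadd.
Proof. by move=> u v; apply: fmod_eq => t /=; rewrite addrC. Qed.
Lemma fadd0 : left_id fzero fadd.
Proof. by move=> u; apply: fmod_eq => t /=; rewrite add0r. Qed.
Lemma faddN : left_inverse fzero (fscale (-1)) fadd.
Proof. by move=> u; apply: fmod_eq => t /=; rewrite mulN1r addNr. Qed.

HB.instance Definition _ := GRing.isZmodule.Build fmod faddA faddC fadd0 faddN.

Lemma fscaleA a b v : fscale a (fscale b v) = fscale (a * b) v.
Proof. by apply: fmod_eq => t /=; rewrite mulrA. Qed.
Lemma fscale1 : left_id 1 fscale.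
Proof. by move=> v; apply: fmod_eq => t /=; rewrite mul1r. Qed.
Lemma fscaleDr : right_distributive fscale +%R.
Proof. by move=> a u v; apply: fmod_eq => t /=; rewrite mulrDr. Qed.
Lemma fscaleDl v : {morph fscale^~ v : a b / a + b}.
Proof. by move=> a b; apply: fmod_eq => t /=; rewrite mulrDl. Qed.

HB.instance Definition _ := GRing.Zmodule_isLmodule.Build R fmod
  fscaleA fscale1 fscaleDr fscaleDl.

Lemma fcoefD (u v : fmod) t : (u + v) t = u t + v t. Proof. by []. Qed.
Lemma fcoefZ a (v : fmod) t : (a *: v) t = a * v t. Proof. by []. Qed.
Lemma fcoef0 t : (0 : fmod) t = 0. Proof. by []. Qed.

Lemma fcoef_sum I (r : seq I) (F : I -> fmod) t :
  (\sum_(i <- r) F i) t = \sum_(i <- r) F i t.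
Proof. by elim/big_rec2: _ => // i x y _ <-. Qed.

Lemma fbas_subproof (t : T) :
  exists s, forall t' : {classic T}, ((t' == t)%:R : R) != 0 -> t' \in s.
Proof.
by exists [:: (t : {classic T})] => t'; rewrite inE; case: (t' =P t) => //; rewrite eqxx.
Qed.
Definition fbas (t : T) : fmod := FMod (fbas_subproof t).

(** The list [fsupp] comes from a choice and may contain indices of coefficient zero. A cell must
    list well formed trees only, hence the filter. *)
Definition fsuppnz (v : fmod) : seq {classic T} := [seq t <- fsupp v | v t != 0].

Definition flin (M : lmodType R) (g : T -> M) (v : fmod) : M :=
  \sum_(t <- fsupp v) v t *: g t.

Lemma flinE (M : lmodType R) (g : T -> M) (v : fmod) s : uniq s ->
  (forall t, v t != 0 -> t \in s) -> flin g v = \sum_(t <- s) v t *: g t.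
Proof.
move=> us sv; rewrite /flin.
rewrite (bigID (fun t => v t == 0)) /= big1 ?add0r; last first.
  by move=> t /eqP->; rewrite scale0r.
rewrite [RHS](bigID (fun t => v t == 0)) /= [X in _ = X + _]big1 ?add0r; last first.
  by move=> t /eqP->; rewrite scale0r.
rewrite -big_filter -[RHS]big_filter; apply: perm_big; apply: uniq_perm.
- by rewrite filter_uniq ?undup_uniq.
- by rewrite filter_uniq.
move=> t; rewrite !mem_filter; case: eqP => //= /eqP vt.
by rewrite fsuppP // sv.
Qed.

Lemma flin_is_linear (M : lmodType R) (g : T -> M) : linear (flin g).
Proof.
move=> a u v; pose s := undup (fsupp u ++ fsupp v).
have us : uniq s by rewrite undup_uniq.
have su t : u t != 0 -> t \in s by move=> /fsuppP tu; rewrite /s mem_undup mem_cat tu.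
have sv t : v t != 0 -> t \in s.
  by move=> /fsuppP tv; rewrite /s mem_undup mem_cat tv orbT.
rewrite (flinE _ us su) (flinE _ us sv) (@flinE _ _ _ s) //; last first.
  move=> t; rewrite fcoefD fcoefZ; have [u0|/su//] := eqVneq (u t) 0.
  by rewrite u0 mulr0 add0r; exact: sv.
rewrite scaler_sumr -big_split /=; apply: eq_bigr => t _.
by rewrite scalerDl scalerA.
Qed.

HB.instance Definition _ (M : lmodType R) (g : T -> M) :=
  GRing.isLinear.Build R fmod M _ (flin g) (flin_is_linear g).

Lemma flin_bas (M : lmodType R) (g : T -> M) t : flin g (fbas t) = g t.
Proof.
rewrite (@flinE _ _ _ [:: (t : {classic T})]) //.
  by rewrite big_seq1 /= eqxx scale1r.
by move=> t' /=; rewrite inE; case: (t' =P t) => //; rewrite eqxx.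
Qed.

Lemma flin_fbas v : flin fbas v = v.
Proof.
apply: fmod_eq => t; rewrite /flin fcoef_sum.
have [tv|tv] := boolP (t \in fsupp v); last first.
  have /eqP -> : v t == 0 by apply: contraNT tv; exact: fsuppP.
  rewrite big_seq big1 // => t' t'v; rewrite -[LHS]/(v t' * (t == t')%:R).
  by case: (t =P t') tv => [->|_ _]; rewrite ?t'v // mulr0.
rewrite (bigD1_seq t) ?undup_uniq //= eqxx mulr1 big1 ?addr0 //.
by move=> t' /negPf ne; rewrite eq_sym ne mulr0.
Qed.

Definition fspan (P : T -> Prop) : {pred fmod} :=
  fun v => `[< forall t, v t != 0 -> P t >].

Lemma fspan_submod P : submod_closed (fspan P).
Proof.
split=> [|a u v /asboolP uP /asboolP vP]; apply/asboolP => t.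
  by rewrite fcoef0 eqxx.
rewrite fcoefD fcoefZ; have [u0|/uP//] := eqVneq (u t) 0.
by rewrite u0 mulr0 add0r; exact: vP.
Qed.
HB.instance Definition _ P :=
  GRing.isSubmodClosed.Build R fmod (fspan P) (fspan_submod P).

Lemma fbas_span (P : T -> Prop) t : P t -> fbas t \in fspan P.
Proof.
move=> Pt; apply/asboolP => t' /=.
by have [->|] := eqVneq t' t; rewrite ?eqxx.
Qed.

Lemma sub_fspan (P Q : T -> Prop) v :
  (forall t, P t -> Q t) -> v \in fspan P -> v \in fspan Q.
Proof. by move=> PQ /asboolP vP; apply/asboolP => t /vP/PQ. Qed.

(** Closure of a [Prop] valued predicate, so that being zero and lying in a span serve alike in
    arguments on basis elements. *)
Definition submodule (M : lmodType R) (S : M -> Prop) : Prop :=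
  S 0 /\ forall a u v, S u -> S v -> S (a *: u + v).

Lemma flin_sub (M : lmodType R) (S : M -> Prop) (P : T -> Prop) (g : T -> M) v :
  submodule S -> v \in fspan P -> (forall t, P t -> S (g t)) -> S (flin g v).
Proof.
move=> [S0 SD] /asboolP vP gS; rewrite /flin; elim: (fsupp v) => [|t s IH].
  by rewrite big_nil.
rewrite big_cons; have [->|vt] := eqVneq (v t) 0; first by rewrite scale0r add0r.
exact/SD/IH/gS/vP.
Qed.

Lemma linear_flin (M : lmodType R) (f : fmod -> M) v : linear f ->
  f v = flin (fun t => f (fbas t)) v.
Proof.
move=> fl; rewrite -[v in LHS]flin_fbas /flin.
elim: (fsupp v) => [|t s IH]; first by rewrite !big_nil (lin0 fl).
by rewrite !big_cons fl IH.
Qed.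

Lemma linear_sub (M : lmodType R) (S : M -> Prop) (P : T -> Prop) (f : fmod -> M) v :
  linear f -> submodule S -> v \in fspan P -> (forall t, P t -> S (f (fbas t))) ->
  S (f v).
Proof. by move=> fl sS vP fS; rewrite linear_flin //; exact: flin_sub vP fS. Qed.

Lemma linear_span_eq (M : lmodType R) (P : T -> Prop) (f g : fmod -> M) v :
  linear f -> linear g -> v \in fspan P ->
  (forall t, P t -> f (fbas t) = g (fbas t)) -> f v = g v.
Proof.
move=> fl gl vP fg; apply/eqP; rewrite -subr_eq0; apply/eqP.
pose h u := f u - g u.
have hl : linear h.
  by move=> a u w; rewrite /h fl gl scalerBr opprD addrACA.
apply: (@linear_sub _ (fun u => u = 0) P h v hl) => // [|t /fg]; last first.
  by rewrite /h => ->; rewrite subrr.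
by split=> // a u w -> ->; rewrite scaler0 addr0.
Qed.

Lemma flin_eq (M : lmodType R) (P : T -> Prop) (g h : T -> M) v :
  v \in fspan P -> (forall t, P t -> g t = h t) -> flin g v = flin h v.
Proof.
move=> vP gh; apply: (linear_span_eq (flin_is_linear g) (flin_is_linear h) vP).
by move=> t Pt; rewrite !flin_bas gh.
Qed.

Lemma linear_comp_flin (M N : lmodType R) (f : {linear M -> N}) (g : T -> M) v :
  f (flin g v) = flin (fun t => f (g t)) v.
Proof. by rewrite /flin linear_sum; apply: eq_bigr => t _; rewrite linearZ. Qed.

Lemma flin_scale (M : lmodType R) a (g : T -> M) v :
  flin (fun t => a *: g t) v = a *: flin g v.
Proof. by rewrite /flin scaler_sumr; apply: eq_bigr => t _; rewrite !scalerA mulrC. Qed.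

Lemma flin0 (M : lmodType R) v : flin (fun _ => 0 : M) v = 0.
Proof. by rewrite /flin big1 // => t _; rewrite scaler0. Qed.

Lemma fspanT v : v \in fspan (fun=> True).
Proof. exact/asboolP. Qed.

Record fsub (P : T -> Prop) := FSub {
  fsub_val : fmod;
  fsub_valP : fsub_val \in fspan P
}.
HB.instance Definition _ (P : T -> Prop) := [isSub for @fsub_val P].
HB.instance Definition _ (P : T -> Prop) := [Choice of fsub P by <:].
HB.instance Definition _ (P : T -> Prop) :=
  [SubChoice_isSubLmodule of fsub P by <:].

Lemma flin_suppnz (M : lmodType R) (g : T -> M) v :
  flin g v = \sum_(i < size (fsuppnz v))
    v (tnth (in_tuple (fsuppnz v)) i) *: g (tnth (in_tuple (fsuppnz v)) i).
Proof.
rewrite -(big_tnth _ _ _ xpredT (fun t => v t *: g t)).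
apply: flinE; first by rewrite filter_uniq ?undup_uniq.
by move=> t vt; rewrite mem_filter vt fsuppP.
Qed.

Lemma fsuppnz0 : fsuppnz 0 = [::].
Proof.
rewrite /fsuppnz (eq_filter (a2 := pred0)) ?filter_pred0 // => t.
by rewrite /= eqxx.
Qed.

Lemma fsuppnz_span (P : T -> Prop) v i : v \in fspan P ->
  P (tnth (in_tuple (fsuppnz v)) i).
Proof.
move=> /asboolP vP; apply: vP.
by have := mem_tnth i (in_tuple (fsuppnz v)); rewrite mem_filter => /andP[].
Qed.

(** Extending the values by zero outside [P] gives a function on all of [T], so that maps out of the
    submodule are handled by the same [flin]. *)
Lemma linear_fsub (P : T -> Prop) (M : lmodType R) (h : fsub P -> M) : linear h ->
  exists h' : T -> M, (forall t (Pt : P t), h' t = h (FSub (fbas_span Pt))) /\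
    forall v, h v = flin h' (fsub_val v).
Proof.
move=> hl; pose b t : fsub P :=
  if pselect (P t) is left Pt then FSub (fbas_span Pt) else 0.
exists (fun t => h (b t)); split=> [t Pt|v].
  by rewrite /b; case: pselect => // Pt'; congr h; exact: val_inj.
have vE : v = \sum_(t <- fsupp (fsub_val v)) fsub_val v t *: b t.
  apply: val_inj; rewrite -[LHS]flin_fbas /flin raddf_sum; apply: eq_bigr => t _ /=.
  have [vt|vt] := eqVneq (fsub_val v t) 0; first by rewrite vt !scale0r.
  rewrite /b; case: pselect => // nPt.
  by case: nPt; have /asboolP := fsub_valP v; exact.
rewrite {1}vE /flin; elim: (fsupp _) => [|t s IH]; first by rewrite !big_nil (lin0 hl).
by rewrite !big_cons hl IH.
Qed.

Lemma fsub_val_is_linear P : linear (@fsub_val P).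
Proof. by []. Qed.
HB.instance Definition _ P :=
  GRing.isLinear.Build R (fsub P) fmod _ (@fsub_val P) (@fsub_val_is_linear P).

End FreeModule.
Arguments fbas R {T} t.

Lemma submodule_eq0 (R : comPzRingType) (M : lmodType R) : submodule (fun v : M => v = 0).
Proof. by split=> // a u v -> ->; rewrite scaler0 addr0. Qed.

Lemma submodule_span (R : comPzRingType) T (P : T -> Prop) :
  submodule (fun v : fmod R T => v \in fspan P).
Proof.
split; first exact: rpred0.
by move=> a u v uP vP; rewrite rpredD // rpredZ.
Qed.

Lemma flin_span (R : comPzRingType) (T T' : Type) (P : T -> Prop) (Q : T' -> Prop)
    (g : T -> fmod R T') v :
  v \in fspan P -> (forall t, P t -> g t \in fspan Q) -> flin g v \in fspan Q.
Proof.
move=> vP gQ.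
have := flin_sub (S := fun u => u \in fspan Q) (@submodule_span _ _ Q) vP gQ.
by [].
Qed.

(** * Trivial fibrations and homotopies *)

Section GradedCast.
Variables (R : comPzRingType) (V : int -> lmodType R).

(** Transport between degrees, made total by the value zero when the degrees differ; it is then
    linear without side conditions and fits the convention for graded operations. *)
Definition gcast (n e : int) (v : V n) : V e :=
  if @eqP _ n e is ReflectT ne then eq_rect n V v e ne else 0.

Lemma gcast_id n v : gcast n v = v.
Proof.
rewrite /gcast; case: eqP => // ne.
by rewrite (eq_irrelevance ne erefl).
Qed.

Lemma gcast_ne n e v : n != e -> @gcast n e v = 0.
Proof. by rewrite /gcast; case: eqP. Qed.

Lemma gcast_is_linear n e : linear (@gcast n e).
Proof.
move=> a u v; have [ne|ne] := eqVneq n e; first by subst e; rewrite !gcast_id.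
by rewrite !gcast_ne // scaler0 addr0.
Qed.
HB.instance Definition _ n e :=
  GRing.isLinear.Build R (V n) (V e) _ (@gcast n e) (@gcast_is_linear n e).

Lemma gcast_fam n e (F : forall k, V k) : n = e -> gcast e (F n) = F e.
Proof. by move=> ->; exact: gcast_id. Qed.
End GradedCast.

Section Homological.
Variable R : comPzRingType.
Implicit Types M N E B : dgmod R.

Lemma gcast_map M N (f : dgmap M N) n e (v : M n) :
  f e (@gcast R M n e v) = gcast e (f n v).
Proof.
have [ne|ne] := eqVneq n e; first by subst e; rewrite !gcast_id.
by rewrite !gcast_ne // linear0.
Qed.

Lemma gcast_d M n k l (v : M n) : k = n + 1 ->
  gcast l (dg_d M n k v) = dg_d M n l v.
Proof.
move=> ->; have [<-|ne] := eqVneq (n + 1) l; first by rewrite gcast_id.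
by rewrite gcast_ne // dg_deg // eq_sym.
Qed.

Lemma d_gcast M n k l (v : M n) : n = k ->
  dg_d M k l (gcast k v) = dg_d M n l v.
Proof. by move=> <-; rewrite gcast_id. Qed.

Lemma d_d M n k l (v : M n) : dg_d M k l (dg_d M n k v) = 0.
Proof. exact: dg_dd'. Qed.

Lemma bij_of_inj_surj (S T : Type) (h : S -> T) :
  injective h -> (forall y, exists x, h x = y) -> bijective h.
Proof.
move=> hi hs; exists (fun y => projT1 (cid (hs y))) => x.
  exact/hi/(projT2 (cid (hs (h x)))).
exact: (projT2 (cid (hs x))).
Qed.

Lemma acyclic_quasi_iso M N (f : dgmap M N) :
  (forall n (z : M n), dg_d M n (n + 1) z = 0 ->
     exists b : M (n - 1), dg_d M (n - 1) n b = z) ->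
  (forall n (z : N n), dg_d N n (n + 1) z = 0 ->
     exists b : N (n - 1), dg_d N (n - 1) n b = z) ->
  quasi_iso f.
Proof.
move=> aM aN n.
have triv (L : dgmod R) : (forall n (z : L n), dg_d L n (n + 1) z = 0 ->
    exists b : L (n - 1), dg_d L (n - 1) n b = z) ->
    forall u v : cohomology L n, u = v.
  move=> aL u v; rewrite -[u]hreprK -[v]hreprK; apply/hclassP.
  by apply: aL; rewrite linearB; have /eqP-> := cocycleP (hrepr u);
     have /eqP-> := cocycleP (hrepr v); rewrite subrr.
apply: bij_of_inj_surj => [u v _|y]; first exact: triv.
by exists 0; exact: triv.
Qed.

(* Lifting property of a trivial fibration against the inclusion of a sphere
   into a disk. *)
Lemma trivial_fibration_lift E B (p : dgmap E B) n k (c : E k) (b : B n) :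
  degreewise_surjective p -> quasi_iso p -> k = n + 1 ->
  (forall l, dg_d E k l c = 0) -> p k c = dg_d B n k b ->
  exists2 e : E n, p n e = b & dg_d E n k e = c.
Proof.
move=> ps pq ek dc pc; have {ek} en : n = k - 1 by rewrite ek addrK.
subst n.
have cc : c \in @is_cocycle R E k by rewrite inE dc.
(* The image of [c] is a boundary and H(p) is injective, so [c] is a boundary. *)
have [e0 de0] : exists e0, dg_d E (k - 1) k e0 = c.
  have [g gK _] := pq k.
  have c0 : hclass (Cocycle cc) = hclass 0.
    rewrite -[LHS]gK -[RHS]gK !hmapE; congr g; apply/hclassP => /=.
    by exists b; rewrite linear0 subr0.
  by have /hclassP[e0 /=] := c0; rewrite subr0 => ?; exists e0.
(* The defect b - p e0 is a cocycle. By surjectivity of H(p) it is p z up to a boundary d b', and b'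
   lifts because [p] is surjective. *)
have bc : b - p (k - 1) e0 \in @is_cocycle R B (k - 1).
  rewrite inE linearB -dg_mapP; apply/eqP.
  have -> : k - 1 + 1 = k by rewrite subrK.
  by rewrite de0 pc subrr.
have [g _ gK] := pq (k - 1).
have := gK (hclass (Cocycle bc)); rewrite -[g _]hreprK hmapE => /hclassP[b' /=].
set z := hrepr _ => db'.
have [e' pe'] := ps (k - 1 - 1) b'.
exists (e0 + cocycle_val z - dg_d E (k - 1 - 1) (k - 1) e').
  rewrite linearB linearD dg_mapP pe' db' /=; set X := p _ e0; set Y := p _ _.
  by apply/eqP; rewrite subr_eq opprB addrCA [b + _]addrC subrK addrC.
rewrite linearB linearD d_d subr0 de0.
have := cocycleP z; rewrite inE subrK => /eqP->.
by rewrite addr0.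
Qed.

(** * Cocones and the lifting of null homotopies *)

Section Cone.
Variables (M N : dgmod R) (f : dgmap M N).

(** The homotopy fibre of [f]: a chain map into it is a chain map to [M] together with a null
    homotopy of its composite with [f]. *)
Definition cocone_mod (n : int) : lmodType R := (M n * N (n - 1))%type.

Definition cocone_d n e (u : cocone_mod n) : cocone_mod e :=
  (dg_d M n e u.1, gcast (e - 1) (f n u.1) - dg_d N (n - 1) (e - 1) u.2).

Lemma cocone_d_linear n e : linear (@cocone_d n e).
Proof.
move=> a u v; rewrite /cocone_d /= !linearP /=.
by congr pair; rewrite addrACA -scalerDr.
Qed.
HB.instance Definition _ n e :=
  GRing.isLinear.Build R (cocone_mod n) (cocone_mod e) _ (@cocone_d n e)
    (@cocone_d_linear n e).

Lemma cocone_deg n e (u : cocone_mod n) : e != n + 1 -> cocone_d e u = 0.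
Proof.
move=> ne; rewrite /cocone_d dg_deg // gcast_ne; last by lia.
by rewrite dg_deg ?subr0 //; lia.
Qed.

Lemma cocone_dd n e (u : cocone_mod n) : cocone_d e (cocone_d (n + 1) u) = 0.
Proof.
rewrite /cocone_d /= d_d linearB d_d subr0 dg_mapP gcast_d // d_gcast; last by lia.
by rewrite subrr.
Qed.

Definition cocone : dgmod R :=
  @DGMod R cocone_mod (fun n e => @cocone_d n e) cocone_deg cocone_dd.
End Cone.

Definition dg_id M : dgmap M M :=
  @DGMap R M M (fun n => idfun) (fun n e x => erefl).

Section HomotopyLifting.
Variables (M N : dgmod R) (p : dgmap M N) (delta : dgmap M M).
Variable k : forall n e : int, {linear M n -> N e}.

Definition cocone_map_fun n (u : cocone (dg_id M) n) : cocone p n :=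
  (u.1, p (n - 1) u.2).
Lemma cocone_map_linear n : linear (@cocone_map_fun n).
Proof. by move=> a u v; rewrite /cocone_map_fun /= linearP. Qed.
HB.instance Definition _ n :=
  GRing.isLinear.Build R (cocone (dg_id M) n) (cocone p n) _ (@cocone_map_fun n)
    (@cocone_map_linear n).

Lemma cocone_mapP n e (u : cocone (dg_id M) n) :
  cocone_map_fun (dg_d (cocone (dg_id M)) n e u) =
  dg_d (cocone p) n e (cocone_map_fun u).
Proof.
rewrite /cocone_map_fun /= /cocone_d /=; congr pair.
by rewrite linearB dg_mapP gcast_map.
Qed.
Definition cocone_map : dgmap (cocone (dg_id M)) (cocone p) :=
  @DGMap R _ _ (fun n => @cocone_map_fun n) cocone_mapP.

Hypothesis kP : forall n (x : M n), p n (delta n x) =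
  dg_d N (n - 1) n (k n (n - 1) x) + k (n + 1) n (dg_d M n (n + 1) x).

Definition nullhtpy_fun n (x : M n) : cocone p n := (delta n x, k n (n - 1) x).
Lemma nullhtpy_linear n : linear (@nullhtpy_fun n).
Proof. by move=> a u v; rewrite /nullhtpy_fun /= !linearP. Qed.
HB.instance Definition _ n :=
  GRing.isLinear.Build R (M n) (cocone p n) _ (@nullhtpy_fun n)
    (@nullhtpy_linear n).

Lemma nullhtpyP n e (x : M n) :
  nullhtpy_fun (dg_d M n e x) = dg_d (cocone p) n e (nullhtpy_fun x).
Proof.
have [->|ne] := eqVneq e (n + 1); last by rewrite !dg_deg // linear0.
rewrite /nullhtpy_fun /= /cocone_d /= dg_mapP; congr pair.
have en : n = n + 1 - 1 by rewrite addrK.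
rewrite [RHS]/= kP linearD /= (@gcast_fam R N _ _ (fun l => dg_d N (n - 1) l _) en).
rewrite [RHS]addrAC [X in _ = X + _]subrr add0r.
by rewrite (@gcast_fam R N _ _ (fun l => k (n + 1) l (dg_d M n (n + 1) x)) en).
Qed.
Definition nullhtpy : dgmap M (cocone p) :=
  @DGMap R _ _ (fun n => @nullhtpy_fun n) nullhtpyP.

Hypotheses (cofM : cofibrant M) (ps : degreewise_surjective p) (pq : quasi_iso p).

Lemma cocone_map_surj : degreewise_surjective cocone_map.
Proof.
by move=> n [a c]; have [b pb] := ps c; exists (a, b); rewrite /= /cocone_map_fun /= pb.
Qed.

(** A cocycle (a, b) of the cocone of the identity has a = d b and is the differential of (b, 0). In
    the cocone of [p] it has p a = d b; [trivial_fibration_lift] gives a' over b with d a' = a, and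
    (a', 0) has differential (a, b). *)
Lemma cocone_map_qis : quasi_iso cocone_map.
Proof.
apply: acyclic_quasi_iso => n [a b] [da db].
  exists (b, 0); rewrite /= /cocone_d /= linear0 subr0 gcast_id.
  have en : n + 1 - 1 = n by rewrite addrK.
  congr pair; have /(congr1 (gcast n)) := db; rewrite linear0 linearB /=.
  rewrite (@gcast_fam R M _ _ (fun l => gcast l a) en) gcast_id.
  rewrite (@gcast_fam R M _ _ (fun l => dg_d M (n - 1) l b) en) => /eqP.
  by rewrite subr_eq0 => /eqP.
have en : n + 1 - 1 = n by rewrite addrK.
have [|||a' pa' da'] := trivial_fibration_lift (n := n - 1) (c := a) (b := b) ps pq.
- by rewrite subrK.
- move=> l; have [->|ne] := eqVneq l (n + 1); first exact: da.
  by rewrite dg_deg.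
- have /(congr1 (gcast n)) := db; rewrite linear0 linearB /=.
  rewrite (@gcast_fam R N _ _ (fun l => gcast l (p n a)) en) gcast_id.
  rewrite (@gcast_fam R N _ _ (fun l => dg_d N (n - 1) l b) en) => /eqP.
  by rewrite subr_eq0 => /eqP.
by exists (a', 0); rewrite /= /cocone_d /= linear0 subr0 gcast_id pa' da'.
Qed.

(* A null homotopy of [delta] is a lift of [delta] to the cocone of the identity;
   [cocone_map] is a trivial fibration, as both cocones are acyclic. *)
Lemma nullhtpy_lift : exists h : forall n e : int, {linear M n -> M e},
  forall n (x : M n), delta n x =
    dg_d M (n - 1) n (h n (n - 1) x) + h (n + 1) n (dg_d M n (n + 1) x).
Proof.
have [g gP] := cofM cocone_map_surj cocone_map_qis nullhtpy.
pose g2 n (x : M n) : M (n - 1) := (g n x).2.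
have g2l n : linear (@g2 n) by move=> a u v; rewrite /g2 linearP.
pose h n e (x : M n) : M e := gcast e (g2 n x).
have hl n e : linear (@h n e) by move=> a u v; rewrite /h g2l linearP.
pose hL n e : {linear M n -> M e} :=
  HB.pack (@h n e) (GRing.isLinear.Build R (M n) (M e) _ (@h n e) (hl n e)).
exists hL => n x; rewrite /= /h gcast_id.
have g1 : (g n x).1 = delta n x by have := congr1 fst (gP n x).
have en : n + 1 - 1 = n by rewrite addrK.
have /(congr1 snd)/(congr1 (gcast n)) /= := dg_mapP g (n + 1) x.
rewrite -/(g2 _ _) g1 linearB /=.
rewrite (@gcast_fam R M _ _ (fun l => gcast l (delta n x)) en) gcast_id.
rewrite (@gcast_fam R M _ _ (fun l => dg_d M (n - 1) l _) en) => ->.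
by rewrite addrC subrK.
Qed.

End HomotopyLifting.
End Homological.

(** * Sums over decompositions of words *)

Section WordSums.
Variables (R : comPzRingType) (O : Type) (V : O -> O -> int -> lmodType R).

Lemma wcatA x y z w (s : word V x y) (t : word V y z) (u : word V z w) :
  wcat (wcat s t) u = wcat s (wcat t u).
Proof. by elim: u s t => //= ? ? ? u IH f s t; rewrite IH. Qed.

Lemma wcat0 x y (s : word V x y) : wcat Nil s = s.
Proof. by elim: s => //= {}y z p s -> f. Qed.

Lemma wlen_cat x y z (s : word V x y) (t : word V y z) :
  wlen (wcat s t) = (wlen s + wlen t)%N.
Proof. by elim: t s => [|? ? ? t IH f] s /=; rewrite ?addn0 ?IH ?addnS. Qed.

Lemma wdeg_cat x y z (s : word V x y) (t : word V y z) :
  wdeg (wcat s t) = wdeg s + wdeg t.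
Proof. by elim: t s => [|? ? ? t IH f] s /=; rewrite ?addr0 ?IH ?addrA. Qed.

Section Sums.
Variable M : zmodType.

(** The pieces reach [g] as arguments with their own endpoints rather than as a record [splitting],
    so that iterated sums can be rearranged under binders. *)
Definition cut2 x z (s : word V x z)
    (g : forall y, word V x y -> word V y z -> M) : M :=
  \sum_(p <- splittings s) g _ (sp_left p) (sp_right p).

Definition cut3 x w (s : word V x w)
    (g : forall y z, word V x y -> word V y z -> word V z w -> M) : M :=
  cut2 s (fun _ a r => cut2 r (fun _ b c => g _ _ a b c)).

Lemma cut2_nil x (g : forall y, word V x y -> word V y x -> M) :
  cut2 Nil g = g _ Nil Nil.
Proof. by rewrite /cut2 /= big_seq1. Qed.

Lemma cut2_snoc x y z p (s : word V x y) (f : V y z p)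
    (g : forall y', word V x y' -> word V y' z -> M) :
  cut2 (Snoc s f) g = g _ (Snoc s f) Nil + cut2 s (fun _ a b => g _ a (Snoc b f)).
Proof. by rewrite /cut2 /= big_cons big_map. Qed.

Lemma eq_cut2 x z (s : word V x z) (g h : forall y, word V x y -> word V y z -> M) :
  (forall y (a : word V x y) (b : word V y z), wcat a b = s -> g _ a b = h _ a b) ->
  cut2 s g = cut2 s h.
Proof.
elim: s g h => [|y {}z p s IH f] g h gh; first by rewrite !cut2_nil gh.
rewrite !cut2_snoc gh //; congr (_ + _); apply: IH => y' a b e.
by apply: gh; rewrite /= e.
Qed.

Lemma cut2D x z (s : word V x z) (g h : forall y, word V x y -> word V y z -> M) :
  cut2 s (fun _ a b => g _ a b + h _ a b) = cut2 s g + cut2 s h.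
Proof. exact: big_split. Qed.

Lemma cut20 x z (s : word V x z) : cut2 s (fun _ _ _ => 0 : M) = 0.
Proof. exact: big1. Qed.

Lemma cut2N x z (s : word V x z) (g : forall y, word V x y -> word V y z -> M) :
  cut2 s (fun _ a b => - g _ a b) = - cut2 s g.
Proof. exact: sumrN. Qed.

Lemma cut2C x z x' z' (s : word V x z) (s' : word V x' z')
    (g : forall y y', word V x y -> word V y z -> word V x' y' -> word V y' z' -> M) :
  cut2 s (fun _ a b => cut2 s' (fun _ a' b' => g _ _ a b a' b')) =
  cut2 s' (fun _ a' b' => cut2 s (fun _ a b => g _ _ a b a' b')).
Proof. exact: exchange_big. Qed.

(** Coassociativity of deconcatenation; the other bracketing is the definition of [cut3]. *)
Lemma cut2A x w (s : word V x w)
    (g : forall y z, word V x y -> word V y z -> word V z w -> M) :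
  cut2 s (fun _ l c => cut2 l (fun _ a b => g _ _ a b c)) = cut3 s g.
Proof.
rewrite /cut3; elim: s g => [|y z p s IH f] g; first by rewrite !cut2_nil.
rewrite !cut2_snoc IH !cut2_nil -addrA; congr (_ + _).
under [in RHS]eq_cut2 => ? ? ? _ do rewrite cut2_snoc.
by rewrite [in RHS]cut2D.
Qed.

(** Both sides enumerate the cuts into five pieces. This and [cut5_mid] are the reindexings needed
    for two successive insertions, disjoint and nested respectively. *)
Lemma cut5_left x w (s : word V x w)
    (g : forall y1 y2 y3 y4, word V x y1 -> word V y1 y2 -> word V y2 y3 ->
       word V y3 y4 -> word V y4 w -> M) :
  cut3 s (fun _ _ a d e => cut3 a (fun _ _ a b c => g _ _ _ _ a b c d e)) =
  cut3 s (fun _ _ a b r => cut3 r (fun _ _ c d e => g _ _ _ _ a b c d e)).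
Proof.
transitivity (cut2 s (fun _ a r => cut2 a (fun _ a1 u => cut2 u (fun _ a2 a3 =>
    cut2 r (fun _ d e => g _ _ _ _ a1 a2 a3 d e))))).
  apply: eq_cut2 => y a r _; rewrite [LHS]cut2C; apply: eq_cut2 => y' a1 u _.
  by rewrite cut2C.
rewrite cut2A; apply: eq_cut2 => y1 a1 w1 _.
exact: (cut2A w1 (fun _ _ a2 a3 r => cut2 r (fun _ d e => g _ _ _ _ a1 a2 a3 d e))).
Qed.

Lemma cut5_mid x w (s : word V x w)
    (g : forall y1 y2 y3 y4, word V x y1 -> word V y1 y2 -> word V y2 y3 ->
       word V y3 y4 -> word V y4 w -> M) :
  cut3 s (fun _ _ l c r => cut2 l (fun _ a b => cut2 r (fun _ d e =>
    g _ _ _ _ a b c d e))) =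
  cut3 s (fun _ _ a u e => cut3 u (fun _ _ b c d => g _ _ _ _ a b c d e)).
Proof.
transitivity (cut2 s (fun _ l u => cut2 l (fun _ a b => cut2 u (fun _ c r =>
    cut2 r (fun _ d e => g _ _ _ _ a b c d e))))).
  by apply: eq_cut2 => y l u _; rewrite [LHS]cut2C.
rewrite cut2A; apply: eq_cut2 => y1 a u _.
rewrite (cut2A u (fun _ _ b v e => cut2 v (fun _ c d => g _ _ _ _ a b c d e))).
apply: eq_cut2 => y2 b r _.
by rewrite (cut2A r (fun _ _ c d e => g _ _ _ _ a b c d e)).
Qed.

Lemma eq_cut3 x w (s : word V x w)
    (g h : forall y z, word V x y -> word V y z -> word V z w -> M) :
  (forall y z (a : word V x y) (b : word V y z) (c : word V z w),
     wcat a (wcat b c) = s -> g _ _ a b c = h _ _ a b c) ->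
  cut3 s g = cut3 s h.
Proof.
move=> gh; apply: eq_cut2 => y a r e; apply: eq_cut2 => z b c e'.
by apply: gh; rewrite e'.
Qed.

Lemma cut3D x z (s : word V x z)
    (g h : forall y w, word V x y -> word V y w -> word V w z -> M) :
  cut3 s (fun _ _ a b c => g _ _ a b c + h _ _ a b c) = cut3 s g + cut3 s h.
Proof. by rewrite -cut2D; apply: eq_cut2 => y a r _; rewrite cut2D. Qed.

Lemma cut3N x z (s : word V x z)
    (g : forall y w, word V x y -> word V y w -> word V w z -> M) :
  cut3 s (fun _ _ a b c => - g _ _ a b c) = - cut3 s g.
Proof. by rewrite -cut2N; apply: eq_cut2 => y a r _; rewrite cut2N. Qed.

Lemma cut30 x z (s : word V x z) : cut3 s (fun _ _ _ _ _ => 0 : M) = 0.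
Proof. by rewrite -[RHS](cut20 s); apply: eq_cut2 => y a r _; rewrite cut20. Qed.

(* A cut of [s v t] falls either inside [s], up to just before [v], or inside
   [t], from just after [v]. *)
Lemma cut2_cat x y z w p (s : word V x y) (v : V y z p) (t : word V z w)
    (g : forall y', word V x y' -> word V y' w -> M) :
  cut2 (wcat (Snoc s v) t) g =
  cut2 s (fun _ a b => g _ a (wcat (Snoc b v) t)) +
  cut2 t (fun _ a b => g _ (wcat (Snoc s v) a) b).
Proof.
elim: t v g => [|? ? ? t IH f] v g; rewrite /= !(cut2_snoc, cut2_nil) //.
  by rewrite addrC.
by rewrite IH addrCA.
Qed.

(** The sums are sorted by the piece that contains the marked letter [v]: the third, the second, the
    first. *)
Lemma cut3_cat x y z w p (s : word V x y) (v : V y z p) (t : word V z w)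
    (g : forall y' z', word V x y' -> word V y' z' -> word V z' w -> M) :
  cut3 (wcat (Snoc s v) t) g =
  cut3 s (fun _ _ a b c => g _ _ a b (wcat (Snoc c v) t)) +
  cut2 s (fun _ a b => cut2 t (fun _ c d => g _ _ a (wcat (Snoc b v) c) d)) +
  cut3 t (fun _ _ a b c => g _ _ (wcat (Snoc s v) a) b c).
Proof.
rewrite /cut3 cut2_cat; congr (_ + _); rewrite -cut2D.
by apply: eq_cut2 => y' a b _; rewrite cut2_cat.
Qed.

Lemma cut2_left x z (s : word V x z) (g : forall y, word V x y -> word V y z -> M) :
  (forall y (a : word V x y) (b : word V y z),
     wcat a b = s -> (0 < wlen b)%N -> g _ a b = 0) ->
  cut2 s g = g _ s Nil.
Proof.
case: s g => [|y {}z p s f] g g0; first by rewrite cut2_nil.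
rewrite cut2_snoc -[RHS]addr0; congr (_ + _); rewrite -(cut20 s).
by apply: eq_cut2 => y' a b e; rewrite g0 //= e.
Qed.

Lemma cut2_right x z (s : word V x z) (g : forall y, word V x y -> word V y z -> M) :
  (forall y (a : word V x y) (b : word V y z),
     wcat a b = s -> (0 < wlen a)%N -> g _ a b = 0) ->
  cut2 s g = g _ Nil s.
Proof.
elim: s g => [|y {}z p s IH f] g g0; first by rewrite cut2_nil.
rewrite cut2_snoc g0 // add0r IH // => y' a b e la.
by rewrite g0 //= e.
Qed.

Lemma cut3_mid x z (s : word V x z)
    (g : forall y w, word V x y -> word V y w -> word V w z -> M) :
  (forall y w (a : word V x y) (b : word V y w) (c : word V w z),
     wcat a (wcat b c) = s -> (0 < wlen a + wlen c)%N -> g _ _ a b c = 0) ->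
  cut3 s g = g _ _ Nil s Nil.
Proof.
move=> g0; rewrite /cut3 cut2_right => [|y a r e la].
  by rewrite cut2_left // => y a b e lb; apply: g0; rewrite ?wcat0.
rewrite -[RHS](cut20 r); apply: eq_cut2 => w b c e'; apply: g0; rewrite ?e' //.
by rewrite addn_gt0 la.
Qed.

End Sums.

Lemma cut2Z (M : lmodType R) x z (s : word V x z) k
    (g : forall y, word V x y -> word V y z -> M) :
  cut2 s (fun _ a b => k *: g _ a b) = k *: cut2 s g.
Proof. by rewrite /cut2 scaler_sumr. Qed.

Lemma cut3Z (M : lmodType R) x z (s : word V x z) k
    (g : forall y w, word V x y -> word V y w -> word V w z -> M) :
  cut3 s (fun _ _ a b c => k *: g _ _ a b c) = k *: cut3 s g.
Proof. by rewrite -cut2Z; apply: eq_cut2 => y a r _; rewrite cut2Z. Qed.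

Lemma cut2_sub (M : lmodType R) (S : M -> Prop) x z (s : word V x z)
    (g : forall y, word V x y -> word V y z -> M) : submodule S ->
  (forall y (a : word V x y) (b : word V y z), wcat a b = s -> S (g _ a b)) ->
  S (cut2 s g).
Proof.
move=> [S0 SD]; have Sadd u v : S u -> S v -> S (u + v).
  by move=> Su Sv; rewrite -[u]scale1r; exact: SD.
elim: s g => [|y {}z p s IH f] g gS; first by rewrite cut2_nil; exact: gS.
rewrite cut2_snoc; apply: Sadd; first exact: gS.
by apply: IH => y' a b e; apply: gS; rewrite /= e.
Qed.

Lemma cut3_sub (M : lmodType R) (S : M -> Prop) x z (s : word V x z)
    (g : forall y w, word V x y -> word V y w -> word V w z -> M) : submodule S ->
  (forall y w (a : word V x y) (b : word V y w) (c : word V w z),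
     wcat a (wcat b c) = s -> S (g _ _ a b c)) ->
  S (cut3 s g).
Proof.
move=> sS gS; apply: cut2_sub => // y a r e; apply: cut2_sub => // w b c e'.
by apply: gS; rewrite e'.
Qed.

Lemma linear_cut2 (M N : lmodType R) (f : {linear M -> N}) x z (s : word V x z)
    (g : forall y, word V x y -> word V y z -> M) :
  f (cut2 s g) = cut2 s (fun _ a b => f (g _ a b)).
Proof. exact: linear_sum. Qed.

Lemma linear_cut3 (M N : lmodType R) (f : {linear M -> N}) x z (s : word V x z)
    (g : forall y w, word V x y -> word V y w -> word V w z -> M) :
  f (cut3 s g) = cut3 s (fun _ _ a b c => f (g _ _ a b c)).
Proof. by rewrite linear_cut2; apply: eq_cut2 => y a r _; rewrite linear_cut2. Qed.

Definition multilinear (M : lmodType R) x w (phi : word V x w -> M) : Prop :=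
  forall (y z : O) (p : int) (s : word V x y) (t : word V z w) (a : R)
    (f g : V y z p),
  phi (wcat (Snoc s (a *: f + g)) t) =
  a *: phi (wcat (Snoc s f) t) + phi (wcat (Snoc s g) t).

(* Signs and degrees in the A-infinity relations, as in [ainf_rel]. *)
Definition wsign x y (s : word V x y) : R := ksign R (wdeg s - (wlen s)%:Z).

Definition wout x y (s : word V x y) : int := wdeg s + 2 - (wlen s)%:Z.

Lemma wsign_cat x y z (s : word V x y) (t : word V y z) :
  wsign (wcat s t) = wsign s * wsign t.
Proof. by rewrite /wsign -ksignD wdeg_cat wlen_cat; congr ksign; lia. Qed.

(** In the grading shifted by one the operations have degree one, whence the minus sign when a piece
    is replaced by its value. It is the source of the cancellation in [coder_coder]. *)
Lemma wsign_snoc x y z w (s : word V x y) (b : word V y z) (v : V y w (wout b)) :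
  wsign (Snoc s v) = - (wsign s * wsign b).
Proof.
have e : wdeg s + wout b - (wlen s).+1%:Z =
    1 + (wdeg s - (wlen s)%:Z + (wdeg b - (wlen b)%:Z)) by rewrite /wout; lia.
by rewrite {1}/wsign /= e ksignD ksign1 mulN1r ksignD.
Qed.

Lemma wsignK x y (s : word V x y) : wsign s * wsign s = 1.
Proof. exact: ksignK. Qed.

Lemma multilinear_lin (M : lmodType R) x w (phi : word V x w -> M) y z p
    (s : word V x y) (t : word V z w) : multilinear phi ->
  linear (fun v : V y z p => phi (wcat (Snoc s v) t)).
Proof. by move=> ml a f g; exact: ml. Qed.

Lemma multilinear0 (M : lmodType R) x w (phi : word V x w -> M) y z p
    (s : word V x y) (t : word V z w) : multilinear phi ->
  phi (wcat (Snoc s (0 : V y z p)) t) = 0.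
Proof. by move=> ml; exact: (lin0 (multilinear_lin s t (p := p) ml)). Qed.

(** * The coderivation induced by the operations and its square *)

Section Coderivation.
Variable m : forall x y : O, word V x y -> forall e : int, V x y e.

(* The composite of [phi] with the coderivation of the tensor coalgebra induced
   by [m]. *)
Definition coder (M : lmodType R) x w (phi : word V x w -> M) (s : word V x w) : M :=
  cut3 s (fun _ _ a b c =>
    wsign a *: phi (wcat (Snoc a (m b (wout b))) c)).

Hypothesis m_multilinear : forall x y e, multilinear (fun s : word V x y => m s e).

Lemma coder_multilinear (M : lmodType R) x w (phi : word V x w -> M) :
  multilinear phi -> multilinear (coder phi).
Proof.
move=> ml y z p s t k f g; rewrite /coder !cut3_cat !scalerDr.
rewrite -!cut3Z -!cut2Z addrACA [X in _ = X + _]addrACA.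
congr (_ + _ + _).
- rewrite -cut3D; apply: eq_cut3 => y' z' a b c _.
  rewrite -!wcatA -[wcat _ (Snoc c _)]/(Snoc (wcat _ c) _) ml scalerDr.
  by rewrite !scalerA mulrC.
- rewrite -cut2D; apply: eq_cut2 => y' a b _.
  rewrite -cut2Z -cut2D; apply: eq_cut2 => z' c d _.
  have -> : wout (wcat (Snoc b (k *: f + g)) c) = wout (wcat (Snoc b f) c).
    by rewrite /wout !wdeg_cat !wlen_cat.
  have -> : wout (wcat (Snoc b g) c) = wout (wcat (Snoc b f) c).
    by rewrite /wout !wdeg_cat !wlen_cat.
  by rewrite m_multilinear ml scalerDr !scalerA mulrC.
- rewrite -cut3D; apply: eq_cut3 => y' z' a b c _.
  have -> : wsign (wcat (Snoc s (k *: f + g)) a) = wsign (wcat (Snoc s f) a).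
    by rewrite /wsign !wdeg_cat !wlen_cat.
  have -> : wsign (wcat (Snoc s g) a) = wsign (wcat (Snoc s f) a).
    by rewrite /wsign !wdeg_cat !wlen_cat.
  rewrite -![Snoc (wcat _ a) _]/(wcat _ (Snoc a _)) !wcatA ml scalerDr.
  by rewrite !scalerA mulrC.
Qed.

(** A cut with empty middle piece contributes zero because [m] vanishes on [Nil]; the restriction to
    nonempty pieces can thus be dropped. *)
Lemma coder_relE x y (s : word V x y) e : (forall x e, m (Nil : word V x x) e = 0) ->
  \sum_(p <- splittings s)
    \sum_(q <- splittings (sp_right p) | (0 < wlen (sp_left q))%N)
      wsign (sp_left p) *: m (wcat (Snoc (sp_left p)
        (m (sp_left q) (wout (sp_left q)))) (sp_right q)) e =
  coder (fun u => m u e) s.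
Proof.
move=> m0; apply: eq_bigr => p _; rewrite big_mkcond /=.
apply: eq_bigr => q _; case: ltnP => // q0.
suff -> : m (sp_left q) (wout (sp_left q)) = 0.
  by rewrite (multilinear0 _ _ _ (@m_multilinear _ _ e)) scaler0.
by case: (sp_left q) q0 => // _; exact: m0.
Qed.

Lemma multilinearZ (M : lmodType R) x w (phi : word V x w -> M) y z p
    (s : word V x y) (t : word V z w) k (v : V y z p) : multilinear phi ->
  phi (wcat (Snoc s (k *: v)) t) = k *: phi (wcat (Snoc s v) t).
Proof.
by move=> ml; rewrite -[k *: v]addr0 ml multilinear0 // addr0.
Qed.

Lemma multilinear_sum (M : lmodType R) x w (phi : word V x w -> M) y z p
    (s : word V x y) (t : word V z w) y' z' (u : word V y' z')
    (g : forall w1 w2, word V y' w1 -> word V w1 w2 -> word V w2 z' -> V y z p) :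
  multilinear phi ->
  phi (wcat (Snoc s (cut3 u g)) t) =
  cut3 u (fun _ _ a b c => phi (wcat (Snoc s (g _ _ a b c)) t)).
Proof.
move=> /(multilinear_lin s t (p := p)) ml.
pose L := GRing.isLinear.Build R _ _ _ _ ml.
pose F : {linear V y z p -> M} :=
  HB.pack (fun v : V y z p => phi (wcat (Snoc s v) t)) L.
exact: (linear_cut3 F).
Qed.

(* Two successive insertions are nested or disjoint; the disjoint ones cancel in
   pairs because [m] has degree one. *)
Lemma coder_coder (M : lmodType R) x w (phi : word V x w -> M) s :
  multilinear phi ->
  coder (coder phi) s =
  cut3 s (fun _ _ a b c =>
    phi (wcat (Snoc a (coder (fun t => m t (wout b + 1)) b)) c)).
Proof.
move=> ml; rewrite {1}/coder.
pose K y1 y2 y3 y4 (a1 : word V x y1) (a2 : word V y1 y2) (a3 : word V y2 y3)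
    (b : word V y3 y4) (c : word V y4 w) :=
  wsign a2 * wsign a3 *:
  phi (wcat (wcat (Snoc a1 (m a2 (wout a2))) (Snoc a3 (m b (wout b)))) c).
pose L y1 y2 y3 y4 (a1 : word V x y1) (a2 : word V y1 y2) (b : word V y2 y3)
    (c1 : word V y3 y4) (c2 : word V y4 w) :=
  let u := wcat (Snoc a2 (m b (wout b))) c1 in
  wsign a2 *: phi (wcat (Snoc a1 (m u (wout u))) c2).
transitivity (cut3 s (fun _ _ a b c =>
    cut3 a (fun _ _ a1 a2 a3 => K _ _ _ _ a1 a2 a3 b c) +
    cut2 a (fun _ a1 a2 => cut2 c (fun _ c1 c2 => L _ _ _ _ a1 a2 b c1 c2)) +
    cut3 c (fun _ _ c1 c2 c3 => - K _ _ _ _ a b c1 c2 c3))).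
  apply: eq_cut3 => y z a b c _.
  rewrite [coder _ _]cut3_cat 2!scalerDr -!cut3Z -cut2Z; congr (_ + _ + _).
  - apply: eq_cut3 => ? ? a1 a2 a3 <-; rewrite /K !wsign_cat scalerA wcatA.
    congr (_ *: _).
    by rewrite mulrAC wsignK mul1r.
  - apply: eq_cut2 => ? a1 a2 <-; rewrite -cut2Z; apply: eq_cut2 => ? c1 c2 _.
    by rewrite /L scalerA wsign_cat mulrC mulrA wsignK mul1r.
  - apply: eq_cut3 => ? ? c1 c2 c3 _.
    rewrite /K wcatA scalerA wsign_cat wsign_snoc -scaleNr; congr (_ *: _).
    by rewrite !mulNr mulrN !mulrA wsignK mul1r.
rewrite !cut3D cut5_left cut5_mid addrAC -cut3D.
(* After [cut5_left] the insertions to the left and to the right of the first one run over the same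
   cuts, with opposite signs. *)
rewrite [X in X + _](_ : _ = 0) ?add0r; last first.
  rewrite -[RHS](cut30 _ s); apply: eq_cut3 => ? ? a b c _.
  by rewrite -cut3D -[RHS](cut30 _ c); apply: eq_cut3 => *; rewrite addrN.
apply: eq_cut3 => y z a u c _; rewrite multilinear_sum //.
apply: eq_cut3 => y1 y2 a2 b c1 <-; rewrite /L multilinearZ //.
(* Replacing a piece by its value raises the output degree by one, which explains the degree wout b
   + 1 in the statement. *)
suff -> : wout (wcat a2 (wcat b c1)) + 1 = wout (wcat (Snoc a2 (m b (wout b))) c1) by [].
rewrite /wout !(wdeg_cat, wlen_cat) /= /wout; lia.
Qed.
End Coderivation.
End WordSums.

(** * Words and relations along maps of quivers *)

Section WordMaps.
Variables (R : comPzRingType) (O : Type).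

Lemma wmap_cat (P : Type) (U : O -> O -> int -> lmodType R)
    (U' : P -> P -> int -> lmodType R) (F0 : O -> P)
    (F1 : forall x y n, U x y n -> U' (F0 x) (F0 y) n)
    x y z (s : word U x y) (t : word U y z) :
  wmap F1 (wcat s t) = wcat (wmap F1 s) (wmap F1 t).
Proof. by elim: t s => //= ? ? ? t IH f s; rewrite IH. Qed.

Lemma wlen_map (P : Type) (U : O -> O -> int -> lmodType R)
    (U' : P -> P -> int -> lmodType R) (F0 : O -> P)
    (F1 : forall x y n, U x y n -> U' (F0 x) (F0 y) n) x y (s : word U x y) :
  wlen (wmap F1 s) = wlen s.
Proof. by elim: s => //= ? ? ? s -> f. Qed.

Lemma wdeg_map (P : Type) (U : O -> O -> int -> lmodType R)
    (U' : P -> P -> int -> lmodType R) (F0 : O -> P)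
    (F1 : forall x y n, U x y n -> U' (F0 x) (F0 y) n) x y (s : word U x y) :
  wdeg (wmap F1 s) = wdeg s.
Proof. by elim: s => //= ? ? ? s -> f. Qed.

Lemma wout_map (P : Type) (U : O -> O -> int -> lmodType R)
    (U' : P -> P -> int -> lmodType R) (F0 : O -> P)
    (F1 : forall x y n, U x y n -> U' (F0 x) (F0 y) n) x y (s : word U x y) :
  wout (wmap F1 s) = wout s.
Proof. by rewrite /wout wdeg_map wlen_map. Qed.

Lemma wsign_map (P : Type) (U : O -> O -> int -> lmodType R)
    (U' : P -> P -> int -> lmodType R) (F0 : O -> P)
    (F1 : forall x y n, U x y n -> U' (F0 x) (F0 y) n) x y (s : word U x y) :
  wsign (wmap F1 s) = wsign s.
Proof. by rewrite /wsign wdeg_map wlen_map. Qed.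

Lemma multilinear_map (P : Type) (U : O -> O -> int -> lmodType R)
    (U' : P -> P -> int -> lmodType R) (F0 : O -> P)
    (F1 : forall x y n, {linear U x y n -> U' (F0 x) (F0 y) n}) (M : lmodType R)
    x y (phi : word U' (F0 x) (F0 y) -> M) :
  multilinear phi ->
  multilinear (fun s : word U x y => phi (wmap (fun x y n f => F1 x y n f) s)).
Proof. by move=> ml y' z' p s t a f g; rewrite !wmap_cat /= linearP; exact: ml. Qed.

Lemma cut3_map (P : Type) (U : O -> O -> int -> lmodType R)
    (U' : P -> P -> int -> lmodType R) (F0 : O -> P)
    (F1 : forall x y n, U x y n -> U' (F0 x) (F0 y) n) (M : zmodType)
    x w (s : word U x w)
    (g : forall y z, word U' (F0 x) y -> word U' y z -> word U' z (F0 w) -> M) :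
  cut3 (wmap F1 s) g =
  cut3 s (fun _ _ a b c => g _ _ (wmap F1 a) (wmap F1 b) (wmap F1 c)).
Proof.
have cut2_map x' w' (u : word U x' w')
    (h : forall y, word U' (F0 x') y -> word U' y (F0 w') -> M) :
    cut2 (wmap F1 u) h = cut2 u (fun _ a b => h _ (wmap F1 a) (wmap F1 b)).
  elim: u h => [|y z p u IH f] h /=; first by rewrite !cut2_nil.
  by rewrite !cut2_snoc IH.
rewrite /cut3 cut2_map; apply: eq_cut2 => y a r _; exact: cut2_map.
Qed.

Lemma cut3_split (M : zmodType) (U : O -> O -> int -> lmodType R) x w (s : word U x w)
    (g : forall y z, word U x y -> word U y z -> word U z w -> M) :
  cut3 s g = g _ _ Nil s Nil +
    cut3 s (fun _ _ a b c => if (0 < wlen a + wlen c)%N then g _ _ a b c else 0).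
Proof.
pose h y z (a : word U x y) (b : word U y z) (c : word U z w) :=
  if (0 < wlen a + wlen c)%N then 0 else g _ _ a b c.
have hE : cut3 s h = g _ _ Nil s Nil.
  by rewrite cut3_mid => // *; rewrite /h ifT.
by rewrite -hE -cut3D; apply: eq_cut3 => *; rewrite /h; case: ifP; rewrite (add0r, addr0).
Qed.

(** A vanishing sum over cuts expresses the full contraction as minus the other terms. With [S] a
    span this bounds the weight of a differential; with [S] the zero submodule it gives vanishing
    and equalities. *)
Lemma cut3_mid_sub (M : lmodType R) (S : M -> Prop) (U : O -> O -> int -> lmodType R)
    x w (s : word U x w) (g : forall y z, word U x y -> word U y z -> word U z w -> M) :
  submodule S -> cut3 s g = 0 ->
  (forall y z (a : word U x y) (b : word U y z) (c : word U z w),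
    wcat a (wcat b c) = s -> (0 < wlen a + wlen c)%N -> S (g _ _ a b c)) ->
  S (g _ _ Nil s Nil).
Proof.
move=> sS; rewrite cut3_split => /eqP; rewrite addr_eq0 => /eqP -> gS.
have [S0 SD] := sS; rewrite -scaleN1r -[_ *: _]addr0; apply: SD => //.
by apply: cut3_sub => // *; case: ifP => // *; exact: gS.
Qed.
End WordMaps.

Section CoderTransfer.
Variables (R : comPzRingType) (O P : Type).
Variables (U : O -> O -> int -> lmodType R) (U' : P -> P -> int -> lmodType R).
Variables (F0 : O -> P) (F1 : forall x y n, {linear U x y n -> U' (F0 x) (F0 y) n}).
Variables (m : forall x y, word U x y -> forall e, U x y e).
Variables (m' : forall x y, word U' x y -> forall e, U' x y e).
Notation wm s := (wmap (fun x y n f => F1 x y n f) s).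

(* If [F1] commutes with all terms of the relation on [s] except the full
   contraction [m1 (m s)], then it commutes with that one too. *)
Lemma coder_transfer x y (s : word U x y) e :
  coder m (fun u => m u e) s = 0 -> coder m' (fun u => m' u e) (wm s) = 0 ->
  (forall y1 y2 (a : word U x y1) (b : word U y1 y2) (c : word U y2 y),
     wcat a (wcat b c) = s -> (0 < wlen a + wlen c)%N ->
     F1 x y e (m (wcat (Snoc a (m b (wout b))) c) e) =
     m' (wcat (Snoc (wm a) (m' (wm b) (wout b))) (wm c)) e) ->
  F1 x y e (m (Snoc Nil (m s (wout s))) e) =
  m' (Snoc Nil (m' (wm s) (wout s))) e.
Proof.
move=> rs rs' H; pose g y1 y2 (a : word U x y1) (b : word U y1 y2) (c : word U y2 y) :=
  wsign a *: (F1 x y e (m (wcat (Snoc a (m b (wout b))) c) e) -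
    m' (wcat (Snoc (wm a) (m' (wm b) (wout b))) (wm c)) e).
have g0 : cut3 s g = 0.
  rewrite -[RHS](subrr 0) -{1}[in RHS](linear0 (F1 x y e)) -[in RHS]rs.
  rewrite -[X in _ - X]rs' /coder linear_cut3 cut3_map.
  rewrite -cut3N -cut3D; apply: eq_cut3 => y1 y2 a b c _.
  by rewrite /g wout_map wsign_map linearZ scalerBr.
suff h : g _ _ Nil s Nil = 0.
  by apply/eqP; rewrite -subr_eq0; apply/eqP; rewrite -[RHS]h /g /wsign ksign0 scale1r.
apply: (cut3_mid_sub (@submodule_eq0 _ _) g0) => y1 y2 a b c abc ac.
by rewrite /g H // subrr scaler0.
Qed.
End CoderTransfer.

(** * Trees of formal operations *)

Section Trees.
Variables (R : comPzRingType) (O : Type) (H : O -> O -> int -> lmodType R).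

(* Monomials of the cofibrant model.  [Gen c t f] is a cell (z, f) filling a
   cocycle: it is sent to z by the differential and to f by the projection,
   where z has the component \sum_i c e i *: t e i in every degree e, so that no
   transport along an equality of degrees is needed.  [Node e F] is a formal
   operation of arity at least two applied to F, used for A-infinity categories;
   [Cmp e a g] is a formal product m^2 (g, a), used for DG categories.  Degrees
   and differentials are only correct for the well formed trees of [tree_wf]. *)
Inductive tree : O -> O -> int -> Type :=
| Gen (x y : O) (n : int) (k : int -> nat) (c : forall e, 'I_(k e) -> R)
    (t : forall e, 'I_(k e) -> tree x y e) (f : H x y n) : tree x y n
| Node (x y : O) (e : int) (F : forest x y) : tree x y e
| Cmp (x y z : O) (p q e : int) (a : tree x y p) (g : tree y z q) : tree x z e
with forest : O -> O -> Type :=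
| FNil (x : O) : forest x x
| FSnoc (x y z : O) (p : int) (F : forest x y) (t : tree y z p) : forest x z.

Scheme tree_forest_mind := Induction for tree Sort Prop
with forest_tree_mind := Induction for forest Sort Prop.
Combined Scheme tree_forest_ind from tree_forest_mind, forest_tree_mind.

Definition V0 x y n : lmodType R := fmod R (tree x y n).
Notation W := (word V0).

Fixpoint emb x y (F : forest x y) : W x y :=
  match F with
  | FNil x => Nil
  | FSnoc _ _ _ _ F t => Snoc (emb F) (fbas R t : V0 _ _ _)
  end.

Fixpoint flen x y (F : forest x y) : nat :=
  if F is FSnoc _ _ _ _ F _ then (flen F).+1 else 0.
Fixpoint fdeg x y (F : forest x y) : int :=
  if F is FSnoc _ _ _ p F _ then fdeg F + p else 0.

Lemma wlen_emb x y (F : forest x y) : wlen (emb F) = flen F.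
Proof. by elim: F => //= ? ? ? ? F -> t. Qed.
Lemma wdeg_emb x y (F : forest x y) : wdeg (emb F) = fdeg F.
Proof. by elim: F => //= ? ? ? ? F -> t. Qed.

Fixpoint mext (M : lmodType R) x y (s : W x y) : (forest x y -> M) -> M :=
  match s in word _ _ y' return (forest x y' -> M) -> M with
  | Nil => fun phi => phi (FNil x)
  | Snoc _ _ _ s v => fun phi =>
      mext s (fun F => flin (fun t => phi (FSnoc F t)) v)
  end.

Lemma eq_mext (M : lmodType R) x y (s : W x y) (phi psi : forest x y -> M) :
  phi =1 psi -> mext s phi = mext s psi.
Proof. by move=> /funext->. Qed.

Lemma mext_linear (M : lmodType R) x y (s : W x y) a (phi psi : forest x y -> M) :
  mext s (fun F => a *: phi F + psi F) = a *: mext s phi + mext s psi.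
Proof.
elim: s phi psi => //= {}y z p s IH v phi psi; rewrite -IH; apply: eq_mext => F.
rewrite /flin scaler_sumr -big_split; apply: eq_bigr => t _ /=.
by rewrite scalerDr !scalerA mulrC.
Qed.

Lemma mext_multilinear (M : lmodType R) x y (phi : forest x y -> M) :
  multilinear (fun s => mext s phi).
Proof.
move=> y' z p s t a f g.
elim: t phi => [|? ? ? t IH v] phi /=; last exact: IH.
by rewrite -mext_linear; apply: eq_mext => F; rewrite linearP.
Qed.

(** Uniqueness of the multilinear extension [mext]: forests are the monomials of words in free
    modules, so identities between multilinear maps need only be checked on forests. *)
Lemma multilinear_mext (M : lmodType R) x y (phi : W x y -> M) (s : W x y) :
  multilinear phi -> phi s = mext s (fun F => phi (emb F)).
Proof.
elim: s phi => //= {}y z p s IH v phi ml.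
have ml' : multilinear (fun u => phi (Snoc u v)).
  by move=> y' z' q u t; exact: (ml _ _ _ u (Snoc t v)).
rewrite (IH _ ml'); apply: eq_mext => F.
exact: (linear_flin v (multilinear_lin (emb F) Nil (p := p) ml)).
Qed.

Lemma mext_emb (M : lmodType R) x y (phi : forest x y -> M) F :
  mext (emb F) phi = phi F.
Proof. by elim: F phi => //= ? ? ? ? F IH t phi; rewrite IH flin_bas. Qed.

End Trees.
Arguments FNil {R O H x}.
Arguments V0 {R O} H x y n.

(** * Products, differential, projection and weight on trees *)

Section Operations.
Variables (R : comPzRingType) (O : Type) (A : ainf_on R O) (fl : flavour).
Notation H := (ainf_hom A).
Notation V := (V0 H).
Notation W := (word (V0 H)).

(* The product [m^2 (b, a)] of the free DG category, whose monomials are the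
   left combs [Cmp (... (Cmp g1 g2) ...) gn] of generators. *)
Fixpoint mul y z q (b : tree H y z q) : forall x p, tree H x y p -> forall e, V x z e :=
  match b in tree _ y z q
  return forall x p, tree H x y p -> forall e, V x z e with
  | Cmp y u z p1 q1 q b' g => fun x p a e =>
      if e == p + q then
        ksign R p *: flin (fun t => fbas R (Cmp e t g)) (mul b' a (p + p1))
      else 0
  | Gen y z q k c t f => fun x p a e =>
      if e == p + q then fbas R (Cmp e a (Gen c t f)) else 0
  | Node y z q F => fun x p a e =>
      if e == p + q then fbas R (Cmp e a (Node q F)) else 0
  end.

(** Meant for arity at least two; [forest_op] puts zero and the differential in arity zero and
    one. *)
Definition tree_prod x y (F : forest H x y) (e : int) : V x y e :=
  match fl with
  | AInfinity => if e == fdeg F + 2 - (flen F)%:Z then fbas R (Node e F) else 0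
  | DG =>
    match F in forest _ x y return V x y e with
    | FNil _ => 0
    | FSnoc x y z q F b =>
      match F in forest _ x y return tree H y z q -> V x z e with
      | FNil _ => fun=> 0
      | FSnoc x v y p F a =>
        match F in forest _ x v return tree H v y p -> tree H y z q -> V x z e with
        | FNil _ => fun a b => mul b a e
        | _ => fun _ _ => 0
        end a
      end b
    end
  end.

Definition word_prod x y (s : W x y) (e : int) : V x y e := mext s (fun F => tree_prod F e).

(* The part of the differential of a monomial [F] in which operations of arity
   at least two are inserted. *)
Definition inner_terms x y (s : W x y) (e : int) : V x y e :=
  cut3 s (fun _ _ a b c =>
    if (1 < wlen b < wlen s)%N
    then wsign a *: word_prod (wcat (Snoc a (word_prod b (wout b))) c) e else 0).

(* The differential.  On a formal operation it is minus the sum of all other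
   terms of the A-infinity relation, of which [leib] collects the ones where a
   letter is differentiated. *)
Fixpoint tree_d x y n (t : tree H x y n) : forall e, V x y e :=
  match t in tree _ x y n return forall e, V x y e with
  | Gen _ _ n k c t f => fun e => \sum_(i < k e) c e i *: fbas R (t e i)
  | Node _ _ n F => fun e =>
      - (leib F (fun s => word_prod s e) + inner_terms (emb F) e)
  (* This is [leib] of the forest with trees [a] and [g], written out for the sake of structural
     recursion. The degree 0 + p + 2 - 1 is [wout] of a one letter word, left unreduced so that the
     two agree by conversion. *)
  | Cmp _ _ _ p q n a g => fun e =>
      - (word_prod (Snoc (Snoc Nil (tree_d a (0 + p + 2 - 1%:Z))) (fbas R g : V _ _ _)) e +
         wsign (Snoc Nil (fbas R a : V _ _ _)) *:
         word_prod (Snoc (Snoc Nil (fbas R a : V _ _ _)) (tree_d g (0 + q + 2 - 1%:Z))) e)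
  end
with leib x y (F : forest H x y) : forall (M : lmodType R), (W x y -> M) -> M :=
  match F in forest _ x y return forall (M : lmodType R), (W x y -> M) -> M with
  | FNil _ => fun _ _ => 0
  | FSnoc _ _ _ p F t => fun M phi =>
      leib F (fun s => phi (Snoc s (fbas R t : V _ _ _))) +
      wsign (emb F) *: phi (Snoc (emb F) (tree_d t (0 + p + 2 - 1%:Z)))
  end.

Definition forest_op x y (F : forest H x y) (e : int) : V x y e :=
  match F in forest _ x y return V x y e with
  | FNil _ => 0
  | FSnoc x y z q F b =>
    match F in forest _ x y return V x z e -> tree H y z q -> V x z e with
    | FNil _ => fun _ b => tree_d b e
    | _ => fun v _ => v
    end (tree_prod (FSnoc F b) e) b
  end.

Definition word_op x y (s : W x y) (e : int) : V x y e := mext s (fun F => forest_op F e).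

Fixpoint psi x y n (t : tree H x y n) : H x y n :=
  match t in tree _ x y n return H x y n with
  | Gen _ _ _ _ _ _ f => f
  | Node _ _ e F => ainf_m A (psiF F) e
  | Cmp _ _ _ _ _ e a g => ainf_m A (Snoc (Snoc Nil (psi a)) (psi g)) e
  end
with psiF x y (F : forest H x y) : word H x y :=
  match F in forest _ x y return word H x y with
  | FNil _ => Nil
  | FSnoc _ _ _ _ F t => Snoc (psiF F) (psi t)
  end.

Definition free_psi x y n (v : V x y n) : H x y n := flin (@psi x y n) v.
HB.instance Definition _ x y n :=
  GRing.isLinear.Build R (V x y n) (H x y n) _ (@free_psi x y n)
    (flin_is_linear (@psi x y n)).

Definition free_d x y n (e : int) (v : V x y n) : V x y e := flin (fun t => tree_d t e) v.
HB.instance Definition _ x y n e :=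
  GRing.isLinear.Build R (V x y n) (V x y e) _ (@free_d x y n e)
    (flin_is_linear (fun t => tree_d t e)).

(* The differential strictly decreases this weight: inserting an operation
   splits a vertex of arity k, of weight k - 2, into vertices of arities k - j + 1
   and j, of total weight k - 3. *)
Fixpoint wt x y n (t : tree H x y n) : nat :=
  match t with
  | Gen _ _ n k c t f => (\max_(i < k (n + 1)%R) wt (t (n + 1)%R i)).+1
  | Node _ _ _ F => (fwt F + (flen F - 2))%N
  | Cmp _ _ _ _ _ _ a g => (wt a + wt g)%N
  end
with fwt x y (F : forest H x y) : nat :=
  match F with
  | FNil _ => 0
  | FSnoc _ _ _ _ F t => (fwt F + wt t)%N
  end.

Definition is_gen x y n (t : tree H x y n) : bool :=
  if t is Gen _ _ _ _ _ _ _ then true else false.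

(** The conditions on a cell: its boundary consists of well formed trees, lies in degree n + 1 only,
    is a cocycle, and is sent by [psi] to m^1 f. Requiring the second factor of a product to be a
    generator singles out the left combs. *)
Fixpoint tree_wf x y n (t : tree H x y n) : Prop :=
  match t with
  | Gen x y n k c t f =>
      [/\ forall e i, tree_wf (t e i),
          forall e, e != n + 1 -> k e = 0%N,
          forall e e', \sum_(i < k e) c e i *: tree_d (t e i) e' = 0 &
          forall e, \sum_(i < k e) c e i *: psi (t e i) = ainf_m A (Snoc Nil f) e]
  | Node _ _ e F =>
      [/\ fl = AInfinity, e = fdeg F + 2 - (flen F)%:Z, (2 <= flen F)%N & forest_wf F]
  | Cmp _ _ _ p q e a g => [/\ fl = DG, e = p + q, is_gen g, tree_wf a & tree_wf g]
  end
with forest_wf x y (F : forest H x y) : Prop :=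
  match F with
  | FNil _ => True
  | FSnoc _ _ _ _ F t => forest_wf F /\ tree_wf t
  end.

End Operations.

(** * The differential on trees *)

Section FormalOperations.
Variables (R : comPzRingType) (O : Type) (A : ainf_on R O) (fl : flavour).
Notation H := (ainf_hom A).
Notation tree := (tree H).
Notation forest := (forest H).
Notation V := (V0 H).
Notation W := (word (V0 H)).
Notation nd := (@tree_prod R O A fl _ _).
Notation mu := (@forest_op R O A fl _ _).
Notation op2 := (@word_prod R O A fl _ _).
Notation op := (@word_op R O A fl _ _).
Notation dt := (@tree_d R O A fl _ _ _).
Notation opd := (@free_d R O A fl _ _ _).
Notation wf := (@tree_wf R O A fl _ _ _).
Notation fwf := (@forest_wf R O A fl _ _).
Notation inner := (@inner_terms R O A fl _ _).
Notation Psi := (@free_psi R O A _ _ _).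

(* The letters of [s] are combinations of well formed trees, of weights bounded
   by positive numbers of total at most [N]. *)
Fixpoint wle x y (s : W x y) (N : nat) : Prop :=
  match s with
  | Nil => True
  | Snoc _ _ _ s v => exists N1 N2,
      [/\ wle s N1, v \in fspan (fun t => wf t /\ (wt t <= N2)%N), (0 < N2)%N &
          (N1 + N2 <= N)%N]
  end.

(** A binary node contributes k - 2 = 0 of its own, so positivity has to come from its letters: a
    forest weighs at least its length. *)
Lemma wt_gt0 x y n (t : tree x y n) : wf t -> (0 < wt t)%N.
Proof.
move: x y n t.
have [] // : (forall x y n (t : tree x y n), wf t -> (0 < wt t)%N) /\
  (forall x y (F : forest x y), fwf F -> (flen F <= fwt F)%N).
apply: tree_forest_ind => //=.
- move=> x y e F IH [_ _ F2 Fwf]; have := IH Fwf; lia.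
- by move=> x y z p q e a IHa g IHg [_ _ _ /IHa wa /IHg wg]; rewrite addn_gt0 wa.
- by move=> x y z p F IHF t IHt [/IHF wF /IHt wt]; lia.
Qed.

Lemma wle_emb x y (F : forest x y) : fwf F -> wle (emb F) (fwt F).
Proof.
elim: F => //= {}x {}y z p F IH t [Fwf twf].
exists (fwt F), (wt t); split=> //; [exact: IH| |exact: wt_gt0].
exact: fbas_span.
Qed.

Lemma wle_len x y (s : W x y) N : wle s N -> (wlen s <= N)%N.
Proof.
elim: s N => //= {}y z p s IH v N [N1 [N2 [/IH sN1 _ N2gt0 le]]]; lia.
Qed.

Lemma wle_cat x y z (s : W x y) (t : W y z) N : wle (wcat s t) N <->
  exists N1 N2, [/\ wle s N1, wle t N2 & (N1 + N2 <= N)%N].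
Proof.
elim: t s N => [|? ? ? t IH v] s N /=.
  split=> [sN|[N1 [N2 [sN1 _ le]]]]; first by exists N, 0; rewrite addn0.
  elim: s N N1 sN1 le => //= ? ? ? s IH v N N1 [M1 [M2 [sM1 vM2 M2gt0 le']]] le.
  by exists M1, M2; split=> //; lia.
split=> [[N1 [N2 [/IH[M1 [M2 [sM1 tM2 le]] vN2 N2gt0 le']]]]|].
  exists M1, (M2 + N2)%N; split=> //; last lia.
  by exists M2, N2.
move=> [N1 [N2 [sN1 [M1 [M2 [tM1 vM2 M2gt0 le]]] le']]].
exists (N1 + M1)%N, M2; split=> //; last lia.
by apply/IH; exists N1, M1.
Qed.

Lemma mext_sub (M : lmodType R) (S : M -> Prop) x y (s : W x y) N
    (phi : forest x y -> M) : submodule S -> wle s N ->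
  (forall F, fwf F -> (fwt F <= N)%N -> flen F = wlen s -> fdeg F = wdeg s ->
     S (phi F)) ->
  S (mext s phi).
Proof.
move=> sS; elim: s N phi => [|{}y z p s IH v] N phi /=.
  by move=> _ phiS; exact: phiS.
move=> [N1 [N2 [sN1 vN2 _ le]]] phiS; apply: IH sN1 _ => F Fwf FN1 Fl Fd.
apply: flin_sub sS vN2 _ => t [twf tN2].
by apply: phiS => //=; rewrite ?Fl ?Fd //; lia.
Qed.

Lemma mext_sub_len (M : lmodType R) (S : M -> Prop) x y (s : W x y)
    (phi : forest x y -> M) : submodule S ->
  (forall F, flen F = wlen s -> fdeg F = wdeg s -> S (phi F)) ->
  S (mext s phi).
Proof.
move=> sS; elim: s phi => [|{}y z p s IH v] phi /= phiS; first exact: phiS.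
apply: IH => F Fl Fd.
by apply: flin_sub sS (fspanT v) _ => t _; apply: phiS; rewrite /= ?Fl ?Fd.
Qed.

Lemma mextB (M : lmodType R) x y (s : W x y) (phi chi : forest x y -> M) :
  mext s (fun F => phi F - chi F) = mext s phi - mext s chi.
Proof.
rewrite addrC -scaleN1r -mext_linear; apply: eq_mext => F.
by rewrite scaleN1r addrC.
Qed.

Lemma eq_mext_len (M : lmodType R) x y (s : W x y) (phi chi : forest x y -> M) :
  (forall F, flen F = wlen s -> fdeg F = wdeg s -> phi F = chi F) ->
  mext s phi = mext s chi.
Proof.
move=> e; apply/eqP; rewrite -subr_eq0 -mextB; apply/eqP.
apply: (@mext_sub_len _ (fun v : M => v = 0)); first exact: submodule_eq0.
by move=> F Fl Fd; rewrite e // subrr.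
Qed.

Lemma op_multilinear x y e : multilinear (fun s : W x y => op s e).
Proof. exact: mext_multilinear. Qed.

Lemma op_nil x e : op (Nil : W x x) e = 0. Proof. by []. Qed.

Lemma op_len0 x y (s : W x y) e : (wlen s < 1)%N -> op s e = 0.
Proof. by case: s. Qed.

Lemma op_letter x y p (v : V x y p) e : op (Snoc Nil v) e = opd e v.
Proof. by []. Qed.

Lemma op_op2 x y (s : W x y) e : (2 <= wlen s)%N -> op s e = op2 s e.
Proof.
move=> s2; apply: eq_mext_len => F Fl _; rewrite -Fl in s2.
by case: F s2 {Fl} => // ? ? ? ? F t; case: F t.
Qed.

Lemma op_emb x y (F : forest x y) e : op (emb F) e = mu F e.
Proof. exact: mext_emb. Qed.

Lemma mul_deg y z q (b : tree y z q) x p (a : tree x y p) e :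
  e != p + q -> mul b a e = 0.
Proof. by case: b a => *; rewrite /= ifN. Qed.

Lemma nd_deg x y (F : forest x y) e : e != fdeg F + 2 - (flen F)%:Z -> nd F e = 0.
Proof.
rewrite /tree_prod; case: fl => [ne|]; first by rewrite ifN.
case: F => // ? ? ? ? F b; case: F b => // ? ? ? ? F a b.
case: F a b => //= *; apply: mul_deg; lia.
Qed.

Lemma op2_deg x y (s : W x y) e : e != wout s -> op2 s e = 0.
Proof.
move=> ne; apply: (@mext_sub_len _ (fun v => v = 0)); first exact: submodule_eq0.
by move=> F Fl Fd; apply: nd_deg; rewrite Fl Fd.
Qed.

(** [leib] is a recursion on forests so that it can be defined together with [tree_d]; it is
    identified here with the cuts whose middle piece is a single letter. *)
Lemma leibE x y (F : forest x y) (M : lmodType R) (phi : W x y -> M) :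
  leib fl F phi = cut3 (emb F) (fun _ _ a b c =>
    if wlen b == 1%N then wsign a *: phi (wcat (Snoc a (op b (wout b))) c) else 0).
Proof.
elim: F M phi => [{}x|{}x {}y z p F IH t] M phi /=; first by rewrite /cut3 !cut2_nil.
rewrite /cut3 cut2_snoc cut2_nil /= [RHS]add0r.
pose g y1 y2 (a : W x y1) (b : W y1 y2) (c : W y2 z) : M :=
  if wlen b == 1%N then wsign a *: phi (wcat (Snoc a (op b (wout b))) c) else 0.
rewrite (eq_cut2 (h := fun _ a b => g _ _ a (Snoc b (fbas R t : V _ _ _)) Nil +
  cut2 b (fun _ b' c => g _ _ a b' (Snoc c (fbas R t : V _ _ _))))); last first.
  by move=> y' a b _; exact: cut2_snoc.
rewrite cut2D addrC {}IH [X in _ = X + _]cut2_left => [|y' a b _ b0]; last first.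
  by rewrite /g /= eqSS -[wlen b == _]negbK -lt0n b0.
by rewrite /g /= op_letter /free_d flin_bas.
Qed.

Notation rel s := (forall e, coder (@word_op R O A fl) (fun u => op u e) s = 0).

(** The relation is the formula for the differential of [t] read backwards: cuts with empty middle
    piece vanish, the full cut gives d t, one letter pieces give [leib], and all others give
    [inner]. *)
Lemma rel_monomial x y (F : forest x y) (t : tree x y (wout (emb F))) :
  (2 <= flen F)%N -> op (emb F) (wout (emb F)) = fbas R t ->
  (forall e, dt t e = - (leib fl F (fun s => op2 s e) + inner (emb F) e)) ->
  rel (emb F).
Proof.
move=> F2 opF dF e; rewrite /coder.
pose g y1 y2 (a : W x y1) (b : W y1 y2) (c : W y2 y) :=
  wsign a *: op (wcat (Snoc a (op b (wout b))) c) e.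
transitivity (cut3 (emb F) (fun _ _ a b c =>
    (if wlen b == wlen (emb F) then g _ _ a b c else 0) +
    ((if wlen b == 1%N then wsign a *: op2 (wcat (Snoc a (op b (wout b))) c) e else 0)
    + (if (1 < wlen b < wlen (emb F))%N
    then wsign a *: op2 (wcat (Snoc a (op2 b (wout b))) c) e else 0)))).
  apply: eq_cut3 => y1 y2 a b c abc.
  have len : (wlen a + (wlen b + wlen c) = wlen (emb F))%N by rewrite -abc !wlen_cat.
  have lF := wlen_emb F.
  have [bF|bF] := eqVneq (wlen b) (wlen (emb F)).
    by rewrite bF ltnn andbF ifN ?addr0 //; lia.
  have bF' : (wlen b < wlen (emb F))%N by lia.
  rewrite bF' andbT add0r; case: (ltngtP (wlen b) 1) => [b0|b1|b1].
  - rewrite (@op_len0 _ _ b) // (multilinear0 _ _ _ (@op_multilinear _ _ e)) //.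
    by rewrite scaler0 !addr0.
  - by rewrite add0r -!op_op2 // wlen_cat /=; lia.
  - by rewrite addr0 -op_op2 // wlen_cat /=; lia.
rewrite 2!cut3D [X in X + _]cut3_mid => [|y1 y2 a b c abc ac]; last first.
  rewrite ifN //; apply/eqP => b_eq; have := congr1 (@wlen _ _ _ _ _) abc.
  by rewrite !wlen_cat; lia.
rewrite eqxx /g /= /wsign ksign0 scale1r op_letter opF /free_d flin_bas dF.
by rewrite leibE addNr.
Qed.

Lemma op_emb2 x y (F : forest x y) e : (2 <= flen F)%N -> op (emb F) e = nd F e.
Proof. by rewrite op_emb; case: F => // ? ? ? ? F t; case: F t. Qed.

Lemma rel_node x y (F : forest x y) : fl = AInfinity -> (2 <= flen F)%N ->
  rel (emb F).
Proof.
move=> flE F2; apply: (rel_monomial (t := Node _ F)) => //.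
by rewrite op_emb2 // /tree_prod flE /wout wdeg_emb wlen_emb eqxx.
Qed.

Lemma rel_multilinear x y e : multilinear
  (fun s : W x y => coder (@word_op R O A fl) (fun u => op u e) s).
Proof.
apply: coder_multilinear; last exact: op_multilinear.
by move=> *; exact: op_multilinear.
Qed.

Lemma rel_mext x y (s : W x y) N : wle s N ->
  (forall F : forest x y, fwf F -> flen F = wlen s -> rel (emb F)) -> rel s.
Proof.
move=> sN relF e; rewrite (multilinear_mext s (@rel_multilinear x y e)).
apply: (@mext_sub _ (fun v => v = 0) _ _ _ _ _ (submodule_eq0 _) sN).
by move=> F Fwf _ Fl _; exact: relF.
Qed.

(** * The DG case: associativity and the Leibniz rule for combs *)

Section DGCase.
Hypothesis flE : fl = DG.

Lemma op_dg x y z p q (a : tree x y p) (b : tree y z q) e :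
  op (emb (FSnoc (FSnoc FNil a) b)) e = mul b a e.
Proof. by rewrite op_emb2 // /tree_prod flE. Qed.

Lemma op_dg_gt2 x y (s : W x y) e : (2 < wlen s)%N -> op s e = 0.
Proof.
move=> s3; apply: (@mext_sub_len _ (fun v => v = 0)).
  exact: submodule_eq0.
move=> F Fl _; rewrite -op_emb op_emb2 /tree_prod ?flE; last by lia.
have {s Fl s3} : (2 < flen F)%N by lia.
by case: F => // ? ? ? ? F b; case: F b => // ? ? ? ? F a b; case: F a b.
Qed.

Definition push x y z p q k (g : tree y z q) (v : V x y p) : V x z k :=
  flin (fun t => fbas R (Cmp k t g)) v.
HB.instance Definition _ x y z p q k (g : tree y z q) :=
  GRing.isLinear.Build R (V x y p) (V x z k) _ (@push x y z p q k g)
    (flin_is_linear (fun t : tree x y p => fbas R (Cmp k t g))).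

Lemma mul_base y z q (b : tree y z q) x p (a : tree x y p) e :
  (if b is Cmp _ _ _ _ _ _ _ _ then false else true) ->
  mul b a e = if e == p + q then fbas R (Cmp e a b) else 0.
Proof. by case: b a. Qed.

Lemma mul_gen y z q (b : tree y z q) x p (a : tree x y p) e : is_gen b ->
  mul b a e = if e == p + q then fbas R (Cmp e a b) else 0.
Proof. by case: b a. Qed.

(** Induction on the last factor [h]. If it is not a product, both sides append it to the product of
    [f] and [g]; otherwise its last generator is stripped off both sides. The sign is the one that
    associativity carries for m^2. *)
Lemma mulA z w r (h : tree z w r) x y p q (g : tree y z q) (f : tree x y p) k l e :
  k = p + q -> l = q + r ->
  flin (fun t : tree x z k => mul h t e) (mul g f k) =
  ksign R p *: flin (fun t : tree y w l => mul t f e) (mul h g l).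
Proof.
move=> ek el; subst k l.
move: z w r h x y p q g f e.
pose P z w r (h : tree z w r) := forall x y p q (g : tree y z q) (f : tree x y p) e,
  flin (fun t : tree x z (p + q) => mul h t e) (mul g f (p + q)) =
  ksign R p *: flin (fun t : tree y w (q + r) => mul t f e) (mul h g (q + r)).
have base z w r (h : tree z w r) :
    (if h is Cmp _ _ _ _ _ _ _ _ then false else true) -> P _ _ _ h.
  move=> hb x y p q g f e; rewrite [in RHS]mul_base // eqxx flin_bas /= addrA.
  have -> : (fun t : tree x z (p + q) => mul h t e) =
      (fun t => if e == p + q + r then fbas R (Cmp e t h) else 0).
    by apply/funext => t; exact: mul_base.
  case: eqP => _; last by rewrite scaler0; exact: flin0.
  by rewrite scalerA ksignK scale1r.
suff [] : (forall z w r h, P z w r h) /\ (forall x y (F : forest x y), True) by [].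
apply: (@tree_forest_ind R O H P (fun _ _ _ => True)) => //.
- by move=> *; exact: base.
- by move=> *; exact: base.
move=> z u w p1 q1 r h' IH k _ x y p q g f e /=.
rewrite eqxx linearZ /=.
rewrite [X in ksign R q *: X]linear_comp_flin.
under [in RHS]eq_fun do rewrite /= flin_bas /=.
rewrite (addrA p q r); case: (e =P p + q + r) => [->|_]; last first.
  by rewrite !flin0 !scaler0.
rewrite !flin_scale -[X in ksign R (p + q) *: X](linear_comp_flin (push (p + q + r) k)).
rewrite -[X in _ = _ *: (_ *: (_ *: X))](linear_comp_flin (push (p + q + r) k)).
rewrite IH (addrA p q p1) linearZ ksignD !scalerA /=; congr (_ *: _).
Qed.

Lemma rel_dg3 x y z w p q r (f : tree x y p) (g : tree y z q) (h : tree z w r) :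
  rel (emb (FSnoc (FSnoc (FSnoc FNil f) g) h)).
Proof.
move=> e; rewrite /coder /cut3 /= !(cut2_snoc, cut2_nil) /=.
have op3 x' y1 y2 y3 y4 n1 n2 n3 (s : W x' y1) (a : V y1 y2 n1) (b : V y2 y3 n2)
    (c : V y3 y4 n3) k : op (Snoc (Snoc (Snoc s a) b) c) k = 0 by exact: op_dg_gt2.
rewrite !op3 op_letter linear0 !(scaler0, addr0, add0r).
rewrite /wsign ksign0 scale1r.
set k := wout _; set l := wout _.
rewrite ![op (Snoc (Snoc Nil (fbas R _)) (fbas R _)) _](op_dg _ _ _).
rewrite /word_op /= /tree_prod flE !flin_bas linear0 add0r scale1r.
under [X in _ + flin X _]eq_fun do rewrite flin_bas.
rewrite (@mulA _ _ _ h _ _ _ _ g f _ k) ?/k /wout /=; [|lia|lia].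
by rewrite ksignD ksignN ksign1 add0r mulrN1 scaleNr [X in _ + X]add0r addNr.
Qed.

Lemma rel_dg_len3 x y (F : forest x y) : flen F = 3 -> rel (emb F).
Proof.
case: F => // ? ? ? ? F h; case: F h => // ? ? ? ? F g h.
by case: F g h => // ? ? ? ? F f g h; case: F f g h => // *; exact: rel_dg3.
Qed.

(** On three letters the relation is associativity. On four or more, one of the two nested
    operations always has arity at least three and vanishes. *)
Lemma rel_dg_gt2 x y (s : W x y) : (2 < wlen s)%N -> rel s.
Proof.
rewrite leq_eqVlt => /orP[/eqP s3|s4] e.
  rewrite (multilinear_mext s (@rel_multilinear x y e)).
  apply: (@mext_sub_len _ (fun v => v = 0)); first exact: submodule_eq0.
  by move=> F Fl _; apply: rel_dg_len3; rewrite Fl -s3.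
rewrite /coder -[RHS](cut30 _ s); apply: eq_cut3 => y' z' a b c abc.
have [b3|b2] := ltnP 2 (wlen b).
  by rewrite (op_dg_gt2 _ b3) (multilinear0 _ _ _ (@op_multilinear _ _ e)) scaler0.
by rewrite op_dg_gt2 ?scaler0 //; move: s4; rewrite -abc !wlen_cat /=; lia.
Qed.

(* By [coder_coder] on the word (a, b, g), whose sub-words satisfy the relation,
   the Leibniz rule for (a, g b) follows from those for (a, b) and (_, g). *)
Lemma rel_dg2 y z q (b : tree y z q) x p (a : tree x y p) : wf b ->
  rel (emb (FSnoc (FSnoc FNil a) b)).
Proof.
have base y' z' q' (g : tree y' z' q') x' p' (c : tree x' y' p') : is_gen g ->
    rel (emb (FSnoc (FSnoc FNil c) g)).
  move=> gg; apply: (rel_monomial (t := Cmp _ c g)) => //.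
    by rewrite op_dg mul_gen // ifT // /wout /=; apply/eqP; lia.
  move=> e /=; rewrite /inner_terms /cut3 /= !(cut2_snoc, cut2_nil) /= !addr0 !add0r.
  by rewrite /wsign ksign0 scale1r.
move: y z q b x p a.
pose P y z q (b : tree y z q) := forall x p (a : tree x y p), wf b ->
  rel (emb (FSnoc (FSnoc FNil a) b)).
suff [] : (forall y z q b, P y z q b) /\ (forall x y (F : forest x y), True) by [].
apply: (@tree_forest_ind R O H P (fun _ _ _ => True)) => //.
- by move=> * x' p' a _; exact: base.
- by move=> y z q F _ x p a [flE']; move: flE; rewrite flE'.
move=> y u z p1 q1 q b IH g _ x p a [_ eq gg bwf _] e; subst q.
have baseV v r (w : V v u r) k : coder (@word_op R O A fl) (fun s => op s k)
    (Snoc (Snoc Nil w) (fbas R g : V u z _)) = 0.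
  have lin := multilinear_lin Nil (Snoc Nil (fbas R g : V u z _))
    (p := r) (@rel_multilinear v z k).
  have /= := linear_sub lin (submodule_eq0 _) (fspanT w).
  by apply=> t _; exact: base.
have ml : multilinear (fun s : W x z => op s e) by exact: op_multilinear.
have := coder_coder (@word_op R O A fl) (emb (FSnoc (FSnoc (FSnoc FNil a) b) g)) ml.
rewrite {1}/coder /cut3 /= !(cut2_snoc, cut2_nil) /=.
have op3 x' y1 y2 y3 y4 n1 n2 n3 (s : W x' y1) (c1 : V y1 y2 n1) (c2 : V y2 y3 n2)
    (c3 : V y3 y4 n3) k : op (Snoc (Snoc (Snoc s c1) c2) c3) k = 0 by exact: op_dg_gt2.
have rel3 x' y1 y2 y3 y4 n1 n2 n3 (s : W x' y1) (c1 : V y1 y2 n1) (c2 : V y2 y3 n2)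
    (c3 : V y3 y4 n3) : rel (Snoc (Snoc (Snoc s c1) c2) c3) by exact: rel_dg_gt2.
rewrite !op3 !rel3 !baseV (IH _ _ a bwf).
have zl r : op (Snoc (Snoc Nil (0 : V x u r)) (fbas R g : V _ _ _)) e = 0.
  exact: (multilinear0 r Nil (Snoc Nil _) ml).
have zr r : op (Snoc (Snoc Nil (fbas R a : V _ _ _)) (0 : V y z r)) e = 0.
  exact: (multilinear0 r (Snoc Nil _) Nil ml).
have zm r : op (Snoc Nil (0 : V x z r)) e = 0 by exact: (multilinear0 r Nil Nil ml).
rewrite !zl !zr !zm !(scaler0, addr0, add0r).
set k := wout _; have -> : op (Snoc (Snoc Nil (fbas R b)) (fbas R g)) k =
    fbas R (Cmp k b g) :> V _ _ _.
  rewrite (@op_dg _ _ _ _ _ b g) mul_gen //.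
  by rewrite ifT // /k /wout /=; apply/eqP; lia.
have -> : k = p1 + q1 by rewrite /k /wout /=; lia.
rewrite [coder _ _ (Snoc Nil 0)](multilinear0 _ Nil Nil (@rel_multilinear x z e)).
rewrite scaler0 addr0 => /(congr1 ( *:%R (wsign (Snoc Nil (fbas R a : V _ _ _))))).
by rewrite scalerA wsignK scale1r scaler0.
Qed.

End DGCase.

Lemma rel_wf x y (F : forest x y) : fwf F -> (2 <= flen F)%N -> rel (emb F).
Proof.
have [flE|flE] : fl = AInfinity \/ fl = DG by case: fl; [left|right].
  by move=> _; exact: rel_node.
move=> Fwf.
rewrite leq_eqVlt => /orP[F2|F3]; last by apply: rel_dg_gt2; rewrite ?wlen_emb.
case: F Fwf F2 => // ? ? ? ? F b; case: F b => // ? ? ? ? F a b.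
by case: F a b => [v a b [_ bwf] _|//]; exact: rel_dg2.
Qed.

Lemma rel_wle x y (s : W x y) N : wle s N -> (2 <= wlen s)%N -> rel s.
Proof.
by move=> sN s2; apply: (rel_mext sN) => F Fwf Fl; apply: rel_wf; rewrite ?Fl.
Qed.
Notation nspan N := (fspan (fun t => wf t /\ (wt t <= N)%N)).

Lemma linear_mext (M M' : lmodType R) (f : {linear M -> M'}) x y (s : W x y)
    (phi : forest x y -> M) : f (mext s phi) = mext s (fun F => f (phi F)).
Proof.
elim: s phi => //= {}y z p s IH v phi; rewrite IH; apply: eq_mext => F.
exact: linear_comp_flin.
Qed.

Lemma mul_span y z q (b : tree y z q) x p (a : tree x y p) e : fl = DG ->
  wf b -> wf a -> mul b a e \in nspan (wt a + wt b)%N.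
Proof.
move=> flE; move: y z q b x p a e.
pose P y z q (b : tree y z q) := forall x p (a : tree x y p) e,
  wf b -> wf a -> mul b a e \in nspan (wt a + wt b)%N.
suff [] : (forall y z q b, P y z q b) /\ (forall x y (F : forest x y), True) by [].
apply: (@tree_forest_ind R O H P (fun _ _ _ => True)) => //.
- move=> y z q k c t _ f x p a e bwf awf /=; case: eqP => [ee|_]; last exact: rpred0.
  exact: fbas_span.
- by move=> y z q F _ x p a e []; rewrite flE.
move=> y u z p1 q1 q b IH g _ x p a e [_ eq gg bwf gwf] awf /=.
case: eqP => [ee|_]; last exact: rpred0.
rewrite rpredZ //; apply: flin_span (IH _ _ a _ bwf awf) _ => t [twf le].
apply: fbas_span; split=> /=; first by split=> //; lia.
by rewrite addnA leq_add2r.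
Qed.

Lemma nd_span x y (F : forest x y) e : fwf F -> (2 <= flen F)%N ->
  nd F e \in nspan (fwt F + (flen F - 2))%N.
Proof.
move=> Fwf F2; have [flE|flE] : fl = AInfinity \/ fl = DG by case: fl; [left|right].
  suff -> : nd F e = if e == fdeg F + 2 - (flen F)%:Z then fbas R (Node e F) else 0.
    by case: eqP => [ee|_]; [exact: fbas_span | exact: rpred0].
  by rewrite /tree_prod flE.
move: F2; rewrite leq_eqVlt => /orP[F2|F3]; last first.
  by rewrite -op_emb2 1?ltnW // op_dg_gt2 ?wlen_emb // rpred0.
case: F Fwf F2 => // ? ? ? ? F b; case: F b => // ? ? ? ? F a b.
case: F a b => [v a b [[_ awf] bwf] _|//].
rewrite -op_emb2 // op_dg //.
by apply: sub_fspan (mul_span e flE bwf awf) => t [twf le]; split=> //=; lia.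
Qed.

Lemma op_span x y (s : W x y) N e : wle s N -> (2 <= wlen s)%N ->
  op s e \in nspan (N + (wlen s - 2))%N.
Proof.
move=> sN s2; rewrite op_op2 //.
pose S := fun v : V x y e => v \in nspan (N + (wlen s - 2))%N.
have := @mext_sub (V x y e) S x y s N (fun F => nd F e) (@submodule_span _ _ _) sN.
apply=> F Fwf FN Fl _; apply: sub_fspan (nd_span e Fwf _); last by rewrite Fl.
by move=> t [twf le]; split=> //; rewrite Fl in le; lia.
Qed.

(** Treats both flavours alike: a well formed tree that is not a cell is the value of an operation
    on a forest, because multiplying by a generator yields a single comb. *)
Lemma wf_cases x y n (t : tree x y n) : wf t -> is_gen t \/
  exists F : forest x y, [/\ fwf F, (2 <= flen F)%N, n = wout (emb F),
    fbas R t = op (emb F) n & wt t = (fwt F + (flen F - 2))%N].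
Proof.
case: t => [*|{}x {}y e F|{}x z {}y p q e a g]; first by left.
  move=> [flE ee F2 Fwf]; right; exists F; split=> //.
    by rewrite ee /wout wdeg_emb wlen_emb.
  by rewrite op_emb2 // /tree_prod flE ee eqxx.
move=> [flE ee gg awf gwf]; right; exists (FSnoc (FSnoc FNil a) g); split=> //=.
- by rewrite ee /wout /=; lia.
- by rewrite op_dg // mul_gen // ee eqxx.
- by rewrite addn0.
Qed.
Hypothesis Afl : has_flavour fl (AInf A).

Notation WPsi s := (wmap (W := H) (F0 := id) (fun x y n (v : V x y n) => Psi v) s).

Lemma m2A_dg (B : ainf R) x y z w p q r (h : ainf_hom B z w r)
    (g : ainf_hom B y z q) (f : ainf_hom B x y p) k l e : is_dg B ->
  k = p + q -> l = q + r ->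
  m2 h (m2 g f k) e = ksign R p *: m2 (m2 h g l) f e.
Proof.
move=> Bdg ek el.
have m30 x' y' z' w' p' q' r' (h' : ainf_hom B z' w' r')
    (g' : ainf_hom B y' z' q') (f' : ainf_hom B x' y' p') i : m3 h' g' f' i = 0.
  exact: Bdg.
have := @m3_rel _ _ _ _ _ _ _ _ _ h g f _ _ _ k l _ e erefl erefl erefl ek el erefl.
rewrite !m30 (lin0 (m1_linear _)) !scaler0 subr0 !addr0 add0r => /eqP.
by rewrite subr_eq0 => /eqP.
Qed.

(** Each recursive step of [mul] is an instance of associativity, so multiplicativity of the
    projection rests on associativity in [A]. *)
Lemma psi_mul y z q (b : tree y z q) x p (a : tree x y p) e : fl = DG -> wf b ->
  Psi (mul b a e) = ainf_m A (Snoc (Snoc Nil (psi a)) (psi b)) e.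
Proof.
move=> flE; move: y z q b x p a e.
pose P y z q (b : tree y z q) := forall x p (a : tree x y p) e, wf b ->
  Psi (mul b a e) = ainf_m A (Snoc (Snoc Nil (psi a)) (psi b)) e.
have base y z q (b : tree y z q) : is_gen b -> P _ _ _ b.
  move=> bg x p a e _; rewrite mul_gen //; case: eqP => [ee|/eqP ne].
    by rewrite /free_psi flin_bas.
  by rewrite linear0 ainf_deg //=; lia.
suff [] : (forall y z q b, P y z q b) /\ (forall x y (F : forest x y), True) by [].
apply: (@tree_forest_ind R O H P (fun _ _ _ => True)) => //.
- by move=> *; exact: base.
- by move=> y z q F _ x p a e []; rewrite flE.
move=> y u z p1 q1 q b IH g _ x p a e [_ eq gg bwf gwf] /=.
case: eqP => [ee|/eqP ne]; last by rewrite linear0 ainf_deg //=; lia.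
have lin : linear (fun v : V x u (p + p1) =>
    ainf_m A (Snoc (Snoc Nil (Psi v)) (psi g)) e).
  by move=> c v w; rewrite linearP; exact: (ainf_linear e Nil (Snoc Nil _)).
have E : Psi (flin (fun t => fbas R (Cmp e t g)) (mul b a (p + p1))) =
    ainf_m A (Snoc (Snoc Nil (Psi (mul b a (p + p1)))) (psi g)) e.
  rewrite (linear_flin _ lin) linear_comp_flin /=; congr flin; apply/funext => t.
  by rewrite /free_psi !flin_bas.
rewrite linearZ /= -/(Psi _) E IH //.
have := @m2A_dg (AInf A) _ _ _ _ _ _ _ (psi g) (psi b) (psi a) (p + p1) q e.
rewrite /m2 => -> //; last by move: Afl; rewrite flE.
by rewrite scalerA ksignK scale1r.
Qed.

Lemma psi_nd x y (F : forest x y) e : fwf F -> (2 <= flen F)%N ->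
  Psi (nd F e) = ainf_m A (psiF F) e.
Proof.
have lenF x' y' (G : forest x' y') : wlen (psiF G) = flen G.
  by elim: G => //= ? ? ? ? G -> t.
have degF x' y' (G : forest x' y') : wdeg (psiF G) = fdeg G.
  by elim: G => //= ? ? ? ? G -> t.
move=> Fwf F2; have [flE|flE] : fl = AInfinity \/ fl = DG by case: fl; [left|right].
  suff -> : nd F e = if e == fdeg F + 2 - (flen F)%:Z then fbas R (Node e F) else 0.
    case: eqP => [ee|/eqP ne]; first by rewrite /free_psi flin_bas.
    by rewrite linear0 ainf_deg // lenF degF.
  by rewrite /tree_prod flE.
move: F2; rewrite leq_eqVlt => /orP[F2|F3]; last first.
  rewrite -op_emb2 1?ltnW // op_dg_gt2 ?wlen_emb // linear0.
  by move: Afl; rewrite flE => -> //=; rewrite lenF.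
case: F Fwf F2 => // ? ? ? ? F b; case: F b => // ? ? ? ? F a b.
case: F a b => [v a b [[_ awf] bwf] _|//].
by rewrite -op_emb2 // op_dg // psi_mul.
Qed.

Lemma psi_emb x y (F : forest x y) : WPsi (emb F) = psiF F.
Proof. by elim: F => //= ? ? ? ? F -> t; rewrite /free_psi flin_bas. Qed.

Lemma psi_op x y (s : W x y) N e : wle s N -> (2 <= wlen s)%N ->
  Psi (op s e) = ainf_m A (WPsi s) e.
Proof.
move=> sN s2; pose phi (u : word H x y) := ainf_m A u e.
have ml : multilinear phi by move=> *; exact: ainf_linear.
have mlP : multilinear (fun u : W x y => phi (WPsi u)).
  exact: (multilinear_map (fun x y n => @free_psi R O A x y n) ml).
rewrite -/(phi _) (multilinear_mext s mlP) [LHS]linear_mext.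
apply/eqP; rewrite -subr_eq0 -mextB; apply/eqP.
have := @mext_sub _ (fun v => v = 0) x y s N _ (@submodule_eq0 _ _) sN.
apply=> F Fwf _ Fl _; have F2 : (2 <= flen F)%N by rewrite Fl.
by apply/eqP; rewrite subr_eq0 psi_emb -op_emb op_emb2 //; apply/eqP; exact: psi_nd.
Qed.

(** The properties carried by the induction on the weight. For a monomial, d^2 = 0 and compatibility
    with [psi] need the same facts for its letters, and the span condition keeps differentiated
    letters within reach of the induction. *)
Record dgood x y n (t : tree x y n) : Prop := DGood {
  dgood_span : forall e, dt t e \in fspan (fun t' => wf t' /\ (wt t' < wt t)%N);
  dgood_dd : forall e e', opd e' (dt t e) = 0;
  dgood_psi : forall e, Psi (dt t e) = ainf_m A (Snoc Nil (psi t)) e;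
  dgood_deg : forall e, e != n + 1 -> dt t e = 0
}.

Lemma dgood_gen x y n (t : tree x y n) : wf t -> is_gen t -> dgood t.
Proof.
case: t => // {}x {}y {}n k c t f [twf k0 dd pp] _; split=> /=.
- move=> e; have [en|en] := eqVneq e (n + 1); last first.
    by rewrite big1 ?rpred0 // => -[i ik]; exfalso; move: ik; rewrite k0.
  subst e; apply: rpred_sum => i _; rewrite rpredZ //; apply: fbas_span.
  split=> [|/=]; first exact: twf.
  by rewrite ltnS; exact: (leq_bigmax (F := fun i => wt (t (n + 1) i))).
- move=> e e'; rewrite linear_sum -[RHS](dd e e'); apply: eq_bigr => i _.
  by rewrite linearZ /= /free_d flin_bas.
- move=> e; rewrite linear_sum -[RHS]pp; apply: eq_bigr => i _.
  by rewrite linearZ /= /free_psi flin_bas.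
- by move=> e en; rewrite big1 // => -[i ik]; exfalso; move: ik; rewrite k0.
Qed.

Lemma coder_nil x e : coder (@word_op R O A fl) (fun u => op u e) (Nil : W x x) = 0.
Proof. by rewrite /coder /cut3 !cut2_nil op_letter op_nil linear0 scaler0. Qed.

Lemma coder_len0 x y (s : W x y) e : (wlen s < 1)%N ->
  coder (@word_op R O A fl) (fun u => op u e) s = 0.
Proof. by case: s => // _; exact: coder_nil. Qed.

Lemma coder_letter x y p (v : V x y p) e :
  coder (@word_op R O A fl) (fun u => op u e) (Snoc Nil v) =
  opd e (opd (0 + p + 2 - 1%:Z) v).
Proof.
rewrite /coder /cut3 !(cut2_snoc, cut2_nil) /= !op_nil.
rewrite (multilinear0 _ (Snoc Nil _) Nil (@op_multilinear _ _ e)).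
rewrite (multilinear0 _ Nil (Snoc Nil _) (@op_multilinear _ _ e)).
by rewrite !scaler0 add0r addr0 /wsign ksign0 scale1r !op_letter.
Qed.

Lemma span0 x y n (v : V x y n) : v \in nspan 0 -> v = 0.
Proof.
move=> /asboolP v0; apply: fmod_eq => t; apply/eqP/negbNE/negP => /v0[twf].
by have := wt_gt0 twf; lia.
Qed.

Lemma ainf_multilinear x y e : multilinear (fun s : word H x y => ainf_m A s e).
Proof. by move=> *; exact: ainf_linear. Qed.

Lemma ainf_coder x y (s : word H x y) e :
  coder (@ainf_m R O A) (fun u => ainf_m A u e) s = 0.
Proof.
rewrite -[RHS](ainf_rel s e) -coder_relE //; last exact: ainf_m0.
exact: ainf_multilinear.
Qed.

(** * The inductive step on the weight *)

Section Step.
Variable N0 : nat.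
Hypothesis IH : forall x y n (t : tree x y n), wf t -> (wt t <= N0)%N -> dgood t.

Lemma opd_span x y n (v : V x y n) N e : (N <= N0)%N -> v \in nspan N ->
  opd e v \in nspan N.-1.
Proof.
move=> NN0 vN; apply: flin_span vN _ => t [twf tN].
apply: sub_fspan (dgood_span (IH twf (leq_trans tN NN0)) e) => t' [t'wf lt].
by split=> //; lia.
Qed.

Lemma opd_zero x y n (v : V x y n) N (M : lmodType R) (f : V x y n -> M) :
  (N <= N0)%N -> v \in nspan N -> linear f ->
  (forall t, dgood t -> f (fbas R t) = 0) -> f v = 0.
Proof.
move=> NN0 vN fl0 f0.
have := linear_sub fl0 (@submodule_eq0 _ _) vN.
by apply=> t [twf tN]; apply/f0/IH => //; exact: leq_trans NN0.
Qed.

Lemma op_letter_span x y (s : W x y) N e : wlen s = 1%N -> (N <= N0)%N ->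
  wle s N -> op s e \in nspan N.-1.
Proof.
case: s => // ? ? ? s v; case: s v => // v _ NN0 [N1 [N2 [_ vN _ le]]].
rewrite op_letter; apply: opd_span => //.
by apply: sub_fspan vN => t [twf tle]; split=> //; lia.
Qed.

Lemma coder_len1 x y (s : W x y) N e : wlen s = 1%N -> (N <= N0)%N ->
  wle s N -> coder (@word_op R O A fl) (fun u => op u e) s = 0.
Proof.
case: s => // ? ? p s v; case: s v => // v _ NN0 [N1 [N2 [_ vN _ le]]].
rewrite coder_letter; apply: (opd_zero (f := fun v => opd e (opd _ v)) _ vN).
- by apply: leq_trans NN0; lia.
- by move=> k u w; rewrite !linearP.
- by move=> t tg; rewrite /free_d flin_bas; exact: dgood_dd.
Qed.

Lemma psi_len0 x y (s : W x y) e : (wlen s < 1)%N ->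
  Psi (op s e) = ainf_m A (WPsi s) e.
Proof. by case: s => // _; rewrite op_nil linear0 ainf_m0. Qed.

Lemma psi_len1 x y (s : W x y) N e : wlen s = 1%N -> (N <= N0)%N ->
  wle s N -> Psi (op s e) = ainf_m A (WPsi s) e.
Proof.
case: s => // ? ? p s v; case: s v => // v _ NN0 [N1 [N2 [_ vN _ le]]].
apply/eqP; rewrite -subr_eq0 op_letter; apply/eqP.
apply: (opd_zero (f := fun v => Psi (opd e v) - ainf_m A (Snoc Nil (Psi v)) e) _ vN).
- by apply: leq_trans NN0; lia.
- move=> k u w; rewrite !linearP (ainf_linear e Nil Nil) /=.
  by rewrite scalerBr opprD addrACA.
- by move=> t tg; rewrite /free_d !/(free_psi (fbas R t)) !flin_bas dgood_psi // subrr.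
Qed.

(** One bound covers both kinds of insertion: an operation of arity k >= 2 adds k - 2, and
    differentiating a letter, k = 1, subtracts one. For the latter the induction hypothesis applies
    since some other letter takes up positive weight. The alternative [op b k = 0] is needed because
    [wle] asks for positive bounds. *)
Lemma insert_wle x y z w (a : W x y) (b : W y z) (c : W z w) N k :
  wle (wcat a (wcat b c)) N -> (0 < wlen a + wlen c)%N -> (N <= N0.+1)%N ->
  op b k = 0 \/
  wle (wcat (Snoc a (op b k)) c) (N + wlen b - 2)%N.
Proof.
move=> /wle_cat[Na [Nr [aN /wle_cat[Nb [Nc [bN cN le]]] le']]] ac NN0.
have [b0|b0] := ltnP (wlen b) 1; first by left; rewrite op_len0.
have la := wle_len aN; have lb := wle_len bN; have lc := wle_len cN.
have sp : op b k \in nspan (Nb + wlen b - 2)%N.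
  have [b2|b2] := ltnP 1 (wlen b).
    by rewrite -addnBA //; exact: op_span.
  have b1 : wlen b = 1%N by lia.
  apply: sub_fspan (op_letter_span k b1 _ bN) => [t [twf tle]|]; last lia.
  by split=> //; lia.
have [e0|e0] := eqVneq (Nb + wlen b - 2)%N 0.
  by left; apply: span0; rewrite e0 in sp.
right; apply/wle_cat; exists (Na + (Nb + wlen b - 2))%N, Nc; split=> //; last lia.
exists Na, (Nb + wlen b - 2)%N; split=> //; lia.
Qed.

(* For d^2 = 0: applying [coder_coder] to the word [emb F], everything vanishes
   but the full contraction, which is d (d (m F)). *)
Lemma dgood_monomial x y (F : forest x y) : fwf F -> (2 <= flen F)%N ->
  (fwt F + (flen F - 2) <= N0.+1)%N ->
  [/\ forall e, opd e (op (emb F) (wout (emb F))) \in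
        fspan (fun t => wf t /\ (wt t < fwt F + (flen F - 2))%N),
      forall e e', e = wout (emb F) + 1 ->
        opd e' (opd e (op (emb F) (wout (emb F)))) = 0,
      forall e, Psi (opd e (op (emb F) (wout (emb F)))) =
        ainf_m A (Snoc Nil (Psi (op (emb F) (wout (emb F))))) e &
      forall e, e != wout (emb F) + 1 -> opd e (op (emb F) (wout (emb F))) = 0].
Proof.
move=> Fwf F2 FN0; set s := emb F.
have sN : wle s (fwt F) := wle_emb Fwf.
have s2 : (2 <= wlen s)%N by rewrite wlen_emb.
have sl : wlen s = flen F := wlen_emb F.
have relF : rel s := rel_wf Fwf F2.
clearbody s.
have ins y1 y2 (a : W x y1) (b : W y1 y2) (c : W y2 y) k :
    wcat a (wcat b c) = s -> (0 < wlen a + wlen c)%N ->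
  op b k = 0 \/ wle (wcat (Snoc a (op b k)) c) (fwt F + wlen b - 2)%N.
  by move=> abc ac; apply: insert_wle => //; [rewrite abc | lia].
have len2 y1 y2 y3 n (a : W y1 y2) (v : V y2 y3 n) (c : W y3 y) :
    (0 < wlen a + wlen c)%N -> (2 <= wlen (wcat (Snoc a v) c))%N.
  by rewrite wlen_cat /=; lia.
have mid e : wsign (Nil : W x x) *: op (wcat (Snoc Nil (op s (wout s))) Nil) e =
    opd e (op s (wout s)).
  by rewrite /wsign ksign0 scale1r.
have ml e := @op_multilinear x y e.
split.
- move=> e; rewrite -mid.
  apply: (cut3_mid_sub (@submodule_span _ _ _) (relF e)) => y1 y2 a b c abc ac.
  rewrite rpredZ //; have [->|wN] := ins _ _ a b c (wout b) abc ac.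
    by rewrite (multilinear0 _ _ _ (ml e)) rpred0.
  (* If [b] has j of the k letters, the outer operation has arity k - j + 1. With N the weight of
     [F] the total is (N + j - 2) + (k - j - 1), one less than N + k - 2. *)
  apply: sub_fspan (op_span e wN (len2 _ _ _ _ _ _ _ ac)) => t [twf tle].
  split=> //; move: tle (wle_len sN); rewrite !wlen_cat /=.
  have := congr1 (@wlen _ _ _ _ _) abc; rewrite !wlen_cat; lia.
- move=> e e' ee.
  have := coder_coder (@word_op R O A fl) s (ml e').
  rewrite [RHS](_ : _ = 0) => [|]; last first.
    rewrite -[RHS](cut30 _ s); apply: eq_cut3 => y1 y2 a b c abc.
    (* A middle piece of at least two letters satisfies the relation outright. A single letter has
       another letter of positive weight beside it, so the induction hypothesis gives d^2 = 0 on
       it. *)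
    rewrite [coder _ _ _](_ : _ = 0) ?(multilinear0 _ _ _ (ml e')) //.
    have sN' := sN; rewrite -abc in sN'.
    have /wle_cat[Na [Nr [aN /wle_cat[Nb [Nc [bN cN le]]] le']]] := sN'.
    have [b0|b0] := ltnP (wlen b) 1; first exact: coder_len0.
    have [b2|b2] := ltnP 1 (wlen b); first exact: rel_wle bN b2 _.
    have la := wle_len aN; have lb := wle_len bN; have lc := wle_len cN.
    have := congr1 (@wlen _ _ _ _ _) abc; rewrite !wlen_cat => labc.
    have NbN0 : (Nb <= N0)%N by lia.
    have b1 : wlen b = 1%N by lia.
    exact: coder_len1 _ b1 NbN0 bN.
  (* On the other side, an insertion that is not full leaves at least two letters, and the relation
     kills it. *)
  rewrite {1}/coder cut3_mid => [|y1 y2 a b c abc ac]; last first.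
    have [->|wN] := ins _ _ a b c (wout b) abc ac.
      by rewrite (multilinear0 _ _ _ (@rel_multilinear _ _ e')) scaler0.
    by rewrite (rel_wle wN) ?len2 // scaler0.
  have -> : e = 0 + wout s + 2 - 1%:Z by rewrite ee; lia.
  by rewrite /wsign ksign0 scale1r coder_letter.
- move=> e.
  rewrite (psi_op _ sN s2); apply: (coder_transfer
    (F1 := fun x y n => @free_psi R O A x y n) (relF e) (ainf_coder (WPsi s) e)).
  move=> y1 y2 a b c abc; rewrite -[wlen a]/(@wlen _ _ V _ _ a).
  rewrite -[wlen c]/(@wlen _ _ V _ _ c) => ac.
  transitivity (ainf_m A (WPsi (wcat (Snoc a (op b (wout b))) c)) e).
    have [->|wN] := ins _ _ a b c (wout b) abc ac.
      rewrite (multilinear0 _ _ _ (ml e)) linear0 wmap_cat /= linear0.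
      by rewrite (multilinear0 _ _ _ (@ainf_multilinear _ _ e)).
    apply: (psi_op e wN); exact: len2.
  rewrite wmap_cat /=; congr (ainf_m A (wcat (Snoc _ _) _) e).
  have sN' := sN; rewrite -abc in sN'.
  have /wle_cat[Na [Nr [aN /wle_cat[Nb [Nc [bN cN le]]] le']]] := sN'.
  have [b0|b0] := ltnP (wlen b) 1; first exact: psi_len0.
  have [b2|b2] := ltnP 1 (wlen b); first by apply: (psi_op (wout b) bN).
  have la := wle_len aN; have lb := wle_len bN; have lc := wle_len cN.
  have := congr1 (@wlen _ _ _ _ _) abc; rewrite !wlen_cat => labc.
  have NbN0 : (Nb <= N0)%N by lia.
  have b1 : wlen b = 1%N by lia.
  exact: psi_len1 _ b1 NbN0 bN.
move=> e ne; rewrite -mid.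
apply: (cut3_mid_sub (@submodule_eq0 _ _) (relF e)) => y1 y2 a b c abc ac.
rewrite op_op2 ?len2 // op2_deg ?scaler0 //.
move: ne; have := congr1 (@wlen _ _ _ _ _) abc; have := congr1 (@wdeg _ _ _ _ _) abc.
rewrite /wout !(wdeg_cat, wlen_cat) /= /wout; lia.
Qed.

End Step.

Theorem dgoodP x y n (t : tree x y n) : wf t -> dgood t.
Proof.
have [N] := ubnP (wt t); elim: N x y n t => // N IH x y n t tN twf.
have [/(dgood_gen twf)//|[F [Fwf F2 nF tF wtF]]] := wf_cases twf.
subst n; have FN : (fwt F + (flen F - 2) <= N)%N by rewrite -wtF.
(* Positivity of weights settles the case N = 0, in which N.-1 is not smaller than N. *)
have IH' x' y' n' (t' : tree x' y' n') : wf t' -> (wt t' <= N.-1)%N -> dgood t'.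
  by move=> t'wf le; apply: IH => //; have := wt_gt0 t'wf; lia.
have FN' : (fwt F + (flen F - 2) <= N.-1.+1)%N by lia.
have [sp dd ps dg] := dgood_monomial IH' Fwf F2 FN'.
have dtE e : dt t e = opd e (op (emb F) (wout (emb F))).
  by rewrite -tF /free_d flin_bas.
split=> [e|e e'|e|e ne]; rewrite dtE ?wtF //.
- have [ee|ne] := eqVneq e (wout (emb F) + 1); first exact: dd.
  by rewrite dg // linear0.
- by rewrite ps -tF /free_psi flin_bas.
- exact: dg.
Qed.

(** Supports are finite, so the filtration by weight is exhaustive; this is how the bounds disappear
    from the statements below. *)
Lemma span_bound x y n (v : V x y n) : v \in fspan (@tree_wf R O A fl x y n) ->
  exists2 N, (0 < N)%N & v \in nspan N.
Proof.
move=> /asboolP vwf; exists (\max_(t <- fsupp v) wt (t : tree x y n)).+1 => //.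
apply/asboolP => t vt; split; first exact: vwf.
by apply: leqW; exact: (@leq_bigmax_seq _ _ xpredT
  (fun t' : {classic tree x y n} => wt (t' : tree x y n)) t (fsuppP vt)).
Qed.

Fixpoint wspan x y (s : W x y) : Prop :=
  match s with
  | Nil => True
  | Snoc _ _ _ s v => wspan s /\ v \in fspan (@tree_wf R O A fl _ _ _)
  end.

Lemma wspan_wle x y (s : W x y) : wspan s -> exists N, wle s N.
Proof.
elim: s => [_|{}y z p s IH v [/IH[N sN] /span_bound[M M0 vM]]]; first by exists 0.
by exists (N + M)%N, N, M.
Qed.

Lemma opd_wf x y n (v : V x y n) e : v \in fspan (@tree_wf R O A fl _ _ _) ->
  opd e v \in fspan (@tree_wf R O A fl _ _ _).
Proof.
move=> vwf; apply: flin_span vwf _ => t twf.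
by apply: sub_fspan (dgood_span (dgoodP twf) e) => t' [].
Qed.

Lemma op_wf x y (s : W x y) e : wspan s -> op s e \in fspan (@tree_wf R O A fl _ _ _).
Proof.
move=> swf; have [s2|s1] := ltnP 1 (wlen s).
  have [N sN] := wspan_wle swf.
  by apply: sub_fspan (op_span e sN s2) => t [].
case: s swf s1 => [_ _|? ? ? s v]; first by rewrite op_nil rpred0.
by case: s v => // v [_ vwf] _; exact: opd_wf.
Qed.

Lemma linear_wf0 x y n (v : V x y n) (M : lmodType R) (f : V x y n -> M) :
  v \in fspan (@tree_wf R O A fl _ _ _) -> linear f ->
  (forall t, wf t -> f (fbas R t) = 0) -> f v = 0.
Proof.
by move=> vwf fl0 f0; have := linear_sub fl0 (@submodule_eq0 _ _) vwf; apply.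
Qed.

Lemma opd_opd x y n (v : V x y n) e e' : v \in fspan (@tree_wf R O A fl _ _ _) ->
  opd e' (opd e v) = 0.
Proof.
move=> vwf; apply: (linear_wf0 (f := fun v => opd e' (opd e v)) vwf).
  by move=> k u w; rewrite !linearP.
by move=> t twf; rewrite [opd e _]flin_bas; exact: dgood_dd (dgoodP twf) _ _.
Qed.

Lemma opd_deg x y n (v : V x y n) e : v \in fspan (@tree_wf R O A fl _ _ _) ->
  e != n + 1 -> opd e v = 0.
Proof.
move=> vwf ne; apply: (linear_wf0 vwf) => [|t twf]; first exact: linearP.
by rewrite [opd e _]flin_bas; exact: dgood_deg (dgoodP twf) _ ne.
Qed.

Lemma Psi_opd x y n (v : V x y n) e : v \in fspan (@tree_wf R O A fl _ _ _) ->
  Psi (opd e v) = ainf_m A (Snoc Nil (Psi v)) e.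
Proof.
move=> vwf; apply/eqP; rewrite -subr_eq0; apply/eqP.
apply: (linear_wf0 (f := fun v => Psi (opd e v) - ainf_m A (Snoc Nil (Psi v)) e) vwf).
  move=> k u w; rewrite !linearP (ainf_linear e Nil Nil) /=.
  by rewrite scalerBr opprD addrACA.
move=> t twf; rewrite [opd e _]flin_bas dgood_psi; last exact: dgoodP.
by rewrite [Psi (fbas R t)]flin_bas subrr.
Qed.

Lemma op_deg x y (s : W x y) e : wspan s -> e != wout s -> op s e = 0.
Proof.
move=> swf ne; have [s2|s1] := ltnP 1 (wlen s); first by rewrite op_op2 // op2_deg.
case: s swf s1 ne => [_ _|? ? ? s v]; first by rewrite op_nil.
case: s v => // v [_ vwf] _ ne; apply: opd_deg => //.
by move: ne; rewrite /wout /=; lia.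
Qed.

Lemma Psi_op x y (s : W x y) e : wspan s -> Psi (op s e) = ainf_m A (WPsi s) e.
Proof.
move=> swf; have [s2|s1] := ltnP 1 (wlen s).
  by have [N sN] := wspan_wle swf; exact: (psi_op e sN).
case: s swf s1 => [_ _|? ? ? s v]; first by rewrite op_nil linear0 ainf_m0.
by case: s v => // v [_ vwf] _; exact: Psi_opd.
Qed.

Lemma op_rel x y (s : W x y) : wspan s -> rel s.
Proof.
move=> swf e; have [s2|s1] := ltnP 1 (wlen s).
  by have [N sN] := wspan_wle swf; exact: (rel_wle sN).
case: s swf s1 => [_ _|? ? ? s v]; first exact: coder_nil.
by case: s v => // v [_ vwf] _; rewrite coder_letter opd_opd.
Qed.

End FormalOperations.

(** * The cofibrant model *)

Section CofibrantModel.
Variables (R : comPzRingType) (O : Type) (A : ainf_on R O) (fl : flavour).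
Notation H := (ainf_hom A).
Notation V := (V0 H).
Notation W := (word (V0 H)).
Notation op := (@word_op R O A fl _ _).
Notation Psi := (@free_psi R O A _ _ _).
Hypothesis Afl : has_flavour fl (AInf A).

Definition cm_hom x y n : lmodType R := fsub R (@tree_wf R O A fl x y n).
Notation CW := (word cm_hom).

Definition cm_val x y n (v : cm_hom x y n) : V x y n := fsub_val v.
HB.instance Definition _ x y n :=
  GRing.isLinear.Build R (cm_hom x y n) (V x y n) _ (@cm_val x y n)
    (@fsub_val_is_linear R _ _).
Notation wval s := (wmap (W := V) (F0 := id) (fun x y n (v : cm_hom x y n) => cm_val v) s).

Lemma cm_val_inj x y n : injective (@cm_val x y n).
Proof. exact: val_inj. Qed.

Lemma cm_val_wf x y n (v : cm_hom x y n) :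
  cm_val v \in fspan (@tree_wf R O A fl x y n).
Proof. exact: fsub_valP. Qed.

Lemma wspan_val x y (s : CW x y) : wspan fl (wval s).
Proof. by elim: s => //= {}y z p s IH v; split=> //; exact: cm_val_wf. Qed.

Definition cm_m x y (s : CW x y) (e : int) : cm_hom x y e :=
  FSub (op_wf Afl e (wspan_val s)).

Lemma cm_val_m x y (s : CW x y) e : cm_val (cm_m s e) = op (wval s) e.
Proof. by []. Qed.

Lemma cm_m0 x e : cm_m (Nil : CW x x) e = 0.
Proof. exact: cm_val_inj. Qed.

Lemma cm_deg x y (s : CW x y) e : e != wdeg s + 2 - (wlen s)%:Z -> cm_m s e = 0.
Proof.
move=> ne; apply: cm_val_inj; rewrite cm_val_m linear0.
by apply: (op_deg Afl (wspan_val s)); rewrite wout_map.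
Qed.

Lemma cm_multilinear x y e : multilinear (fun s : CW x y => cm_m s e).
Proof.
move=> y' z p s t a f g; apply: cm_val_inj; rewrite linearP !cm_val_m.
exact: (multilinear_map (fun x y n => @cm_val x y n) (@op_multilinear _ _ A fl x y e)).
Qed.

Lemma cm_rel x y (s : CW x y) e :
  coder cm_m (fun u => cm_m u e) s = 0.
Proof.
apply: cm_val_inj; rewrite linear0 -(op_rel Afl (wspan_val s) e).
rewrite /coder linear_cut3 cut3_map; apply: eq_cut3 => y1 y2 a b c _.
rewrite linearZ wsign_map wout_map; congr (_ *: _).
by rewrite -[LHS]/(op (wval _) e) wmap_cat.
Qed.

Lemma cm_ainf_rel x y (s : CW x y) e :
  \sum_(p <- splittings s)
    \sum_(q <- splittings (sp_right p) | (0 < wlen (sp_left q))%N)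
      ksign R (wdeg (sp_left p) - (wlen (sp_left p))%:Z) *:
      cm_m (wcat (Snoc (sp_left p) (cm_m (sp_left q)
        (wdeg (sp_left q) + 2 - (wlen (sp_left q))%:Z))) (sp_right q)) e = 0.
Proof.
rewrite -[RHS](cm_rel s e) -coder_relE //; last exact: cm_m0.
exact: cm_multilinear.
Qed.

Definition cm_on : ainf_on R O :=
  AInfOn cm_m0 cm_deg (fun x y z w p e s t a f g => @cm_multilinear x w e y z p s t a f g)
    cm_ainf_rel.

Lemma cm_flavour : has_flavour fl (AInf cm_on).
Proof.
have : fl = DG -> is_dg (AInf cm_on).
  move=> flE x y s e s3; apply: cm_val_inj; rewrite [LHS]cm_val_m linear0.
  by apply: op_dg_gt2 => //; rewrite wlen_map.
by rewrite /has_flavour; move: (is_dg _) => P; case: fl => //; exact.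
Qed.

Definition cm_psi x y n (v : cm_hom x y n) : H x y n := Psi (cm_val v).
HB.instance Definition _ x y n :=
  GRing.Linear.copy (@cm_psi x y n) (@free_psi R O A x y n \o @cm_val x y n).

Lemma cm_psi_m x y (s : word (ainf_hom cm_on) x y) e :
  cm_psi (ainf_m cm_on s e) =
  ainf_m A (wmap (W := ainf_hom A) (F0 := id) (fun x y n f => cm_psi f) s) e.
Proof.
rewrite /cm_psi cm_val_m (Psi_op Afl) ?wmap_comp //; exact: wspan_val.
Qed.

Definition cm_Psi : sfun (AInf cm_on) (AInf A) :=
  @SFun R (AInf cm_on) (AInf A) id (fun x y n => @cm_psi x y n) cm_psi_m.
End CofibrantModel.

(** * Surjectivity, quasi-isomorphism and cofibrancy *)

Section CofibrantModelProperties.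
Variables (R : comPzRingType) (O : Type) (A : ainf_on R O) (fl : flavour).
Hypothesis Afl : has_flavour fl (AInf A).
Notation H := (ainf_hom A).
Notation tree := (tree H).
Notation V := (V0 H).
Notation dt := (@tree_d R O A fl _ _ _).
Notation opd := (@free_d R O A fl _ _ _).
Notation wf := (@tree_wf R O A fl _ _ _).
Notation Psi := (@free_psi R O A _ _ _).
Notation C := (AInf (cm_on Afl)).
Notation chom x y := (hom_dg (A := AInf (cm_on Afl)) x y).

Lemma cm_val_d x y n e (v : chom x y n) :
  cm_val (dg_d (chom x y) n e v) = opd e (cm_val v).
Proof. by []. Qed.

(** The cocycle is put into the syntax of [Gen] by enumerating its support: [zf] is [z] in degree
    [k] and zero elsewhere. Only nonzero coefficients are listed, as every tree of the family must
    be well formed. *)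
Lemma cell x y n k (z : V x y k) (f : H x y n) : k = n + 1 ->
  z \in fspan (@tree_wf R O A fl x y k) -> (forall e, opd e z = 0) ->
  Psi z = ainf_m A (Snoc Nil f) k ->
  exists t : tree x y n, [/\ wf t, psi t = f & dt t k = z].
Proof.
move=> ek zwf dz pz; pose zf e : V x y e := gcast e z.
have zk : zf k = z by rewrite /zf gcast_id.
pose t := Gen (x := x) (y := y) (fun e i => zf e (tnth (in_tuple (fsuppnz (zf e))) i))
  (fun e i => tnth (in_tuple (fsuppnz (zf e))) i) f.
have zf0 e : e != k -> zf e = 0 by move=> ne; rewrite /zf gcast_ne // eq_sym.
have dtE e : dt t e = zf e.
  by rewrite /= -[RHS]flin_fbas flin_suppnz.
exists t; split=> //; last by rewrite dtE zk.
split=> [e i|e ne|e e'|e].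
- apply: fsuppnz_span; have [->|ne] := eqVneq e k; first by rewrite zk.
  by rewrite zf0 // rpred0.
- by rewrite zf0 ?fsuppnz0 // ek.
- rewrite -[LHS](flin_suppnz (fun t => dt t e')).
  have [->|ne] := eqVneq e k; first by rewrite zk; exact: dz.
  by rewrite zf0 // linear0.
- rewrite -[LHS](flin_suppnz (@psi R O A x y e)).
  have [->|ne] := eqVneq e k; first by rewrite zk; exact: pz.
  rewrite zf0 // linear0 ainf_deg //=; lia.
Qed.

Lemma fbas_wf x y n (t : tree x y n) : wf t ->
  exists v : cm_hom A fl x y n, cm_val v = fbas R t.
Proof. by move=> twf; exists (FSub (fbas_span R twf)). Qed.

(** The lifting property of the projection against the inclusion of a sphere into a disk, realised
    by a single cell. Surjectivity and the quasi-isomorphism are special cases. *)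
Lemma cm_fill x y n k (z : chom x y k) (f : H x y n) : k = n + 1 ->
  (forall e, dg_d (chom x y) k e z = 0) ->
  cm_psi z = ainf_m A (Snoc Nil f) k ->
  exists2 v : chom x y n, cm_psi v = f & dg_d (chom x y) n k v = z.
Proof.
move=> ek dz pz.
have [|t [twf tf dtz]] := cell ek (cm_val_wf z) _ pz.
  by move=> e; rewrite -cm_val_d dz linear0.
have [v vt] := fbas_wf twf; exists v; first by rewrite /cm_psi vt /free_psi flin_bas.
by apply: cm_val_inj; rewrite cm_val_d vt /free_d flin_bas.
Qed.

Lemma cm_lift_cocycle x y n (f : H x y n) : ainf_m A (Snoc Nil f) (n + 1) = 0 ->
  exists2 v : chom x y n, cm_psi v = f & forall e, dg_d (chom x y) n e v = 0.
Proof.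
move=> df; have [|||v vf dv] := @cm_fill x y n (n + 1) 0 f.
- by [].
- by move=> e; rewrite linear0.
- by rewrite df linear0.
exists v => // e; have [->//|ne] := eqVneq e (n + 1).
by rewrite dg_deg.
Qed.

Lemma cm_psi_surj x y n (f : H x y n) : exists v : chom x y n, cm_psi v = f.
Proof.
have [|z zf dz] := @cm_lift_cocycle x y (n + 1) (ainf_m A (Snoc Nil f) (n + 1)).
  exact: (m1_rel (A := AInf A) f _ erefl).
have [|||v vf _] := @cm_fill x y n (n + 1) z f => //.
by exists v.
Qed.

Lemma cm_psi_qis x y : quasi_iso (sfun_dgmap (cm_Psi Afl) x y).
Proof.
move=> n; apply: bij_of_inj_surj.
  move=> u v; rewrite -[u]hreprK -[v]hreprK !hmapE => /hclassP[b eb].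
  apply/hclassP; set z := cocycle_val _ - _.
  have [|e||v' _ dv] := @cm_fill x y (n - 1) n z b; last by exists v'.
  - by rewrite subrK.
  - have [->|ne] := eqVneq e (n + 1); last by rewrite dg_deg.
    rewrite linearB; have /eqP-> := cocycleP (hrepr u).
    by have /eqP-> := cocycleP (hrepr v); rewrite subrr.
  - by rewrite /z linearB; exact: esym eb.
move=> h; rewrite -[h]hreprK; have /eqP zc := cocycleP (hrepr h).
have [v vf dv] := cm_lift_cocycle zc.
have vc : v \in @is_cocycle R (chom x y) n by rewrite inE dv.
by exists (hclass (Cocycle vc)); rewrite hmapE; congr hclass; exact: val_inj.
Qed.

(* A lift is chosen on the basis of trees by induction on the weight. *)
Lemma cm_cofibrant : cofibrant_morphisms C.
Proof.
move=> x y E B p ps pq f.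
have fl0 n : linear (fun v : cm_hom A fl x y n => f n v) by exact: linearP.
pose F n := projT1 (cid (linear_fsub (fl0 n))).
have Fwf n t (twf : wf t) : F n t = f n (FSub (fbas_span R twf)).
  exact: (projT2 (cid (linear_fsub (fl0 n)))).1.
have fF n (v : cm_hom A fl x y n) : f n v = flin (F n) (cm_val v).
  exact: (projT2 (cid (linear_fsub (fl0 n)))).2.
pose choice n (Q : E n -> Prop) : E n :=
  if pselect (exists e, Q e) is left h then projT1 (cid h) else 0.
have choiceP n (Q : E n -> Prop) : (exists e, Q e) -> Q (choice n Q).
  by rewrite /choice; case: pselect => // h _; exact: (projT2 (cid h)).
(* Recursion on a bound for the weight, since the trees of [dt t] need not be subterms of [t]. A
   tree of weight at most [N'] keeps its earlier value, so [G N] is independent of [N] once it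
   bounds the weight. *)
pose fix G (N : nat) (n : int) (t : tree x y n) {struct N} : E n :=
  if N is N'.+1 then
    if (wt t <= N')%N then G N' n t
    else choice n (fun e => p n e = F n t /\
      forall k, dg_d E n k e = flin (G N' k) (dt t k))
  else 0.
have GE N n (t : tree x y n) : (wt t <= N)%N -> G N n t = G (wt t) n t.
  elim: N => [|N IH]; first by rewrite leqn0 => /eqP->.
  rewrite leq_eqVlt => /orP[/eqP->//|tN]; by rewrite /= -ltnS tN IH.
have GP N n (t : tree x y n) : wf t -> (wt t <= N)%N ->
    p n (G N n t) = F n t /\ forall k, dg_d E n k (G N n t) = flin (G N k) (dt t k).
  elim: N n t => [|N IH] n t twf tN.
    by have := wt_gt0 twf; lia.
  have tgood := dgoodP Afl twf.
  have GN k : flin (G N.+1 k) (dt t k) = flin (G N k) (dt t k).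
    apply: (flin_eq (dgood_span tgood k)) => t' [_ lt]; rewrite !GE //; lia.
  have [le|lt] := leqP (wt t) N.
    have GNt : G N.+1 n t = G N n t by rewrite /= le.
    by rewrite GNt; have [-> dG] := IH _ _ twf le; split=> // k; rewrite dG GN.
  pose Q (e : E n) := p n e = F n t /\
    forall k, dg_d E n k e = flin (G N k) (dt t k).
  have -> : G N.+1 n t = choice n Q by rewrite /= leqNgt lt.
  suff /(choiceP n Q)[-> dG] : exists e, Q e by split=> // k; rewrite dG GN.
  (* The lift is already fixed on [dt t], whose trees have lower weight. Its value there is a
     cocycle because d^2 = 0, and it lies over d (F t) because [f] is a chain map. *)
  have [l||e pe de] := @trivial_fibration_lift R E B p n (n + 1)
      (flin (G N (n + 1)) (dt t (n + 1))) (F n t) ps pq erefl.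
  - rewrite linear_comp_flin.
    transitivity (flin (fun t' => flin (G N l) (dt t' l)) (dt t (n + 1))).
      apply: (flin_eq (dgood_span tgood (n + 1))) => t' [t'wf lt'].
      by have [//|_ ->] := IH _ t' t'wf; first lia.
    by rewrite -(linear_comp_flin (flin (G N l))) [flin _ (dt t _)]dgood_dd // linear0.
  - rewrite linear_comp_flin.
    transitivity (flin (F (n + 1)) (dt t (n + 1))).
      apply: (flin_eq (dgood_span tgood (n + 1))) => t' [t'wf lt'].
      by have [//|-> _] := IH _ t' t'wf; first lia.
    by rewrite (Fwf _ _ twf) -dg_mapP fF cm_val_d [opd _ _]flin_bas.
  exists e; split=> // k; have [->//|ne] := eqVneq k (n + 1).
  by rewrite dg_deg // (dgood_deg tgood ne) linear0.
pose G' n (t : tree x y n) := G (wt t) n t.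
have dG n k (t : tree x y n) : wf t -> dg_d E n k (G' n t) = flin (G' k) (dt t k).
  move=> twf; have [_ ->] := GP _ _ _ twf (leqnn (wt t)).
  apply: (flin_eq (dgood_span (dgoodP Afl twf) k)) => t' [_ lt].
  by rewrite /G' GE // ltnW.
pose g n (v : chom x y n) : E n := flin (G' n) (cm_val v).
have gl n : linear (@g n) by move=> a u v; rewrite /g !linearP.
pose gL n : {linear chom x y n -> E n} :=
  HB.pack (@g n) (GRing.isLinear.Build R (chom x y n) (E n) _ (@g n) (gl n)).
have gd n e (v : chom x y n) : gL e (dg_d (chom x y) n e v) = dg_d E n e (gL n v).
  rewrite [LHS](linear_comp_flin (flin (G' e))) [RHS]linear_comp_flin.
  by apply: (flin_eq (cm_val_wf v)) => t twf; rewrite dG.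
exists (DGMap gd) => n v; rewrite /= /g linear_comp_flin fF.
apply: (flin_eq (cm_val_wf v)) => t twf.
by have [-> _] := GP _ _ _ twf (leqnn (wt t)).
Qed.

End CofibrantModelProperties.

(** * Consequences in cohomology: quasi-equivalence, units and homotopies *)

Section IdentityNatIso.
Variables (R : comPzRingType) (D : gcat R).

Definition id_multiplier (x : D) : multiplier x x :=
  @Multiplier R D x x (fun z n => idfun) (fun z n => idfun)
    (fun _ _ _ _ _ _ _ => erefl) (fun _ _ _ _ _ _ _ => erefl)
    (fun _ _ _ _ _ _ _ => erefl).

(** Identity multipliers exist even without units, so pointwise equal actions over one object map
    are naturally isomorphic. *)
Lemma gnatiso_id (C : gcat R) (F0 : C -> D)
    (F1 G1 : forall x y n, {linear ghom x y n -> ghom (F0 x) (F0 y) n}) Fc Gc :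
  (forall x y n a, F1 x y n a = G1 x y n a) ->
  gnatiso (@GFun R C D F0 F1 Fc) (@GFun R C D F0 G1 Gc).
Proof.
move=> FG; exists (fun x => id_multiplier (F0 x)), (fun x => id_multiplier (F0 x)).
by split=> [x z n|x y n a] //; rewrite /= FG.
Qed.
End IdentityNatIso.

Section Transfer.
Variables (R : comPzRingType) (O : Type) (A : ainf_on R O) (fl : flavour).
Hypothesis Afl : has_flavour fl (AInf A).
Notation C := (AInf (cm_on Afl)).
Notation P := (cm_Psi Afl).
Notation hP x y n := (@hmap R _ _ (sfun_dgmap P x y) n).

Lemma hP_comp (x y z : O) p q e (g : cohomology (hom_dg (A := C) y z) q)
    (f : cohomology (hom_dg (A := C) x y) p) :
  hP x z e (hcomp g f e) = hcomp (hP y z q g) (hP x y p f) e.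
Proof. exact: hmap_comp. Qed.

Lemma hP_inj (x y : C) n : injective (hP x y n).
Proof. have := @cm_psi_qis R O A fl Afl x y n. exact: bij_inj. Qed.

Lemma hP_surj (x y : C) n h : exists u, hP x y n u = h.
Proof. by have [g _ gK] := @cm_psi_qis R O A fl Afl x y n; exists (g h). Qed.

Definition hPinv (x y : O) n (h : cohomology (hom_dg (A := AInf A) x y) n) :
  cohomology (hom_dg (A := C) x y) n := projT1 (cid (@hP_surj x y n h)).

Lemma hPinvK x y n : cancel (@hPinv x y n) (hP x y n).
Proof. by move=> h; exact: (projT2 (cid (@hP_surj x y n h))). Qed.

Lemma hPinv_linear x y n : linear (@hPinv x y n).
Proof. by move=> a u v; apply: (@hP_inj x y n); rewrite hPinvK linearP /= !hPinvK. Qed.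
HB.instance Definition _ x y n := GRing.isLinear.Build R
  (cohomology (hom_dg (A := AInf A) x y) n) (cohomology (hom_dg (A := C) x y) n) _
  (@hPinv x y n) (@hPinv_linear x y n).

Lemma hPinv_comp (x y z : O) p q e (g : cohomology (hom_dg (A := AInf A) y z) q)
    (f : cohomology (hom_dg (A := AInf A) x y) p) :
  hPinv (hcomp g f e) = hcomp (hPinv g) (hPinv f) e.
Proof. by apply: hP_inj; rewrite hP_comp !hPinvK. Qed.

(** H(Psi) is the identity on objects and bijective on morphisms; the inverse bijections form a
    functor, and both composites act as identities. *)
Lemma cm_quasi_equivalence : quasi_equivalence P.
Proof.
exists (@GFun R (cohomology_cat (AInf A)) (cohomology_cat C) id
  (fun x y n => @hPinv x y n) hPinv_comp).
split; apply: gnatiso_id => x y n a /=; last exact: hPinvK.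
by apply: hP_inj; rewrite hPinvK.
Qed.

(** Being bijective on morphisms over the identity on objects, H(Psi) reflects units as well as
    preserving them. *)
Lemma is_unit_hP (x : O) (u : @ghom R (cohomology_cat C) x x 0) :
  is_unit u <-> @is_unit R (cohomology_cat (AInf A)) x (hP x x 0 u).
Proof.
split=> [[u1 u2]|[u1 u2]]; split=> y p f.
- have [g <-] := hP_surj f; rewrite -[LHS](hP_comp p g u); congr (hP _ _ _ _); exact: u1.
- have [g <-] := hP_surj f; rewrite -[LHS](hP_comp p u g); congr (hP _ _ _ _); exact: u2.
- by apply: hP_inj; rewrite [LHS](hP_comp p f u); exact: u1.
- by apply: hP_inj; rewrite [LHS](hP_comp p u f); exact: u2.
Qed.

Lemma cm_Psi_coh_unital : coh_unital_fun P.
Proof. by move=> x u /is_unit_hP. Qed.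

Lemma cm_coh_unital : coh_unital (AInf A) -> coh_unital C.
Proof.
move=> Au x; have [u uP] := Au x; exists (hPinv u); apply/is_unit_hP.
by rewrite hPinvK.
Qed.

(** Precomposing the homotopy for [phiA] with Psi yields a null homotopy of Psi (phi - id), which
    [nullhtpy_lift] raises to one of phi - id. *)
Lemma cm_htpy_lift (x y : O)
    (phi : forall n, {linear hom_dg (A := C) x y n -> hom_dg (A := C) x y n})
    (phiA : forall n, hom_dg (A := AInf A) x y n -> hom_dg (A := AInf A) x y n) :
  (forall n e v, phi e (dg_d (hom_dg (A := C) x y) n e v) = dg_d _ n e (phi n v)) ->
  (forall n v, cm_psi (phi n v) = phiA n (cm_psi v)) ->
  homotopic phiA (fun n f => f) -> homotopic phi (fun n f => f).
Proof.
move=> phid phiP [h hP].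
pose del n (v : hom_dg (A := C) x y n) := phi n v - v.
have dell n : linear (@del n).
  by move=> a u v; rewrite /del linearP scalerBr opprD addrACA.
pose delL n : {linear hom_dg (A := C) x y n -> hom_dg (A := C) x y n} :=
  HB.pack (@del n) (GRing.isLinear.Build R _ _ _ (@del n) (dell n)).
have deld n e v : delL e (dg_d (hom_dg (A := C) x y) n e v) = dg_d _ n e (delL n v).
  by rewrite /= /del linearB phid.
pose k n e (v : hom_dg (A := C) x y n) : hom_dg (A := AInf A) x y e := h n e (cm_psi v).
have kl n e : linear (@k n e) by move=> a u v; rewrite /k !linearP.
pose kL n e : {linear hom_dg (A := C) x y n -> hom_dg (A := AInf A) x y e} :=
  HB.pack (@k n e) (GRing.isLinear.Build R _ _ _ (@k n e) (kl n e)).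
have := @nullhtpy_lift R _ _ (sfun_dgmap P x y) (DGMap deld) kL _
  (@cm_cofibrant R O A fl Afl x y).
case=> [n v|||h' h'P].
- rewrite /= /del linearB /= phiP hP; congr (_ + _).
  by rewrite /k; congr (h _ _ _); exact: esym (dg_mapP (sfun_dgmap P x y) _ _).
- by move=> n f; exact: cm_psi_surj.
- exact: cm_psi_qis.
by exists h' => n v; exact: h'P.
Qed.

Lemma cm_unital : unital (AInf A) -> unital C.
Proof.
move=> [Au A1]; split; first exact: cm_coh_unital.
move=> x; have [one [oneu oneh]] := A1 x.
have /eqP one0 := cocycleP one.
(* The representative itself is lifted and not only its class: products with [v] then lie strictly
   over products with [one], as [cm_htpy_lift] requires. *)
have [v vone dv] := cm_lift_cocycle Afl one0.
have vc : v \in @is_cocycle R (hom_dg (A := C) x x) 0 by rewrite inE dv.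
exists (Cocycle vc); split.
  apply/is_unit_hP; rewrite hmapE; congr is_unit: oneu.
  by congr hclass; apply: val_inj.
have m1v k : m1 (A := C) v k = 0 by exact: dv.
have psi2 y z w p q e (g : ainf_hom (cm_on Afl) z w q) (f : ainf_hom (cm_on Afl) y z p) :
    cm_psi (m2 (A := C) g f e) = m2 (A := AInf A) (cm_psi g) (cm_psi f) e.
  exact: (cm_psi_m (Snoc (Snoc Nil f) g) e).
move=> y; have [hl hr] := oneh y; split.
- pose phi n (f : hom_dg (A := C) x y n) := m2 (A := C) f v n.
  pose phiL n : {linear hom_dg (A := C) x y n -> hom_dg (A := C) x y n} :=
    HB.pack (@phi n) (GRing.isLinear.Build R _ _ _ (@phi n) (m2_linearl n v)).
  apply: (cm_htpy_lift (phi := phiL) _ _ hl) => [n e f|n f]; last first.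
    by rewrite -vone -psi2.
  rewrite /= /phi /hom_d; have [->|ne] := eqVneq e (n + 1); last first.
    by rewrite !m1_deg // m2_0l.
  have en : n = 0 + n by rewrite add0r.
  have := m2_rel (A := C) f v (n + 1) erefl erefl en.
  by rewrite m1v m2_0r addr0 ksign0 scale1r => /eqP; rewrite subr_eq0 => /eqP.
pose phi n (f : hom_dg (A := C) y x n) := ksign R n *: m2 (A := C) v f n.
have phil n : linear (@phi n).
  move=> a f g; rewrite /phi m2_linearr scalerDr !scalerA.
  by rewrite [a * _]mulrC.
pose phiL n : {linear hom_dg (A := C) y x n -> hom_dg (A := C) y x n} :=
  HB.pack (@phi n) (GRing.isLinear.Build R _ _ _ (@phi n) (phil n)).
apply: (cm_htpy_lift (phi := phiL) _ _ hr) => [n e f|n f]; last first.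
  by rewrite linearZ /= psi2 vone.
rewrite linearZ /= /phi /hom_d; have [->|ne] := eqVneq e (n + 1); last first.
  by rewrite !m1_deg // m2_0r !scaler0.
have en : n = n + 0 by rewrite addr0.
have := m2_rel (A := C) v f (n + 1) erefl erefl en.
rewrite m1v m2_0l scaler0 subr0 => /eqP; rewrite addr_eq0 => /eqP->.
by rewrite ksignD ksign1 mulrN1 scaleNr scalerN.
Qed.
End Transfer.

(** * Functoriality *)

Section Functor.
Variables (R : comPzRingType) (A B : ainf R) (F : sfun A B) (fl : flavour).
Notation HA := (ainf_hom A).
Notation HB := (ainf_hom B).

(** Only the labels of cells change. Coefficients and shapes are kept, and trees that acquire equal
    images inside a cell are not collected; identities and composites are therefore preserved
    strictly. *)
Fixpoint tmap x y n (t : tree HA x y n) : tree HB (F x) (F y) n :=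
  match t in tree _ x y n return tree HB (F x) (F y) n with
  | Gen _ _ _ k c t f => Gen c (fun e i => tmap (t e i)) (sf_hom F _ f)
  | Node _ _ e G => Node e (fmap G)
  | Cmp _ _ _ _ _ e a g => Cmp e (tmap a) (tmap g)
  end
with fmap x y (G : forest HA x y) : forest HB (F x) (F y) :=
  match G in forest _ x y return forest HB (F x) (F y) with
  | FNil _ => FNil
  | FSnoc _ _ _ _ G t => FSnoc (fmap G) (tmap t)
  end.

Definition Vmap x y n (v : V0 HA x y n) : V0 HB (F x) (F y) n :=
  flin (fun t => fbas R (tmap t)) v.
HB.instance Definition _ x y n :=
  GRing.isLinear.Build R (V0 HA x y n) (V0 HB (F x) (F y) n) _ (@Vmap x y n)
    (flin_is_linear (fun t : tree HA x y n => fbas R (tmap t))).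

Notation WV s := (wmap (W := V0 HB) (F0 := F) (fun x y n (v : V0 HA x y n) => Vmap v) s).
Notation opA := (@word_op R A A fl _ _).
Notation opB := (@word_op R B B fl _ _).
Notation opdA := (@free_d R A A fl _ _ _).
Notation opdB := (@free_d R B B fl _ _ _).
Notation dtA := (@tree_d R A A fl _ _ _).
Notation dtB := (@tree_d R B B fl _ _ _).

Lemma Vmap_bas x y n (t : tree HA x y n) : Vmap (fbas R t) = fbas R (tmap t).
Proof. exact: flin_bas. Qed.

Lemma flen_fmap x y (G : forest HA x y) : flen (fmap G) = flen G.
Proof. by elim: G => //= ? ? ? ? G -> t. Qed.

Lemma fdeg_fmap x y (G : forest HA x y) : fdeg (fmap G) = fdeg G.
Proof. by elim: G => //= ? ? ? ? G -> t. Qed.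

Lemma emb_fmap x y (G : forest HA x y) : WV (emb G) = emb (fmap G).
Proof. by elim: G => //= ? ? ? ? G -> t; rewrite Vmap_bas. Qed.

Lemma is_gen_tmap x y n (t : tree HA x y n) : is_gen (tmap t) = is_gen t.
Proof. by case: t. Qed.

Lemma psi_tmap :
  (forall x y n (t : tree HA x y n), psi (tmap t) = sf_hom F n (psi t)) /\
  (forall x y (G : forest HA x y), psiF (fmap G) =
     wmap (W := HB) (F0 := F) (fun x y n f => sf_hom F n f) (psiF G)).
Proof.
apply: tree_forest_ind => //=.
- by move=> x y e G ->; rewrite sf_m.
- by move=> x y z p q e a -> g ->; rewrite sf_m.
- by move=> x y z p G -> t ->.
Qed.

Lemma Psi_Vmap x y n (v : V0 HA x y n) :
  free_psi (A := B) (Vmap v) = sf_hom F n (free_psi (A := A) v).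
Proof.
rewrite /free_psi !linear_comp_flin; apply: (flin_eq (fspanT v)) => t _.
by rewrite [LHS]flin_bas psi_tmap.1.
Qed.

Lemma Vmap_mul y z q (b : tree HA y z q) x p (a : tree HA x y p) e :
  Vmap (mul b a e) = mul (tmap b) (tmap a) e.
Proof.
move: y z q b x p a e.
pose Q y z q (b : tree HA y z q) := forall x p (a : tree HA x y p) e,
  Vmap (mul b a e) = mul (tmap b) (tmap a) e.
suff [] : (forall y z q b, Q y z q b) /\ (forall x y (G : forest HA x y), True) by [].
apply: (@tree_forest_ind R A HA Q (fun _ _ _ => True)) => //.
- by move=> y z q k c t _ f x p a e /=; case: eqP => _; rewrite ?Vmap_bas ?linear0.
- by move=> y z q G _ x p a e /=; case: eqP => _; rewrite ?Vmap_bas ?linear0.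
move=> y u z p1 q1 q b IH g _ x p a e /=; case: eqP => _; last by rewrite linear0.
rewrite linearZ /= -IH [X in _ = _ *: X]linear_comp_flin; congr (_ *: _).
rewrite [LHS]linear_comp_flin; apply: (flin_eq (fspanT _)) => t _.
by rewrite [LHS]Vmap_bas [RHS]flin_bas.
Qed.

Lemma Vmap_nd x y (G : forest HA x y) e : Vmap (tree_prod fl G e) = tree_prod fl (fmap G) e.
Proof.
rewrite /tree_prod; case: fl.
  by rewrite fdeg_fmap flen_fmap; case: eqP => _; rewrite ?Vmap_bas ?linear0.
case: G => [*|? ? ? ? G b]; first by rewrite linear0.
case: G b => [*|? ? ? ? G a b]; first by rewrite linear0.
by case: G a b => *; rewrite /= ?linear0 //; exact: Vmap_mul.
Qed.

Lemma Vmap_op x y (s : word (V0 HA) x y) e : (2 <= wlen s)%N ->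
  Vmap (opA s e) = opB (WV s) e.
Proof.
move=> s2; have ml := multilinear_map (fun x y n => @Vmap x y n)
  (@op_multilinear R B B fl (F x) (F y) e).
rewrite (multilinear_mext s ml) [LHS]linear_mext; apply: eq_mext_len => G Gl _.
by rewrite emb_fmap /= -op_emb !op_emb2 ?flen_fmap ?Gl // Vmap_nd.
Qed.

(** In arity at least two [Vmap_op] holds for all words. In arity one, commutation is a hypothesis
    on the letters, supplied by the induction in [tmap_wf]. *)
Fixpoint wcomm x y (s : word (V0 HA) x y) : Prop :=
  match s with
  | Nil => True
  | Snoc _ _ _ s v => wcomm s /\ forall e, Vmap (opdA e v) = opdB e (Vmap v)
  end.

Lemma wcomm_cat x y z (s : word (V0 HA) x y) (t : word (V0 HA) y z) :
  wcomm (wcat s t) -> wcomm s /\ wcomm t.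
Proof. by elim: t s => //= ? ? ? t IH v s [/IH[? ?] ?]. Qed.

Lemma wcomm_op x y (s : word (V0 HA) x y) e : wcomm s ->
  Vmap (opA s e) = opB (WV s) e.
Proof.
have [s2 _|s1] := ltnP 1 (wlen s); first exact: Vmap_op.
case: s s1 => [_ _|? ? ? s v]; first by rewrite !op_nil linear0.
by case: s v => // v _ [_ vc]; exact: vc.
Qed.

(** Source and target both satisfy the relation on this word and their other terms correspond, so
    [coder_transfer] yields the remaining one, the differential of the monomial. *)
Lemma tmap_monomial x y (G : forest HA x y) e : forest_wf fl G -> forest_wf fl (fmap G) ->
  (2 <= flen G)%N -> wcomm (emb G) ->
  Vmap (opdA e (opA (emb G) (wout (emb G)))) =
  opdB e (opB (emb (fmap G)) (wout (emb G))).
Proof.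
move=> Gwf FGwf G2 Gc.
have rA := rel_wf Gwf G2 e.
have rB : coder (@word_op R B B fl) (fun u => opB u e) (WV (emb G)) = 0.
  by rewrite emb_fmap; apply: rel_wf; rewrite ?flen_fmap.
rewrite -emb_fmap.
apply: (coder_transfer (F1 := fun x y n => @Vmap x y n) rA rB) => y1 y2 a b c abc ac.
have [_ /wcomm_cat[bc _]] : wcomm a /\ wcomm (wcat b c).
  by apply: wcomm_cat; rewrite abc.
rewrite [LHS]Vmap_op; last by rewrite wlen_cat /= addSn ltnS.
by rewrite wmap_cat /= wcomm_op.
Qed.

(** The two claims need each other. The image of a cell is well formed only if its boundary stays a
    cocycle, which is commutation with d on the boundary; commutation at a monomial uses the
    relation in [B], hence well formedness of the image. *)
Lemma tmap_wf :
  (forall x y n (t : tree HA x y n), tree_wf fl t ->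
     tree_wf fl (tmap t) /\ forall e, Vmap (dtA t e) = dtB (tmap t) e) /\
  (forall x y (G : forest HA x y), forest_wf fl G -> forest_wf fl (fmap G) /\ wcomm (emb G)).
Proof.
have mono x y n (t : tree HA x y n) (G : forest HA x y) e :
    fbas R t = opA (emb G) n -> n = wout (emb G) ->
    forest_wf fl G -> forest_wf fl (fmap G) -> (2 <= flen G)%N -> wcomm (emb G) ->
    Vmap (dtA t e) = dtB (tmap t) e.
  move=> tE nE Gwf FGwf G2 Gc; subst n.
  have -> : dtA t e = opdA e (opA (emb G) (wout (emb G))).
    by rewrite -tE [RHS]flin_bas.
  rewrite tmap_monomial // -emb_fmap -Vmap_op ?wlen_emb // -tE Vmap_bas.
  by rewrite [LHS]flin_bas.
apply: tree_forest_ind.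
- move=> x y n k c t IH f /= [twf k0 dd pp].
  have comb e : Vmap (\sum_(i < k e) c e i *: fbas R (t e i)) =
      \sum_(i < k e) c e i *: fbas R (tmap (t e i)).
    by rewrite linear_sum; apply: eq_bigr => i _; rewrite linearZ /= Vmap_bas.
  split=> //; split=> [e i|//|e e'|e].
  + by have [] := IH e i (twf e i).
  + rewrite -[RHS](linear0 (@Vmap x y e')) -(dd e e') linear_sum.
    apply: eq_bigr => i _; rewrite linearZ /=.
    by have [_ ->] := IH e i (twf e i).
  + rewrite -[RHS](sf_m F (Snoc Nil f) e) -[in RHS]pp linear_sum.
    by apply: eq_bigr => i _; rewrite linearZ /= psi_tmap.1.
- move=> x y e G IH [flE ee G2 Gwf]; have [FGwf Gc] := IH Gwf.
  split=> [|e']; first by rewrite /= fdeg_fmap flen_fmap.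
  apply: (mono _ _ _ _ G) => //.
    by rewrite op_emb2 // /tree_prod flE ee eqxx.
  by rewrite ee /wout wdeg_emb wlen_emb.
- move=> x y z p q e a IHa g IHg [flE ee gg awf gwf].
  have [Fawf ac] := IHa awf; have [Fgwf gc] := IHg gwf.
  split=> [|e']; first by rewrite /= is_gen_tmap.
  apply: (mono _ _ _ _ (FSnoc (FSnoc FNil a) g)) => //=.
  + by rewrite (op_dg flE) mul_gen // ee eqxx.
  + by rewrite ee /wout /=; lia.
  + by split=> [|e'']; [split=> [|e'']|]; rewrite ?Vmap_bas /free_d ?flin_bas ?ac ?gc.
- by [].
move=> x y z p G IHG t IHt [/IHG[FGwf Gc] /IHt[Ftwf tc]] /=.
by split=> //; split=> // e; rewrite Vmap_bas /free_d !flin_bas tc.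
Qed.

End Functor.

Section CofibrantModelFunctor.
Variables (R : comPzRingType) (A B : ainf R) (F : sfun A B) (fl : flavour).
Variables (Afl : has_flavour fl (AInf A)) (Bfl : has_flavour fl (AInf B)).
Notation CA := (AInf (cm_on Afl)).
Notation CB := (AInf (cm_on Bfl)).

Lemma Vmap_wf x y n (v : cm_hom A fl x y n) :
  Vmap F (cm_val v) \in fspan (@tree_wf R B B fl (F x) (F y) n).
Proof.
apply: flin_span (cm_val_wf v) _ => t twf; apply: fbas_span.
by have [] := (tmap_wf F fl).1 x y n t twf.
Qed.

Definition cm_map x y n (v : cm_hom A fl x y n) : cm_hom B fl (F x) (F y) n :=
  FSub (Vmap_wf v).

Lemma cm_val_map x y n (v : cm_hom A fl x y n) : cm_val (cm_map v) = Vmap F (cm_val v).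
Proof. by []. Qed.

Lemma cm_map_linear x y n : linear (@cm_map x y n).
Proof. by move=> a u v; apply: cm_val_inj; rewrite linearP !cm_val_map !linearP. Qed.
HB.instance Definition _ x y n := GRing.isLinear.Build R (cm_hom A fl x y n)
  (cm_hom B fl (F x) (F y) n) _ (@cm_map x y n) (@cm_map_linear x y n).

Lemma wcomm_val x y (s : word (cm_hom A fl) x y) :
  wcomm F fl (wmap (W := V0 (ainf_hom A)) (F0 := id) (fun x y n v => cm_val v) s).
Proof.
elim: s => //= {}y z p s IH v; split=> // e.
rewrite [LHS]linear_comp_flin [RHS]linear_comp_flin.
apply: (flin_eq (cm_val_wf v)) => t twf.
rewrite [RHS]flin_bas; exact: ((tmap_wf F fl).1 y z p t twf).2 e.
Qed.

Lemma cm_map_m x y (s : word (cm_hom A fl) x y) e :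
  cm_map (cm_m Afl s e) =
  cm_m Bfl (wmap (W := cm_hom B fl) (F0 := F) (fun x y n f => cm_map f) s) e.
Proof.
apply: cm_val_inj; rewrite cm_val_map !cm_val_m wcomm_op; last exact: wcomm_val.
by rewrite !wmap_comp.
Qed.

Definition cm_fun : sfun CA CB :=
  @SFun R CA CB F (fun x y n => @cm_map x y n) cm_map_m.

Lemma cm_psi_map x y n (v : cm_hom A fl x y n) :
  cm_psi (cm_map v) = sf_hom F n (cm_psi v).
Proof. exact: Psi_Vmap. Qed.

End CofibrantModelFunctor.

Lemma tmap_id (R : comPzRingType) (A : ainf R) :
  (forall x y n (t : tree (ainf_hom A) x y n), tmap (sid A) t = t) /\
  (forall x y (G : forest (ainf_hom A) x y), fmap (sid A) G = G).
Proof.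
apply: tree_forest_ind => //=.
- move=> x y n k c t IH f; congr Gen.
  by apply: functional_extensionality_dep => e; apply: funext => i; exact: IH.
- by move=> x y e G ->.
- by move=> x y z p q e a -> g ->.
- by move=> x y z p G -> t ->.
Qed.

Lemma tmap_comp (R : comPzRingType) (A B C : ainf R) (G : sfun B C) (F : sfun A B) :
  (forall x y n (t : tree (ainf_hom A) x y n),
     tmap (scomp G F) t = tmap G (tmap F t)) /\
  (forall x y (S : forest (ainf_hom A) x y),
     fmap (scomp G F) S = fmap G (fmap F S)).
Proof.
apply: tree_forest_ind => //=.
- move=> x y n k c t IH f; congr Gen.
  by apply: functional_extensionality_dep => e; apply: funext => i; exact: IH.
- by move=> x y e S ->.
- by move=> x y z p q e a -> g ->.
- by move=> x y z p S -> t ->.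
Qed.

(** * Assembly over the categories of the given unitality and flavour *)

Section ForAInf.
Variables (R : comPzRingType) (fl : flavour).

(** For a variable [A], the record [AInf A] rebuilt from its structure is not convertible to [A].
    The projection is therefore restated with target [A], and results are carried over by
    destructing [A]. *)
Definition cm (A : ainf R) (Afl : has_flavour fl A) : ainf_on R A :=
  cm_on (Afl : has_flavour fl (AInf A)).

Definition cm_proj (A : ainf R) (Afl : has_flavour fl A) : sfun (AInf (cm Afl)) A :=
  @SFun R (AInf (cm Afl)) A id (fun x y n => @cm_psi R A A fl x y n)
    (cm_psi_m (Afl := Afl)).

Lemma cm_proj_surj A (Afl : has_flavour fl A) : surjective_on_morphisms (cm_proj Afl).
Proof. by move=> x y n g; exact: (cm_psi_surj (Afl : has_flavour fl (AInf A))). Qed.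

Lemma cm_proj_quasi_equivalence A (Afl : has_flavour fl A) :
  quasi_equivalence (cm_proj Afl).
Proof. by case: A Afl => O A Afl; exact: cm_quasi_equivalence. Qed.

Lemma cm_proj_coh_unital A (Afl : has_flavour fl A) : coh_unital_fun (cm_proj Afl).
Proof. by case: A Afl => O A Afl; exact: cm_Psi_coh_unital. Qed.

Lemma cm_has_unitality u A (Afl : has_flavour fl A) :
  has_unitality u A -> has_unitality u (AInf (cm Afl)).
Proof.
case: A Afl => O A Afl; case: u => //=; [exact: cm_coh_unital | exact: cm_unital].
Qed.

Lemma cm_proj_reflect A (Afl : has_flavour fl A) (x : A)
    (u : @ghom R (cohomology_cat (AInf (cm Afl))) x x 0) :
  @is_unit R (cohomology_cat A) x (gf_hom (cohomology_fun (cm_proj Afl)) 0 u) ->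
  is_unit u.
Proof. by case: A Afl x u => O A Afl x u /(is_unit_hP (Afl := Afl)). Qed.

(** Psi F^cm = F Psi sends units to units, and the projection of the target reflects them. *)
Lemma cm_fun_coh_unital A B (Afl : has_flavour fl A) (Bfl : has_flavour fl B)
    (F : sfun A B) : coh_unital_fun F ->
  coh_unital_fun (cm_fun F Afl Bfl : sfun (AInf (cm Afl)) (AInf (cm Bfl))).
Proof.
move=> Fu x u uP; apply: (@cm_proj_reflect B Bfl (F x)).
have := Fu _ _ (cm_proj_coh_unital uP); congr is_unit.
rewrite /= -[u]hreprK !hmapE; congr hclass; apply: val_inj => /=.
exact/esym/cm_psi_map.
Qed.

Lemma cm_proj_star_mor u A (Afl : has_flavour fl A) : star_mor u (cm_proj Afl).
Proof. by case: u => //=; exact: cm_proj_coh_unital. Qed.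

Lemma cm_fun_star_mor u A B (Afl : has_flavour fl A) (Bfl : has_flavour fl B)
    (F : sfun A B) : star_mor u F ->
  star_mor u (cm_fun F Afl Bfl : sfun (AInf (cm Afl)) (AInf (cm Bfl))).
Proof. by case: u => //=; exact: cm_fun_coh_unital. Qed.
End ForAInf.

Theorem theoremB (R : comPzRingType) (u : unitality) (k : flavour) :
  exists (cm : forall A : star_cat R u k, ainf_on R A)
         (cm_unitality : forall A : star_cat R u k, has_unitality u (AInf (cm A)))
         (cm_flavour : forall A : star_cat R u k, has_flavour k (AInf (cm A))),
  let CM (A : star_cat R u k) : star_cat R u k :=
    StarCat (cm_unitality A) (cm_flavour A) in
  exists (Psi : forall A : star_cat R u k, star_fun (CM A) A)
         (cmF : forall A B : star_cat R u k,
            star_fun A B -> star_fun (CM A) (CM B)),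
    (forall A : star_cat R u k, cofibrant_morphisms (CM A)) /\
    (forall (A : star_cat R u k) (x : A), Psi A x = x) /\
    (forall A : star_cat R u k, surjective_on_morphisms (Psi A)) /\
    (forall A : star_cat R u k, quasi_equivalence (Psi A)) /\
    (forall A : star_cat R u k, cmF A A (star_id A) = star_id (CM A)) /\
    (forall (A B C : star_cat R u k) (G : star_fun B C) (F : star_fun A B),
       cmF A C (star_comp G F) = star_comp (cmF B C G) (cmF A B F)) /\
    (forall (A B : star_cat R u k) (F : star_fun A B),
       star_comp (Psi B) (cmF A B F) = star_comp F (Psi A)).
Proof.
exists (fun A => cm (star_flavour A)).
exists (fun A => cm_has_unitality (star_flavour A) (star_unitality A)).
exists (fun A => cm_flavour (star_flavour A)) => CM.
exists (fun A => @StarFun R u k (CM A) A _ (cm_proj_star_mor u (star_flavour A))).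
exists (fun A B F => @StarFun R u k (CM A) (CM B) _
  (cm_fun_star_mor (star_flavour A) (star_flavour B) (star_funP F))).
split; first by move=> A; exact: cm_cofibrant.
split; first by [].
split; first by move=> A; exact: cm_proj_surj.
split; first by move=> A; exact: cm_proj_quasi_equivalence.
split.
  (* Equality of strict functors with the same object map reduces to their linear maps, and by
     linearity to single trees, where it is syntactic. *)
  move=> A; apply: star_fun_eq; apply: sfun_eq => x y n v; apply: cm_val_inj.
  rewrite cm_val_map /= -[RHS]flin_fbas; apply: (flin_eq (fspanT _)) => t _.
  by rewrite (tmap_id A).1.
split.
  move=> A B C G F; apply: star_fun_eq; apply: sfun_eq => x y n v; apply: cm_val_inj.
  transitivity (Vmap G (Vmap F (cm_val v))) => //.
  rewrite [RHS]linear_comp_flin; apply: (flin_eq (fspanT _)) => t _.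
  by rewrite [RHS]Vmap_bas (tmap_comp G F).1.
move=> A B F; apply: star_fun_eq; apply: sfun_eq => x y n v.
exact: (@cm_psi_map R A B F k x y n v).
Qed.
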